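(* Let $f:\mathbb{C}\to\mathbb{C}$ be a nonconstant entire function and $b$ a nonzero complex number. If $f$ and its derivative $f'$ share the value $b$ allowing ramification, then $b$ cannot be a totally ramified value of $f$.
   Context: Definition. For a meromorphic function $f$ on a domain $D$ and a nonzero complex number $b$, $f$ and $f'$ share the value $b$ allowing ramification if for all $z\in D$: $f(z)=b$ implies $f'(z)\in\{b,0\}$, and $f'(z)=b$ implies $f(z)=b$. (Here $D=\mathbb{C}$.) A value $b\in\mathbb{C}$ is a totally ramified value of the entire function $f$ if every $b$-point of $f$ (point $z$ with $f(z)=b$) is multiple, i.e. $f(z)=b$ implies $f'(z)=0$; this includes vacuously the case that $f$ omits the value $b$. *)

(* Defs.v *)
From Stdlib Require Import Reals.
From Coquelicot Require Import Coquelicot.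

Definition entire (f : C -> C) : Prop := forall z : C, ex_derive f z.

(* [C_derive] computes its limit along the real direction only; it is the
   complex derivative wherever [f] is complex differentiable (see
   [C_derive_correct]), so the two predicates below are meant for entire [f]. *)

(* The domain D is the whole plane, and [f] has no poles. *)
Definition share_allowing_ramification (f : C -> C) (b : C) : Prop :=
  forall z : C,
    (f z = b -> C_derive f z = b \/ C_derive f z = RtoC 0) /\
    (C_derive f z = b -> f z = b).

(* Holds vacuously when [f] omits [b]. *)
Definition totally_ramified_value (f : C -> C) (b : C) : Prop :=
  forall z : C, f z = b -> C_derive f z = RtoC 0.

(* Main.v *)
Require Import Defs.
From Stdlib Require Import Reals ZArith Lra Lia Psatz Classical ClassicalEpsilon.
From Coquelicot Require Import Coquelicot.
Open Scope C_scope.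

(** If [b] is totally ramified, then [f' = b] would force [f = b] and hence [f' = 0]; so [f'] omits
    [b], and [F = f / b - 1] is an entire function all of whose zeros are multiple and whose
    derivative omits 1. The proof shows that such an [F] is constant ([exceptional_constant]).

    The model case is instructive. If [F] had exponential type, then [F' = 1 + exp (c z + d)], so
    [F] is [z + k + exp (c z + d) / c], or affine when [c = 0]. The zeros of the former are simple
    with at most one exception, and there are infinitely many of them; a nonconstant affine function
    has a simple zero. So the point is to reduce to this case, in the manner of Bloch's principle:
    the class is invariant under [F |-> m F (a + z / m)], and such a rescaling at a suitable point
    ([doubling_point]) gives a function [G] with [|G'| <= 1 + 4 |G|^2] on a disc as large as one
    wants, and with equality [|G'(0)| = 1 + |G(0)|^2] at the centre.

    For such a [G] everything is explicit, and no limit function is extracted. Its value at the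
    centre is bounded ([centre_bound]); it has exponential growth ([exponential_growth], after Clunie
    and Hayman); therefore [G' - 1 = exp g] with [g] nearly affine on a large disc
    ([linearisation]); and so [G] is close to one of the model functions, whose simple zeros persist
    and contradict the hypothesis once the disc is larger than an absolute constant
    ([no_normalised_exceptional]).

    The function theory behind these estimates rests on Goursat's theorem for rectangles, which
    yields a mean value bound on circles ([mean_value_bound]) and primitives on discs
    ([holo_primitive]). From the former follow the Schwarz lemma at the centre of a disc, the Cauchy
    estimates, the differentiability of [f'] and the existence of zeros by the minimum modulus
    principle; from the latter, logarithms. The sharp estimate for the derivative of a function with
    positive real part ([pos_re_derivative]), and Harnack's inequality which integrates it, control
    logarithms of zero-free functions. *)

(** * Complex differentiation *)

(** The target carries the structure of [C] as a module over itself, so that the product and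
    composition rules for derivatives apply. The definition of an entire function uses the product
    structure on the target instead; [cder_C_NormedModule] passes from one to the other. *)
Definition cder (f : C -> C) (z l : C) : Prop :=
  @is_derive C_AbsRing (AbsRing_NormedModule C_AbsRing) f z l.

Lemma Cmod_minus_sym (x y : C) : Cmod (x - y) = Cmod (y - x).
Proof. rewrite <- Cmod_opp. f_equal. ring. Qed.

Lemma Cmod_triangle_rev (x y : C) : (Cmod x - Cmod y <= Cmod (x - y))%R.
Proof.
  assert (H := Cmod_triangle (x - y) y).
  replace (x - y + y) with x in H by ring. lra.
Qed.

Lemma Cmod_triangle_minus (x y : C) : (Cmod (x - y) <= Cmod x + Cmod y)%R.
Proof. rewrite <- (Cmod_opp y). apply Cmod_triangle. Qed.

Lemma Cmod_triangle3 (x y z : C) : (Cmod (x - z) <= Cmod (x - y) + Cmod (y - z))%R.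
Proof. replace (x - z) with ((x - y) + (y - z)) by ring. apply Cmod_triangle. Qed.

Lemma cder_eps (f : C -> C) (z l : C) : cder f z l <->
  forall eps : posreal, exists del : posreal, forall w, (Cmod (w - z) < del)%R ->
   (Cmod (f w - f z - l * (w - z)) <= eps * Cmod (w - z))%R.
Proof.
  assert (E : forall w, minus (minus (f w) (f z)) (scal (minus w z) l)
                        = f w - f z - l * (w - z)).
  { intros w. change (f w - f z - (w - z) * l = f w - f z - l * (w - z)). ring. }
  split.
  - intros [_ H] eps. destruct (H z (fun P HP => HP) eps) as [d Hd].
    exists d. intros w Hw. specialize (Hd w Hw). rewrite <- E. exact Hd.
  - intros H. split. apply @is_linear_scal_l.
    intros x Hx. apply (@is_filter_lim_locally_unique C_AbsRing (AbsRing_NormedModule C_AbsRing)) in Hx. subst x.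
    intros eps. destruct (H eps) as [d Hd]. exists d. intros w Hw.
    specialize (Hd w Hw). rewrite <- E in Hd. exact Hd.
Qed.

Lemma cder_C_NormedModule (f : C -> C) (z l : C) :
  @is_derive C_AbsRing C_NormedModule f z l <-> cder f z l.
Proof.
  assert (E : forall w, @minus C_AbelianGroup (@minus C_AbelianGroup (f w) (f z))
                 (@scal C_AbsRing C_NormedModule (@minus C_AbelianGroup w z) l)
                        = f w - f z - l * (w - z)).
  { intros w. change (f w - f z - (w - z) * l = f w - f z - l * (w - z)). ring. }
  rewrite cder_eps. split.
  - intros [_ H] eps. destruct (H z (fun P HP => HP) eps) as [d Hd].
    exists d. intros w Hw. specialize (Hd w Hw).
    rewrite <- E. exact Hd.
  - intros H. split. apply @is_linear_scal_l.
    intros x Hx. apply (@is_filter_lim_locally_unique C_AbsRing (AbsRing_NormedModule C_AbsRing)) in Hx. subst x.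
    intros eps. destruct (H eps) as [d Hd]. exists d. intros w Hw.
    specialize (Hd w Hw). rewrite <- E in Hd. exact Hd.
Qed.

Lemma cder_unique f z l : cder f z l -> C_derive f z = l.
Proof. intros H. apply is_C_derive_unique, cder_C_NormedModule, H. Qed.

Lemma cder_eq f z l l' : cder f z l -> l = l' -> cder f z l'.
Proof. intros H E. subst. exact H. Qed.

Lemma cder_const (a z : C) : cder (fun _ => a) z 0.
Proof. apply (is_derive_const (K := C_AbsRing) (V := AbsRing_NormedModule C_AbsRing)). Qed.

Lemma cder_id (z : C) : cder (fun w => w) z 1.
Proof. apply (is_derive_id (K := C_AbsRing)). Qed.

Lemma cder_plus (f g : C -> C) (z a b : C) : cder f z a -> cder g z b -> cder (fun w => f w + g w) z (a + b).
Proof. apply (is_derive_plus (K := C_AbsRing) (V := AbsRing_NormedModule C_AbsRing)). Qed.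

Lemma cder_minus (f g : C -> C) (z a b : C) : cder f z a -> cder g z b -> cder (fun w => f w - g w) z (a - b).
Proof. apply (is_derive_minus (K := C_AbsRing) (V := AbsRing_NormedModule C_AbsRing)). Qed.

Lemma cder_mult (f g : C -> C) (z a b : C) : cder f z a -> cder g z b ->
  cder (fun w => f w * g w) z (a * g z + f z * b).
Proof.
  intros Hf Hg. apply (is_derive_mult (K := C_AbsRing)); auto.
  intros; apply Cmult_comm.
Qed.

Lemma cder_scal k f z a : cder f z a -> cder (fun w => k * f w) z (k * a).
Proof.
  intros H. eapply cder_eq. apply cder_mult. apply cder_const. exact H. cbv beta. ring.
Qed.

Lemma cder_comp (f g : C -> C) (z a b : C) : cder f (g z) a -> cder g z b ->
  cder (fun w => f (g w)) z (a * b).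
Proof.
  intros Hf Hg. eapply cder_eq.
  apply (is_derive_comp (K := C_AbsRing) (V := AbsRing_NormedModule C_AbsRing)); eauto.
  apply Cmult_comm.
Qed.

Lemma cder_shift f a z l : cder f (z + a) l -> cder (fun w => f (w + a)) z l.
Proof.
  intros H. eapply cder_eq. apply (cder_comp f (fun w => w + a)). exact H.
  apply cder_plus. apply cder_id. apply cder_const. ring.
Qed.

Lemma cder_ext_near f g z l (r : R) : (0 < r)%R ->
  (forall w, (Cmod (w - z) < r)%R -> f w = g w) -> cder f z l -> cder g z l.
Proof.
  intros Hr E. apply is_derive_ext_loc. exists (mkposreal r Hr). intros w Hw.
  apply E, Hw.
Qed.

Lemma cder_ext f g z l : (forall w, f w = g w) -> cder f z l -> cder g z l.
Proof. intros E. apply (cder_ext_near _ _ _ _ 1); [lra | auto]. Qed.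

Definition ccont (f : C -> C) (z : C) : Prop :=
  forall eps : R, (0 < eps)%R -> exists del : R, (0 < del)%R /\
    forall w, (Cmod (w - z) < del)%R -> (Cmod (f w - f z) < eps)%R.

Lemma cder_ccont f z l : cder f z l -> ccont f z.
Proof.
  intros H eps He. destruct (proj1 (cder_eps f z l) H (mkposreal 1 Rlt_0_1)) as [d Hd].
  simpl in Hd. assert (0 <= Cmod l)%R by apply Cmod_ge_0.
  exists (Rmin d (eps / (2 + Cmod l))). split.
  - apply Rmin_pos. apply cond_pos. apply Rdiv_lt_0_compat; lra.
  - intros w Hw.
    assert (H1 : (Cmod (w - z) < d)%R) by (eapply Rlt_le_trans; [exact Hw|apply Rmin_l]).
    assert (H2 : (Cmod (w - z) < eps / (2 + Cmod l))%R) by (eapply Rlt_le_trans; [exact Hw|apply Rmin_r]).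
    specialize (Hd w H1).
    replace (f w - f z) with ((f w - f z - l * (w - z)) + l * (w - z)) by ring.
    eapply Rle_lt_trans. apply Cmod_triangle. rewrite Cmod_mult.
    assert (0 <= Cmod (w - z))%R by apply Cmod_ge_0.
    apply (Rmult_lt_compat_l (2 + Cmod l)) in H2; [|lra].
    replace ((2 + Cmod l) * (eps / (2 + Cmod l)))%R with eps in H2 by (field; lra).
    nra.
Qed.

Lemma cder_inv_at (z : C) : z <> 0 -> cder Cinv z (- / (z * z)).
Proof.
  intros Hz. apply cder_eps. intros eps.
  assert (Hm : (0 < Cmod z)%R) by now apply Cmod_gt_0.
  assert (He := cond_pos eps).
  assert (Hd : (0 < Rmin (Cmod z / 2) (eps * (Cmod z * Cmod z * Cmod z) / 2))%R).
  { apply Rmin_pos. lra. apply Rdiv_lt_0_compat; [|lra].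
    repeat apply Rmult_lt_0_compat; lra. }
  exists (mkposreal _ Hd). intros w Hw. simpl in Hw.
  assert (H1 : (Cmod (w - z) < Cmod z / 2)%R) by (eapply Rlt_le_trans; [exact Hw|apply Rmin_l]).
  assert (H2 : (Cmod (w - z) < eps * (Cmod z * Cmod z * Cmod z) / 2)%R) by (eapply Rlt_le_trans; [exact Hw|apply Rmin_r]).
  assert (H3 : (Cmod z / 2 < Cmod w)%R).
  { assert (H := Cmod_triangle_rev z w). rewrite Cmod_minus_sym in H. lra. }
  assert (Hw0 : w <> 0) by (apply Cmod_gt_0; lra).
  replace (/ w - / z - - / (z * z) * (w - z)) with ((w - z) * (w - z) / (w * (z * z))) by (field; auto).
  assert (Hzz : w * (z * z) <> 0) by (repeat apply Cmult_neq_0; auto).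
  rewrite Cmod_div by auto. rewrite !Cmod_mult.
  assert (Hq : (0 < Cmod w * (Cmod z * Cmod z))%R) by (repeat apply Rmult_lt_0_compat; lra).
  apply Rmult_le_reg_r with (1 := Hq). unfold Rdiv. rewrite Rmult_assoc, Rinv_l, Rmult_1_r by lra.
  rewrite (Rmult_comm eps), !Rmult_assoc. apply Rmult_le_compat_l. apply Cmod_ge_0.
  assert (0 < Cmod z * Cmod z)%R by nra.
  assert (eps * (Cmod z * Cmod z) * (Cmod z / 2) <= eps * (Cmod z * Cmod z) * Cmod w)%R.
  { apply Rmult_le_compat_l; [|lra]. apply Rmult_le_pos; lra. }
  lra.
Qed.

Lemma cder_inv (f : C -> C) (z a : C) : f z <> 0 -> cder f z a -> cder (fun w => / f w) z (- a / (f z * f z)).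
Proof.
  intros H Hf. eapply cder_eq. apply (cder_comp Cinv f). apply cder_inv_at, H. exact Hf.
  field. auto.
Qed.

Lemma cder_div (f g : C -> C) (z a b : C) : g z <> 0 -> cder f z a -> cder g z b ->
  cder (fun w => f w / g w) z ((a * g z - f z * b) / (g z * g z)).
Proof.
  intros H Hf Hg. eapply cder_eq. apply cder_mult. exact Hf. apply cder_inv; eauto.
  simpl. field. auto.
Qed.

(** Brings monotonicity and mean value arguments of real calculus to bear on [f]: with [u = 1]
    on its real part, with [u = - Ci] on its imaginary part, with other [u] on its component in a
    chosen direction. *)
Lemma cder_Re_line f (u z h : C) (t : R) l : cder f (z + t * h) l ->
  is_derive (fun s : R => Re (u * f (z + s * h))) t (Re (u * (l * h))).
Proof.
  intros H. apply is_derive_Reals. intros eps He.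
  set (k := (Cmod u * Cmod h + 1)%R).
  assert (Hk : (0 < k)%R).
  { unfold k. assert (0 <= Cmod u * Cmod h)%R by (apply Rmult_le_pos; apply Cmod_ge_0). lra. }
  assert (He2 : (0 < eps / (2 * k))%R) by (apply Rdiv_lt_0_compat; lra).
  destruct (proj1 (cder_eps _ _ _) H (mkposreal _ He2)) as [d Hd]. simpl in Hd.
  assert (Hd2 : (0 < d / (Cmod h + 1))%R).
  { apply Rdiv_lt_0_compat. apply cond_pos. assert (0 <= Cmod h)%R by apply Cmod_ge_0. lra. }
  exists (mkposreal _ Hd2). intros s Hs Hsd. simpl in Hsd.
  assert (Hh := Cmod_ge_0 h). assert (Hu := Cmod_ge_0 u).
  specialize (Hd (z + (t + s)%R * h)).
  replace (z + (t + s)%R * h - (z + t * h)) with (RtoC s * h) in Hd.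
  2:{ rewrite RtoC_plus. ring. }
  rewrite Cmod_mult, Cmod_R in Hd.
  assert (Hs0 : (0 < Rabs s)%R) by now apply Rabs_pos_lt.
  assert (Hlt : (Rabs s * Cmod h < d)%R).
  { apply (Rmult_lt_compat_r (Cmod h + 1)) in Hsd; [|lra].
    replace (d / (Cmod h + 1) * (Cmod h + 1))%R with (pos d) in Hsd by (field; lra). nra. }
  specialize (Hd Hlt).
  assert (E : ((Re (u * f (z + (t + s)%R * h)%C) - Re (u * f (z + t * h)%C)) / s - Re (u * (l * h)) =
     Re (u * (f (z + (t + s)%R * h)%C - f (z + t * h)%C - l * (RtoC s * h))) / s)%R).
  { destruct u as [u1 u2], h as [h1 h2], l as [l1 l2].
    generalize (f (z + (t + s)%R * (h1, h2))) (f (z + t * (h1, h2))). intros [a1 a2] [b1 b2].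
    simpl. field. auto. }
  rewrite E. rewrite Rabs_div by auto.
  apply Rmult_lt_reg_r with (Rabs s); [auto|].
  unfold Rdiv. rewrite Rmult_assoc, Rinv_l, Rmult_1_r by lra.
  eapply Rle_lt_trans. apply re_le_Cmod. rewrite Cmod_mult.
  eapply Rle_lt_trans. apply Rmult_le_compat_l; [auto|exact Hd].
  replace (Cmod u * (eps / (2 * k) * (Rabs s * Cmod h)))%R
    with ((Cmod u * Cmod h) * (eps / (2 * k) * Rabs s))%R by ring.
  apply Rle_lt_trans with (k * (eps / (2 * k) * Rabs s))%R.
  - apply Rmult_le_compat_r. apply Rmult_le_pos; lra. unfold k; lra.
  - replace (k * (eps / (2 * k) * Rabs s))%R with (eps / 2 * Rabs s)%R by (field; lra). nra.
Qed.

(** A mean value theorem holds for the real component of [f] in the direction of the increment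
    [f (z + h) - f z], and that component sees the full length of the increment. *)
Lemma segment_bound f (df : C -> C) z h (L : R) :
  (forall t : R, (0 <= t <= 1)%R -> cder f (z + t * h) (df (z + t * h)) /\ Cmod (df (z + t * h)) <= L) ->
  Cmod (f (z + h) - f z) <= (L * Cmod h)%R.
Proof.
  intros H. set (d := f (z + h) - f z).
  destruct (Ceq_dec d 0) as [E|N].
  { rewrite E, Cmod_0. apply Rmult_le_pos; [|apply Cmod_ge_0].
    eapply Rle_trans; [apply Cmod_ge_0|apply (proj2 (H 0%R ltac:(lra)))]. }
  assert (Hd : (0 < Cmod d)%R) by now apply Cmod_gt_0.
  destruct (MVT_gen (fun s : R => Re (Cconj d * f (z + s * h))) 0 1
     (fun s => Re (Cconj d * (df (z + s * h) * h)))) as [c [Hc E]].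
  - intros x Hx. rewrite Rmin_left, Rmax_right in Hx by lra.
    apply cder_Re_line, H; lra.
  - intros x Hx. rewrite Rmin_left, Rmax_right in Hx by lra.
    apply continuity_pt_filterlim, (ex_derive_continuous (K := R_AbsRing) (V := R_NormedModule)).
    eexists. apply cder_Re_line, H; lra.
  - rewrite Rmin_left, Rmax_right in Hc by lra.
    destruct (H c Hc) as [_ HL].
    replace (z + 1%R * h) with (z + h) in E by ring.
    replace (z + 0%R * h) with z in E by ring.
    assert (E2 : (Cmod d * Cmod d)%R = Re (Cconj d * (df (z + c * h) * h))).
    { rewrite Rminus_0_r, Rmult_1_r in E. rewrite <- E.
      transitivity (Re (Cconj d * d)).
      - rewrite Cmult_comm. rewrite <- Cmod2_conj. simpl. ring.
      - transitivity (Re (Cconj d * (f (z + h) - f z))). reflexivity.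
        destruct (Cconj d), (f (z + h)), (f z). simpl. ring. }
    assert (H3 := re_le_Cmod (Cconj d * (df (z + c * h) * h))).
    rewrite <- E2, !Cmod_mult, Cmod_conj in H3.
    rewrite Rabs_pos_eq in H3 by nra.
    assert (Hh := Cmod_ge_0 h).
    apply Rmult_le_reg_l with (Cmod d); [auto|].
    eapply Rle_trans; [exact H3|]. apply Rmult_le_compat_l; [lra|].
    apply Rmult_le_compat_r; auto.
Qed.

(** * Integrals along lines *)

Lemma continuous_path_eps (g : R -> C) (t : R) :
  (forall eps : R, 0 < eps -> exists d : R, 0 < d /\
     forall s, Rabs (s - t) < d -> Cmod (g s - g t) < eps) ->
  continuous (U := C_R_NormedModule) g t.
Proof.
  intros H P [eps HP]. destruct (H eps (cond_pos eps)) as [d [Hd Hg]].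
  exists (mkposreal d Hd). intros s Hs. apply HP.
  specialize (Hg s Hs).
  assert (H1 := re_le_Cmod (g s - g t)).
  assert (H2 := Rmax_Cmod (g s - g t)).
  split.
  - eapply Rle_lt_trans; [|exact Hg]. eapply Rle_trans; [|exact H2]. apply Rmax_l.
  - eapply Rle_lt_trans; [|exact Hg]. eapply Rle_trans; [|exact H2]. apply Rmax_r.
Qed.

Lemma ccont_line f z h (t : R) : ccont f (z + t * h) ->
  continuous (U := C_R_NormedModule) (fun s : R => f (z + s * h)) t.
Proof.
  intros H. apply continuous_path_eps. intros eps He.
  destruct (H eps He) as [d [Hd Hf]].
  assert (Hh := Cmod_ge_0 h).
  exists (d / (Cmod h + 1))%R. split. apply Rdiv_lt_0_compat; lra.
  intros s Hs. apply Hf.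
  replace (z + s * h - (z + t * h)) with (RtoC (s - t) * h) by (rewrite RtoC_minus; ring).
  rewrite Cmod_mult, Cmod_R.
  apply (Rmult_lt_compat_r (Cmod h + 1)) in Hs; [|lra].
  replace (d / (Cmod h + 1) * (Cmod h + 1))%R with d in Hs by (field; lra).
  assert (0 <= Rabs (s - t))%R by apply Rabs_pos. nra.
Qed.

Definition line_int (f : C -> C) (z h : C) (a b : R) : C :=
  RInt (V := C_R_CompleteNormedModule) (fun t : R => h * f (z + t * h)) a b.

Definition cont_on_line (f : C -> C) (z h : C) (a b : R) : Prop :=
  forall t : R, Rmin a b <= t <= Rmax a b -> ccont f (z + t * h).

Lemma ccont_scal k f z : ccont f z -> ccont (fun w => k * f w) z.
Proof.
  intros H eps He. assert (Hh := Cmod_ge_0 k).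
  destruct (H (eps / (Cmod k + 1))%R) as [d [Hd Hf]].
  apply Rdiv_lt_0_compat; lra.
  exists d. split; [exact Hd|]. intros w Hw. specialize (Hf w Hw).
  replace (k * f w - k * f z) with (k * (f w - f z)) by ring.
  rewrite Cmod_mult.
  apply (Rmult_lt_compat_l (Cmod k + 1)) in Hf; [|lra].
  replace ((Cmod k + 1) * (eps / (Cmod k + 1)))%R with eps in Hf by (field; lra).
  assert (H0 := Cmod_ge_0 (f w - f z)). nra.
Qed.

Lemma ex_line_int f z h a b : cont_on_line f z h a b ->
  ex_RInt (V := C_R_CompleteNormedModule) (fun t : R => h * f (z + t * h)) a b.
Proof.
  intros H. apply (ex_RInt_continuous (V := C_R_CompleteNormedModule)).
  intros t Ht. apply (ccont_line (fun w => h * f w)), ccont_scal, H, Ht.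
Qed.

Lemma line_int_Chasles f z h (a b c : R) :
  cont_on_line f z h a b -> cont_on_line f z h b c ->
  line_int f z h a c = line_int f z h a b + line_int f z h b c.
Proof.
  intros H1 H2. unfold line_int. symmetry.
  apply (RInt_Chasles (V := C_R_CompleteNormedModule)); apply ex_line_int; auto.
Qed.

Lemma cont_on_line_swap f z h (a b : R) : cont_on_line f z h a b -> cont_on_line f z h b a.
Proof. intros H t. rewrite Rmin_comm, Rmax_comm. apply H. Qed.

Lemma line_int_swap f z h (a b : R) : cont_on_line f z h a b ->
  line_int f z h b a = - line_int f z h a b.
Proof.
  intros H. assert (E := line_int_Chasles f z h a b a H (cont_on_line_swap _ _ _ _ _ H)).
  assert (E0 : line_int f z h a a = 0) by apply (RInt_point (V := C_R_CompleteNormedModule)).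
  rewrite E0 in E.
  replace (line_int f z h b a) with ((line_int f z h a b + line_int f z h b a) - line_int f z h a b) by ring.
  rewrite <- E. ring.
Qed.

Lemma line_int_ext f g z h (a b : R) : a <= b ->
  (forall t : R, a <= t <= b -> f (z + t * h) = g (z + t * h)) ->
  line_int f z h a b = line_int g z h a b.
Proof.
  intros Hab E. unfold line_int. apply (RInt_ext (V := C_R_CompleteNormedModule)).
  intros x. rewrite Rmin_left, Rmax_right by lra. intros Hx. f_equal. apply E. lra.
Qed.

Lemma line_int_minus f g z h (a b : R) :
  cont_on_line f z h a b -> cont_on_line g z h a b ->
  line_int (fun w => f w - g w) z h a b = line_int f z h a b - line_int g z h a b.
Proof.
  intros Hf Hg. unfold line_int.
  transitivity (RInt (V := C_R_CompleteNormedModule)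
    (fun t : R => h * f (z + t * h) - h * g (z + t * h)) a b).
  - apply (RInt_ext (V := C_R_CompleteNormedModule)). intros x _.
    match goal with |- ?a = ?b => change (@eq C a b) end. ring.
  - apply (RInt_minus (V := C_R_CompleteNormedModule)
    (fun t : R => h * f (z + t * h)) (fun t : R => h * g (z + t * h))); apply ex_line_int; auto.
Qed.

Lemma line_int_bound f z h (a b M : R) : a <= b -> cont_on_line f z h a b ->
  (forall t : R, a <= t <= b -> Cmod (f (z + t * h)) <= M) ->
  Cmod (line_int f z h a b) <= (b - a) * (Cmod h * M).
Proof.
  intros Hab Hc HM.
  rewrite Cmod_norm.
  apply (norm_RInt_le_const (V := C_R_NormedModule) (fun t : R => h * f (z + t * h)) a b).
  - exact Hab.
  - intros x Hx. eapply Rle_trans; [right; symmetry; apply Cmod_norm|].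
    rewrite Cmod_mult. apply Rmult_le_compat_l; [apply Cmod_ge_0|apply HM, Hx].
  - apply (RInt_correct (V := C_R_CompleteNormedModule)). apply ex_line_int, Hc.
Qed.

Lemma line_int_bound_abs f z h (a b M : R) : cont_on_line f z h a b ->
  (forall t : R, Rmin a b <= t <= Rmax a b -> Cmod (f (z + t * h)) <= M) ->
  Cmod (line_int f z h a b) <= Rabs (b - a) * (Cmod h * M).
Proof.
  intros Hc HM. destruct (Rle_dec a b) as [H|H].
  - rewrite Rabs_pos_eq by lra. apply line_int_bound; auto.
    intros t Ht. apply HM. rewrite Rmin_left, Rmax_right; lra.
  - rewrite Rabs_minus_sym, Rabs_pos_eq by lra.
    rewrite line_int_swap by (apply cont_on_line_swap; auto). rewrite Cmod_opp.
    apply line_int_bound. lra. apply cont_on_line_swap; auto.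
    intros t Ht. apply HM. rewrite Rmin_right, Rmax_left; lra.
Qed.

Lemma cder_line f z h (t : R) l : cder f (z + t * h) l ->
  is_derive (K := R_AbsRing) (V := C_R_NormedModule) (fun s : R => f (z + s * h)) t (l * h).
Proof.
  intros H. split. apply @is_linear_scal_l.
  intros x Hx. apply (@is_filter_lim_locally_unique R_AbsRing R_NormedModule) in Hx. subst x.
  intros eps.
  assert (Hh := Cmod_ge_0 h). assert (He := cond_pos eps).
  assert (He2 : (0 < eps / (Cmod h + 1))%R) by (apply Rdiv_lt_0_compat; lra).
  destruct (proj1 (cder_eps _ _ _) H (mkposreal _ He2)) as [d Hd]. simpl in Hd.
  assert (Hd2 : (0 < d / (Cmod h + 1))%R).
  { apply Rdiv_lt_0_compat. apply cond_pos. lra. }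
  exists (mkposreal _ Hd2). intros s Hs.
  change (Rabs (s - t) < d / (Cmod h + 1)) in Hs.
  specialize (Hd (z + s * h)).
  replace (z + s * h - (z + t * h)) with (RtoC (s - t) * h) in Hd
    by (rewrite RtoC_minus; ring).
  rewrite Cmod_mult, Cmod_R in Hd.
  assert (Hs0 := Rabs_pos (s - t)).
  apply (Rmult_lt_compat_r (Cmod h + 1)) in Hs; [|lra].
  replace (d / (Cmod h + 1) * (Cmod h + 1))%R with (pos d) in Hs by (field; lra).
  assert (Hlt : Rabs (s - t) * Cmod h < d) by nra.
  specialize (Hd Hlt).
  change (norm (minus s t)) with (Rabs (s - t)).
  eapply Rle_trans; [right; symmetry; apply Cmod_norm|].
  match goal with |- Cmod ?X <= _ =>
    replace X with (f (z + s * h) - f (z + t * h) - l * (RtoC (s - t) * h)) end.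
  2:{ rewrite <- (Cmult_comm h), Cmult_assoc, (Cmult_comm _ (s - t)%R).
      unfold minus, plus, opp, scal; simpl. unfold prod_plus, prod_opp, prod_scal, scal; simpl.
      unfold mult, plus, opp; simpl.
      destruct (f (z + s * h)), (f (z + t * h)), l, h.
      apply injective_projections; simpl; ring. }
  eapply Rle_trans; [exact Hd|].
  apply Rle_trans with (eps / (Cmod h + 1) * (Rabs (s - t) * (Cmod h + 1)))%R.
  - apply Rmult_le_compat_l; [lra|]. nra.
  - right. field. lra.
Qed.

Lemma line_int_primitive P f z h (a b : R) :
  (forall t : R, Rmin a b <= t <= Rmax a b -> cder P (z + t * h) (f (z + t * h)))->
  cont_on_line f z h a b ->
  line_int f z h a b = P (z + b * h) - P (z + a * h).
Proof.
  intros HP Hc. unfold line_int. apply (is_RInt_unique (V := C_R_CompleteNormedModule)).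
  apply (is_RInt_derive (V := C_R_CompleteNormedModule) (fun t : R => P (z + t * h))
    (fun t : R => h * f (z + t * h)) a b).
  - intros t Ht. rewrite Cmult_comm. apply cder_line, HP, Ht.
  - intros t Ht. apply (ccont_line (fun w => h * f w)), ccont_scal, Hc, Ht.
Qed.

(** * Goursat's theorem on rectangles *)

Definition rect_int (f : C -> C) (x1 x2 y1 y2 : R) : C :=
  line_int f (0, y1) 1 x1 x2 - line_int f (0, y2) 1 x1 x2
  + line_int f (x2, 0) Ci y1 y2 - line_int f (x1, 0) Ci y1 y2.

Definition in_rect (x1 x2 y1 y2 : R) (z : C) : Prop :=
  x1 <= Re z <= x2 /\ y1 <= Im z <= y2.

Lemma horizontal_point (y t : R) : (0, y) + t * 1 = (t, y).
Proof. apply injective_projections; simpl; ring. Qed.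

Lemma vertical_point (x t : R) : (x, 0) + t * Ci = (x, t).
Proof. apply injective_projections; simpl; ring. Qed.

Lemma rect_cont_horizontal f (x1 x2 y1 y2 y a b : R) :
  (forall z, in_rect x1 x2 y1 y2 z -> ccont f z) ->
  y1 <= y <= y2 -> x1 <= a -> a <= b -> b <= x2 ->
  cont_on_line f (0, y) 1 a b.
Proof.
  intros Hc H H1 H2 H3 t Ht. rewrite Rmin_left, Rmax_right in Ht by lra.
  rewrite horizontal_point. apply Hc. split; simpl; lra.
Qed.

Lemma rect_cont_vertical f (x1 x2 y1 y2 x a b : R) :
  (forall z, in_rect x1 x2 y1 y2 z -> ccont f z) ->
  x1 <= x <= x2 -> y1 <= a -> a <= b -> b <= y2 ->
  cont_on_line f (x, 0) Ci a b.
Proof.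
  intros Hc H H1 H2 H3 t Ht. rewrite Rmin_left, Rmax_right in Ht by lra.
  rewrite vertical_point. apply Hc. split; simpl; lra.
Qed.

Lemma rect_split_vertical f (x1 x2 y1 y2 m : R) : y1 <= y2 ->
  (forall z, in_rect x1 x2 y1 y2 z -> ccont f z) ->
  x1 <= m <= x2 ->
  rect_int f x1 x2 y1 y2 = rect_int f x1 m y1 y2 + rect_int f m x2 y1 y2.
Proof.
  intros Hy Hc Hm. unfold rect_int.
  rewrite (line_int_Chasles f (0, y1) 1 x1 m x2), (line_int_Chasles f (0, y2) 1 x1 m x2);
    try lra; try (apply (rect_cont_horizontal f x1 x2 y1 y2); auto; lra). ring.
Qed.

Lemma rect_split_horizontal f (x1 x2 y1 y2 m : R) : x1 <= x2 ->
  (forall z, in_rect x1 x2 y1 y2 z -> ccont f z) ->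
  y1 <= m <= y2 ->
  rect_int f x1 x2 y1 y2 = rect_int f x1 x2 y1 m + rect_int f x1 x2 m y2.
Proof.
  intros Hx Hc Hm. unfold rect_int.
  rewrite (line_int_Chasles f (x1, 0) Ci y1 m y2), (line_int_Chasles f (x2, 0) Ci y1 m y2);
    try lra; try (apply (rect_cont_vertical f x1 x2 y1 y2); auto; lra). ring.
Qed.

Lemma rect_int_bound f (x1 x2 y1 y2 M : R) : x1 <= x2 -> y1 <= y2 ->
  (forall z, in_rect x1 x2 y1 y2 z -> ccont f z) ->
  (forall z, in_rect x1 x2 y1 y2 z -> Cmod (f z) <= M) ->
  Cmod (rect_int f x1 x2 y1 y2) <= 2 * ((x2 - x1) + (y2 - y1)) * M.
Proof.
  intros Hx Hy Hc HM. unfold rect_int.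
  assert (H1 : forall y, y1 <= y <= y2 -> Cmod (line_int f (0, y) 1 x1 x2) <= (x2 - x1) * (1 * M)).
  { intros y H. assert (L := line_int_bound f (0, y) 1 x1 x2 M). rewrite Cmod_1 in L.
    apply L. lra. apply (rect_cont_horizontal f x1 x2 y1 y2); auto; lra.
    intros t Ht. rewrite horizontal_point. apply HM. split; simpl; lra. }
  assert (H2 : forall x, x1 <= x <= x2 -> Cmod (line_int f (x, 0) Ci y1 y2) <= (y2 - y1) * (1 * M)).
  { intros x H. assert (L := line_int_bound f (x, 0) Ci y1 y2 M). rewrite Cmod_Ci in L.
    apply L. lra. apply (rect_cont_vertical f x1 x2 y1 y2); auto; lra.
    intros t Ht. rewrite vertical_point. apply HM. split; simpl; lra. }
  eapply Rle_trans. apply Cmod_triangle_minus.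
  assert (H3 := Cmod_triangle (line_int f (0, y1) 1 x1 x2 - line_int f (0, y2) 1 x1 x2)
     (line_int f (x2, 0) Ci y1 y2)).
  assert (H4 := Cmod_triangle_minus (line_int f (0, y1) 1 x1 x2) (line_int f (0, y2) 1 x1 x2)).
  assert (A1 := H1 y1 ltac:(lra)). assert (A2 := H1 y2 ltac:(lra)).
  assert (B1 := H2 x1 ltac:(lra)). assert (B2 := H2 x2 ltac:(lra)).
  lra.
Qed.

Lemma rect_int_primitive f (P : C -> C) (x1 x2 y1 y2 : R) : x1 <= x2 -> y1 <= y2 ->
  (forall z, in_rect x1 x2 y1 y2 z -> ccont f z) ->
  (forall z, in_rect x1 x2 y1 y2 z -> cder P z (f z)) -> rect_int f x1 x2 y1 y2 = 0.
Proof.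
  intros Hx Hy Hc HP. unfold rect_int.
  assert (H1 : forall y, y1 <= y <= y2 -> line_int f (0, y) 1 x1 x2 = P (x2, y) - P (x1, y)).
  { intros y H. rewrite (line_int_primitive P), !horizontal_point; auto.
    2: apply (rect_cont_horizontal f x1 x2 y1 y2); auto; lra.
    intros t Ht. rewrite Rmin_left, Rmax_right in Ht by lra.
    rewrite horizontal_point. apply HP. split; simpl; lra. }
  assert (H2 : forall x, x1 <= x <= x2 -> line_int f (x, 0) Ci y1 y2 = P (x, y2) - P (x, y1)).
  { intros x H. rewrite (line_int_primitive P), !vertical_point; auto.
    2: apply (rect_cont_vertical f x1 x2 y1 y2); auto; lra.
    intros t Ht. rewrite Rmin_left, Rmax_right in Ht by lra.
    rewrite vertical_point. apply HP. split; simpl; lra. }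
  rewrite !H1, !H2 by lra. ring.
Qed.
Lemma rect_int_minus f g (x1 x2 y1 y2 : R) : x1 <= x2 -> y1 <= y2 ->
  (forall z, in_rect x1 x2 y1 y2 z -> ccont f z) ->
  (forall z, in_rect x1 x2 y1 y2 z -> ccont g z) ->
  rect_int (fun z => f z - g z) x1 x2 y1 y2 = rect_int f x1 x2 y1 y2 - rect_int g x1 x2 y1 y2.
Proof.
  intros Hx Hy Hf Hg. unfold rect_int.
  rewrite !line_int_minus;
   try (eapply rect_cont_horizontal; eauto; lra); try (eapply rect_cont_vertical; eauto; lra).
  ring.
Qed.

Lemma ccont_minus f g z : ccont f z -> ccont g z -> ccont (fun w => f w - g w) z.
Proof.
  intros Hf Hg eps He.
  destruct (Hf (eps / 2)%R) as [d1 [H1 F1]]. lra.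
  destruct (Hg (eps / 2)%R) as [d2 [H2 F2]]. lra.
  exists (Rmin d1 d2). split. apply Rmin_pos; auto.
  intros w Hw.
  specialize (F1 w (Rlt_le_trans _ _ _ Hw (Rmin_l _ _))).
  specialize (F2 w (Rlt_le_trans _ _ _ Hw (Rmin_r _ _))).
  replace (f w - g w - (f z - g z)) with ((f w - f z) - (g w - g z)) by ring.
  eapply Rle_lt_trans. apply Cmod_triangle_minus. lra.
Qed.

Lemma Cmod_le_Re_Im z : Cmod z <= Rabs (Re z) + Rabs (Im z).
Proof.
  replace z with (RtoC (Re z) + Ci * RtoC (Im z)) at 1.
  2:{ destruct z as [a b]. apply injective_projections; simpl; ring. }
  eapply Rle_trans. apply Cmod_triangle. rewrite Cmod_mult, Cmod_Ci, !Cmod_R. lra.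
Qed.

(** Two such points are the coordinates of the centre on which the bisection in [Goursat]
    closes down. *)
Lemma nested_point (u v : nat -> R) :
  (forall n, u n <= u (S n)) -> (forall n, v (S n) <= v n) -> (forall n, u n <= v n) ->
  exists p : R, forall n, u n <= p <= v n.
Proof.
  intros Hu Hv Huv.
  assert (Mu : forall n m, (n <= m)%nat -> u n <= u m).
  { intros n m H. induction H. lra. specialize (Hu m). lra. }
  assert (Mv : forall n m, (n <= m)%nat -> v m <= v n).
  { intros n m H. induction H. lra. specialize (Hv m). lra. }
  assert (Hb : forall n m, u n <= v m).
  { intros n m. assert (A := Mu n (max n m) ltac:(lia)). assert (B := Mv m (max n m) ltac:(lia)).
    specialize (Huv (max n m)). lra. }
  destruct (completeness (fun x => exists n, x = u n)) as [p [P1 P2]].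
  - exists (v O). intros x [n ->]. apply Hb.
  - exists (u O). now exists O.
  - exists p. intros n. split. apply P1. now exists n. apply P2. intros x [m ->]. apply Hb.
Qed.

(** If the boundary integral over the rectangle is [I], one of its four quarters has a boundary
    integral of modulus at least [|I| / 4]; iterating, the [n]-th rectangle has one of modulus at
    least [|I| / 4^n]. The rectangles shrink to a point [p], near which [f] differs by
    [o(|z - p|)] from an affine function. The affine part has a primitive and integrates to zero,
    and the remainder integrates to [o(4^-n)], since both the perimeter and the size of the
    integrand are of order [2^-n]. Hence [I = 0]. *)
Theorem Goursat f (x1 x2 y1 y2 : R) : x1 <= x2 -> y1 <= y2 ->
  (forall z, in_rect x1 x2 y1 y2 z -> exists l, cder f z l) ->
  rect_int f x1 x2 y1 y2 = 0.
Proof.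
  intros Hx Hy Hd.
  assert (Hcont : forall z, in_rect x1 x2 y1 y2 z -> ccont f z).
  { intros z Hz. destruct (Hd z Hz) as [l Hl]. eapply cder_ccont, Hl. }
  set (w := (x2 - x1)%R). set (v := (y2 - y1)%R).
  assert (Hw : 0 <= w) by (unfold w; lra). assert (Hv : 0 <= v) by (unfold v; lra).
  set (q := fun n => (/ 2 ^ n)%R).
  assert (Hq : forall n, 0 < q n). { intros n. apply Rinv_0_lt_compat, pow_lt. lra. }
  assert (HqS : forall n, q n = (q (S n) + q (S n))%R).
  { intros n. unfold q. simpl. assert (H := pow_lt 2 n ltac:(lra)). field. lra. }
  (* Generation [n] consists of rectangles of width [w * q n] and height [v * q n], given by their
     lower left corners; [ok] says that such a rectangle lies in the original one. *)
  set (I := fun n (a : R * R) => rect_int f (fst a) (fst a + w * q n) (snd a) (snd a + v * q n)).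
  set (ok := fun n (a : R * R) => x1 <= fst a /\ fst a + w * q n <= x2 /\ y1 <= snd a /\ (snd a + v * q n)%R <= y2).
  assert (Hstep : forall n a, ok n a -> exists b, ok (S n) b /\ Cmod (I n a) <= 4 * Cmod (I (S n) b)
     /\ fst a <= fst b /\ fst b + w * q (S n) <= fst a + w * q n
     /\ snd a <= snd b /\ (snd b + v * q (S n))%R <= (snd a + v * q n)%R).
  { intros n [a1 a2] [O1 [O2 [O3 O4]]]. simpl in O1, O2, O3, O4.
    assert (E1 : (w * q n = w * q (S n) + w * q (S n))%R) by (rewrite HqS; ring).
    assert (E2 : (v * q n = v * q (S n) + v * q (S n))%R) by (rewrite HqS; ring).
    assert (P1 : 0 <= w * q (S n)) by (apply Rmult_le_pos; [lra|left; apply Hq]).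
    assert (P2 : 0 <= v * q (S n)) by (apply Rmult_le_pos; [lra|left; apply Hq]).
    set (w' := (w * q (S n))%R) in *. set (v' := (v * q (S n))%R) in *.
    assert (E : I n (a1, a2) = I (S n) (a1, a2) + I (S n) (a1, (a2 + v')%R)
              + (I (S n) ((a1 + w')%R, a2) + I (S n) ((a1 + w')%R, (a2 + v')%R))).
    { unfold I. cbn [fst snd]. fold w' v'. rewrite E1, E2. rewrite <- !Rplus_assoc.
      assert (Hsub : forall a b c d, x1 <= a -> b <= x2 -> y1 <= c -> d <= y2 ->
        forall z, in_rect a b c d z -> ccont f z).
      { intros a b c d A1 A2 A3 A4 z [Z1 Z2]. apply Hcont. split; lra. }
      rewrite (rect_split_vertical f a1 (a1 + w' + w') a2 (a2 + v' + v')) with (m := (a1 + w')%R); try lra.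
      2: apply Hsub; lra.
      rewrite (rect_split_horizontal f a1 (a1 + w') a2 (a2 + v' + v')) with (m := (a2 + v')%R); try lra.
      2: apply Hsub; lra.
      rewrite (rect_split_horizontal f (a1 + w') (a1 + w' + w') a2 (a2 + v' + v')) with (m := (a2 + v')%R); try lra.
      2: apply Hsub; lra. reflexivity. }
    assert (T : Cmod (I n (a1, a2)) <= Cmod (I (S n) (a1, a2)) + Cmod (I (S n) (a1, (a2 + v')%R))
              + Cmod (I (S n) ((a1 + w')%R, a2)) + Cmod (I (S n) ((a1 + w')%R, (a2 + v')%R))).
    { rewrite E. eapply Rle_trans. apply Cmod_triangle.
      assert (T1 := Cmod_triangle (I (S n) (a1, a2)) (I (S n) (a1, (a2 + v')%R))).
      assert (T2 := Cmod_triangle (I (S n) ((a1 + w')%R, a2)) (I (S n) ((a1 + w')%R, (a2 + v')%R))). lra. }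
    destruct (Rle_dec (Cmod (I n (a1, a2))) (4 * Cmod (I (S n) (a1, a2)))) as [D1|D1].
    { exists (a1, a2). unfold ok. cbn [fst snd]. fold w' v'. repeat split; lra. }
    destruct (Rle_dec (Cmod (I n (a1, a2))) (4 * Cmod (I (S n) (a1, (a2 + v')%R)))) as [D2|D2].
    { exists (a1, (a2 + v')%R). unfold ok. cbn [fst snd]. fold w' v'. repeat split; lra. }
    destruct (Rle_dec (Cmod (I n (a1, a2))) (4 * Cmod (I (S n) ((a1 + w')%R, a2)))) as [D3|D3].
    { exists ((a1 + w')%R, a2). unfold ok. cbn [fst snd]. fold w' v'. repeat split; lra. }
    exists ((a1 + w')%R, (a2 + v')%R). unfold ok. cbn [fst snd]. fold w' v'. repeat split; lra. }
  set (next := fun n a => epsilon (inhabits a) (fun b => ok (S n) b /\ Cmod (I n a) <= 4 * Cmod (I (S n) b)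
     /\ fst a <= fst b /\ fst b + w * q (S n) <= fst a + w * q n
     /\ snd a <= snd b /\ (snd b + v * q (S n))%R <= (snd a + v * q n)%R)).
  set (s := fix s n := match n with O => (x1, y1) | S m => next m (s m) end).
  assert (Hs : forall n, ok n (s n)).
  { induction n.
    - unfold ok, s, q. simpl. unfold w, v. repeat split; lra.
    - simpl. unfold next. apply (epsilon_spec (inhabits (s n)) _ (Hstep n (s n) IHn)). }
  assert (Hs2 : forall n, Cmod (I n (s n)) <= 4 * Cmod (I (S n) (s (S n)))
     /\ fst (s n) <= fst (s (S n)) /\ fst (s (S n)) + w * q (S n) <= fst (s n) + w * q n
     /\ snd (s n) <= snd (s (S n)) /\ (snd (s (S n)) + v * q (S n))%R <= (snd (s n) + v * q n)%R).
  { intros n. apply (epsilon_spec (inhabits (s n)) _ (Hstep n (s n) (Hs n))). }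
  destruct (nested_point (fun n => fst (s n)) (fun n => (fst (s n) + w * q n)%R)) as [p1 Hp1].
  { intros n; apply Hs2. } { intros n; apply Hs2. }
  { intros n. assert (0 <= w * q n) by (apply Rmult_le_pos; [lra|left; apply Hq]). lra. }
  destruct (nested_point (fun n => snd (s n)) (fun n => (snd (s n) + v * q n)%R)) as [p2 Hp2].
  { intros n; apply Hs2. } { intros n; apply Hs2. }
  { intros n. assert (0 <= v * q n) by (apply Rmult_le_pos; [lra|left; apply Hq]). lra. }
  assert (Hgrow : forall n, Cmod (rect_int f x1 x2 y1 y2) * (q n * q n) <= Cmod (I n (s n))).
  { induction n.
    - unfold I, s, q; simpl. right. rewrite Rinv_1, !Rmult_1_r. f_equal. f_equal; unfold w, v; ring.
    - destruct (Hs2 n) as [H _]. rewrite HqS in IHn. lra. }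
  destruct (Hd (p1, p2)) as [l Hl].
  { destruct (Hs O) as [A1 [A2 [A3 A4]]]. specialize (Hp1 O). specialize (Hp2 O). split; simpl in *; lra. }
  apply Cmod_eq_0. apply Rle_antisym; [|apply Cmod_ge_0].
  apply le_epsilon. intros eps He. rewrite Rplus_0_l.
  set (K := (2 * (w + v) * (w + v) + 1)%R).
  assert (HK : 0 < K) by (unfold K; nra).
  destruct (proj1 (cder_eps _ _ _) Hl (mkposreal (eps / K) ltac:(apply Rdiv_lt_0_compat; lra))) as [d Hdd].
  simpl in Hdd.
  assert (Hn : exists n, (w + v) * q n < d).
  { destruct (pow_lt_1_zero (/ 2) ltac:(rewrite Rabs_pos_eq; lra) (d / (w + v + 1))) as [n Hn].
    - apply Rdiv_lt_0_compat. apply cond_pos. lra.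
    - exists n. specialize (Hn n (le_n n)). rewrite pow_inv in Hn. fold (q n) in Hn.
      rewrite Rabs_pos_eq in Hn by (left; apply Hq).
      apply (Rmult_lt_compat_l (w + v + 1)) in Hn; [|lra].
      replace ((w + v + 1) * (d / (w + v + 1)))%R with (pos d) in Hn by (field; lra).
      specialize (Hq n). lra. }
  destruct Hn as [n Hn].
  set (p := (p1, p2)) in *.
  set (A := fun z => f p + l * (z - p)).
  assert (Hrc : forall z, in_rect (fst (s n)) (fst (s n) + w * q n) (snd (s n)) (snd (s n) + v * q n) z -> ccont f z).
  { intros z [Z1 Z2]. apply Hcont. destruct (Hs n) as [A1 [A2 [A3 A4]]]. split; lra. }
  assert (HA : forall z, cder A z l).
  { intros z. unfold A. eapply cder_eq. apply cder_plus. apply cder_const. apply cder_scal.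
    apply cder_minus. apply cder_id. apply cder_const. ring. }
  assert (HP : forall z, cder (fun z => f p * z + l * ((z - p) * (z - p)) * / 2) z (A z)).
  { intros z. unfold A. eapply cder_eq. apply cder_plus. apply cder_scal. apply cder_id.
    apply cder_mult. apply cder_scal. apply cder_mult; (apply cder_minus; [apply cder_id|apply cder_const]).
    apply cder_const. cbv beta. field. }
  assert (Q1 : 0 <= w * q n) by (apply Rmult_le_pos; [lra|left; apply Hq]).
  assert (Q2 : 0 <= v * q n) by (apply Rmult_le_pos; [lra|left; apply Hq]).
  assert (E : I n (s n) = rect_int (fun z => f z - A z) (fst (s n)) (fst (s n) + w * q n) (snd (s n)) (snd (s n) + v * q n)).
  { rewrite rect_int_minus; auto; try lra.
    - unfold I. rewrite (rect_int_primitive A) with (P := fun z => f p * z + l * ((z - p) * (z - p)) * / 2); auto; try lra.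
      ring. intros z _. eapply cder_ccont, HA.
    - intros z _. eapply cder_ccont, HA. }
  assert (B : Cmod (I n (s n)) <= 2 * ((w + v) * q n) * (eps / K * ((w + v) * q n))).
  { rewrite E. eapply Rle_trans. apply rect_int_bound with (M := (eps / K * ((w + v) * q n))%R); try lra.
    - intros z Hz. apply ccont_minus; auto. eapply cder_ccont, HA.
    - intros z [Z1 Z2].
      assert (Hzp : Cmod (z - p) <= (w + v) * q n).
      { eapply Rle_trans. apply Cmod_le_Re_Im. unfold p, Cminus. rewrite re_plus, im_plus, re_opp, im_opp. simpl.
        specialize (Hp1 n). specialize (Hp2 n). simpl in Hp1, Hp2.
        assert (Rabs (Re z + - p1) <= w * q n) by (apply Rabs_le; lra).
        assert (Rabs (Im z + - p2) <= v * q n) by (apply Rabs_le; lra). lra. }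
      unfold A. replace (f z - (f p + l * (z - p))) with (f z - f p - l * (z - p)) by ring.
      eapply Rle_trans. apply Hdd. lra. apply Rmult_le_compat_l; [|exact Hzp].
      left; apply Rdiv_lt_0_compat; lra.
    - right. ring. }
  specialize (Hgrow n). specialize (Hq n).
  apply Rmult_le_reg_r with (q n * q n)%R. nra.
  eapply Rle_trans; [exact Hgrow|]. eapply Rle_trans; [exact B|].
  replace (2 * ((w + v) * q n) * (eps / K * ((w + v) * q n)))%R with ((2 * (w + v) * (w + v)) * (eps / K * (q n * q n)))%R by ring.
  apply Rle_trans with (K * (eps / K * (q n * q n)))%R.
  - apply Rmult_le_compat_r. apply Rmult_le_pos; [left; apply Rdiv_lt_0_compat; lra|nra]. unfold K; lra.
  - right. field. lra.
Qed.

(** The form used for primitives, where [f] is integrated between two points in arbitrary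
    relative position. *)
Lemma Goursat_signed f (x1 x2 y1 y2 : R) :
  (forall z, in_rect (Rmin x1 x2) (Rmax x1 x2) (Rmin y1 y2) (Rmax y1 y2) z -> exists l, cder f z l) ->
  rect_int f x1 x2 y1 y2 = 0.
Proof.
  assert (H0 : forall a b c d, a <= b -> c <= d ->
    (forall z, in_rect a b c d z -> exists l, cder f z l) ->
    rect_int f a b c d = 0 /\ rect_int f b a c d = 0 /\ rect_int f a b d c = 0 /\ rect_int f b a d c = 0).
  { intros a b c d Hab Hcd Hd. assert (G := Goursat f a b c d Hab Hcd Hd).
    assert (Hc : forall z, in_rect a b c d z -> ccont f z).
    { intros z Hz. destruct (Hd z Hz) as [l Hl]. eapply cder_ccont, Hl. }
    split; [exact G|]. unfold rect_int in *.
    rewrite !(line_int_swap f _ 1 a b), !(line_int_swap f _ Ci c d);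
      try (eapply rect_cont_horizontal; eauto; lra); try (eapply rect_cont_vertical; eauto; lra).
    set (X := line_int f (0, c) 1 a b) in *. set (Y := line_int f (0, d) 1 a b) in *.
    set (U := line_int f (b, 0) Ci c d) in *. set (W := line_int f (a, 0) Ci c d) in *.
    split; [|split].
    - replace (- X - - Y + W - U) with (- (X - Y + U - W)) by ring. rewrite G; ring.
    - replace (Y - X + - U - - W) with (- (X - Y + U - W)) by ring. rewrite G; ring.
    - replace (- Y - - X + - W - - U) with (X - Y + U - W) by ring. exact G. }
  intros Hd.
  destruct (Rle_dec x1 x2) as [Hx|Hx]; destruct (Rle_dec y1 y2) as [Hy|Hy].
  - rewrite !Rmin_left, !Rmax_right in Hd by lra. apply (H0 x1 x2 y1 y2); auto; lra.
  - rewrite (Rmin_left x1), (Rmax_right x1), Rmin_right, Rmax_left in Hd by lra.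
    apply (H0 x1 x2 y2 y1); auto; lra.
  - rewrite (Rmin_right x1), (Rmax_left x1), Rmin_left, Rmax_right in Hd by lra.
    apply (H0 x2 x1 y1 y2); auto; lra.
  - rewrite !Rmin_right, !Rmax_left in Hd by lra. apply (H0 x2 x1 y2 y1); auto; lra.
Qed.

(** * The exponential, and the mean value bound on circles *)

Definition cexp (z : C) : C := (exp (Re z) * cos (Im z), exp (Re z) * sin (Im z))%R.

Lemma cexp_plus a b : cexp (a + b) = cexp a * cexp b.
Proof.
  destruct a as [a1 a2], b as [b1 b2]. unfold cexp; simpl.
  rewrite exp_plus, cos_plus, sin_plus.
  apply injective_projections; simpl; ring.
Qed.

Lemma cexp_0 : cexp 0 = 1.
Proof.
  unfold cexp; simpl. rewrite exp_0, cos_0, sin_0.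
  apply injective_projections; simpl; ring.
Qed.

Lemma Cmod_cexp z : Cmod (cexp z) = exp (Re z).
Proof.
  unfold Cmod, cexp. cbn [fst snd].
  replace ((exp (Re z) * cos (Im z)) ^ 2 + (exp (Re z) * sin (Im z)) ^ 2)%R
    with (exp (Re z) * exp (Re z))%R.
  - apply sqrt_square. left; apply exp_pos.
  - assert (H := sin2_cos2 (Im z)). unfold Rsqr in H.
    transitivity (exp (Re z) * exp (Re z) * (sin (Im z) * sin (Im z) + cos (Im z) * cos (Im z)))%R.
    rewrite H; ring. ring.
Qed.

Lemma cexp_neq_0 z : cexp z <> 0.
Proof. apply Cmod_gt_0. rewrite Cmod_cexp. apply exp_pos. Qed.

Lemma cexp_opp z : cexp (- z) = / cexp z.
Proof.
  assert (H : cexp (- z) * cexp z = 1) by (rewrite <- cexp_plus; rewrite <- cexp_0; f_equal; ring).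
  assert (Hz := cexp_neq_0 z).
  replace (cexp (- z)) with (cexp (- z) * cexp z * / cexp z) by (field; auto).
  rewrite H. ring.
Qed.

Lemma derivable_pt_lim_0_eps (f : R -> R) (l : R) : derivable_pt_lim f 0 l ->
  forall eps, 0 < eps -> exists d, 0 < d /\ forall h, Rabs h < d -> Rabs (f h - f 0%R - l * h) <= eps * Rabs h.
Proof.
  intros H eps He. destruct (H eps He) as [d Hd]. exists d. split. apply cond_pos.
  intros h Hh. destruct (Req_dec h 0) as [->|N].
  - replace (f 0%R - f 0%R - l * 0)%R with 0%R by ring. rewrite Rabs_R0. lra.
  - specialize (Hd h N Hh). rewrite Rplus_0_l in Hd.
    replace (f h - f 0%R - l * h)%R with (((f h - f 0%R) / h - l) * h)%R by (field; auto).
    rewrite Rabs_mult. apply Rmult_le_compat_r. apply Rabs_pos. lra.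
Qed.

Lemma cder_cexp_0 : cder cexp 0 1.
Proof.
  apply cder_eps. intros eps. assert (He := cond_pos eps).
  set (e := Rmin (eps / 20) 1).
  assert (He0 : 0 < e) by (apply Rmin_pos; lra).
  assert (He1 : e <= 1) by apply Rmin_r.
  assert (He2 : 20 * e <= eps) by (assert (H := Rmin_l (eps / 20) 1); fold e in H; lra).
  clearbody e.
  destruct (derivable_pt_lim_0_eps exp 1) with (eps := e) as [d1 [D1 E1]]; auto.
  { assert (H := derivable_pt_lim_exp 0). rewrite exp_0 in H. exact H. }
  destruct (derivable_pt_lim_0_eps sin 1) with (eps := e) as [d2 [D2 E2]]; auto.
  { rewrite <- cos_0. apply derivable_pt_lim_sin. }
  destruct (derivable_pt_lim_0_eps cos 0) with (eps := e) as [d3 [D3 E3]]; auto.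
  { assert (H := derivable_pt_lim_cos 0). rewrite sin_0, Ropp_0 in H. exact H. }
  assert (Hd : 0 < Rmin e (Rmin d1 (Rmin d2 d3))) by (repeat apply Rmin_pos; auto).
  exists (mkposreal _ Hd). intros z Hz. simpl in Hz.
  assert (M1 := Rmin_l e (Rmin d1 (Rmin d2 d3))). assert (M2 := Rmin_r e (Rmin d1 (Rmin d2 d3))).
  assert (M3 := Rmin_l d1 (Rmin d2 d3)). assert (M4 := Rmin_r d1 (Rmin d2 d3)).
  assert (M5 := Rmin_l d2 d3). assert (M6 := Rmin_r d2 d3).
  rewrite cexp_0. replace (z - 0) with z in * by ring.
  destruct z as [a b].
  assert (Ha : Rabs a <= Cmod (a, b)) by apply (re_le_Cmod (a, b)).
  assert (Hb : Rabs b <= Cmod (a, b)).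
  { eapply Rle_trans; [|apply (Rmax_Cmod (a, b))]. apply Rmax_r. }
  set (m := Cmod (a, b)) in *.
  specialize (E1 a ltac:(lra)). specialize (E2 b ltac:(lra)). specialize (E3 b ltac:(lra)).
  rewrite exp_0 in E1. rewrite sin_0 in E2. rewrite cos_0 in E3.
  rewrite Rmult_0_l, Rminus_0_r in E3. rewrite Rminus_0_r, Rmult_1_l in E2. rewrite Rmult_1_l in E1.
  assert (Ra := Rabs_pos a). assert (Rb := Rabs_pos b).
  assert (F1 : Rabs (exp a - 1) <= 2 * Rabs a).
  { replace (exp a - 1)%R with ((exp a - 1 - a) + a)%R by ring. eapply Rle_trans. apply Rabs_triang. nra. }
  assert (F2 : Rabs (exp a) <= 3).
  { replace (exp a)%R with ((exp a - 1) + 1)%R by ring. eapply Rle_trans. apply Rabs_triang. rewrite Rabs_R1. nra. }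
  eapply Rle_trans. apply Cmod_le_Re_Im.
  replace (Re (cexp (a, b) - 1 - 1 * (a, b))) with (exp a * (cos b - 1) + (exp a - 1 - a))%R.
  2:{ unfold cexp; simpl. ring. }
  replace (Im (cexp (a, b) - 1 - 1 * (a, b))) with (exp a * (sin b - b) + (exp a - 1) * b)%R.
  2:{ unfold cexp; simpl. ring. }
  assert (G1 : Rabs (exp a * (cos b - 1) + (exp a - 1 - a)) <= 3 * (e * m) + e * m).
  { eapply Rle_trans. apply Rabs_triang. rewrite Rabs_mult. apply Rplus_le_compat.
    apply Rmult_le_compat; auto using Rabs_pos. eapply Rle_trans; [exact E3|]. nra.
    eapply Rle_trans; [exact E1|]. nra. }
  assert (G2 : Rabs (exp a * (sin b - b) + (exp a - 1) * b) <= 3 * (e * m) + 2 * (e * m)).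
  { eapply Rle_trans. apply Rabs_triang. rewrite !Rabs_mult. apply Rplus_le_compat.
    apply Rmult_le_compat; auto using Rabs_pos. eapply Rle_trans; [exact E2|]. nra.
    apply Rle_trans with (2 * Rabs a * Rabs b)%R. apply Rmult_le_compat_r; auto.
    rewrite Rmult_assoc. apply Rmult_le_compat_l; [lra|]. apply Rmult_le_compat; lra. }
  nra.
Qed.

Lemma cder_cexp z : cder cexp z (cexp z).
Proof.
  apply (cder_ext (fun w => cexp z * cexp (w + (- z)))).
  { intros w. rewrite <- cexp_plus. f_equal. ring. }
  eapply cder_eq. apply cder_scal. apply (cder_shift cexp (- z)).
  replace (z + - z) with (RtoC 0) by ring. apply cder_cexp_0. ring.
Qed.

Lemma cexp_surj (u : C) : u <> 0 -> exists z, cexp z = u.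
Proof.
  intros Hu. assert (Hm := proj1 (Cmod_gt_0 u) Hu).
  assert (E2 : (Cmod u * Cmod u)%R = (Re u * Re u + Im u * Im u)%R).
  { assert (H := Cmod2_alt u). simpl in H. lra. }
  assert (Hc : exists t, (Cmod u * cos t)%R = Re u /\ (Cmod u * sin t)%R = Im u).
  { set (t := (Re u / Cmod u)%R).
    assert (Ht : Re u = (Cmod u * t)%R) by (unfold t; field; lra).
    assert (T1 : -1 <= t <= 1).
    { assert (H := re_le_Cmod u). apply Rabs_le_between in H. rewrite Ht in H. split; nra. }
    assert (Hs : (sin (acos t) * sin (acos t))%R = (1 - t * t)%R).
    { assert (H := sin2_cos2 (acos t)). rewrite cos_acos in H by exact T1. unfold Rsqr in H. lra. }
    assert (Hs0 : 0 <= sin (acos t)).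
    { apply sin_ge_0; apply acos_bound. }
    assert (Hi : (Im u * Im u)%R = (Cmod u * sin (acos t) * (Cmod u * sin (acos t)))%R).
    { replace (Cmod u * sin (acos t) * (Cmod u * sin (acos t)))%R with (Cmod u * Cmod u * (sin (acos t) * sin (acos t)))%R by ring.
      rewrite Hs. rewrite Ht in E2. lra. }
    destruct (Rle_dec 0 (Im u)) as [P|P].
    - exists (acos t). split. rewrite cos_acos; auto.
      apply Rsqr_inj; auto. apply Rmult_le_pos; lra.
    - exists (- acos t)%R. rewrite cos_neg, sin_neg, cos_acos by auto. split; auto.
      apply Ropp_eq_reg. rewrite Ropp_mult_distr_r, Ropp_involutive.
      apply Rsqr_inj; try lra. apply Rmult_le_pos; lra. unfold Rsqr. lra. }
  destruct Hc as [t [H1 H2]]. exists (ln (Cmod u), t). unfold cexp; simpl.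
  rewrite exp_ln by auto. rewrite H1, H2. symmetry. destruct u; reflexivity.
Qed.

Lemma cexp_periodic z : cexp (z + (0, 2 * PI)%R) = cexp z.
Proof.
  destruct z as [a b]. unfold cexp; simpl. rewrite Rplus_0_r.
  rewrite cos_plus, sin_plus, cos_2PI, sin_2PI. apply injective_projections; simpl; ring.
Qed.

(** The freedom in the imaginary part is what lets [no_normalised_exceptional] choose a solution
    of [cexp t = u] near a prescribed height. *)
Lemma cexp_surj_window (u : C) (T : R) : u <> 0 ->
  exists z, cexp z = u /\ T <= Im z <= T + 2 * PI.
Proof.
  intros Hu. destruct (cexp_surj u Hu) as [z Hz].
  assert (Hpi := PI_RGT_0).
  assert (Hn : forall n : nat, cexp (z + (0, 2 * PI * INR n)%R) = u /\ cexp (z - (0, 2 * PI * INR n)%R) = u).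
  { induction n as [|n [IH1 IH2]].
    - simpl. rewrite Rmult_0_r. change (0%R, 0%R) with (RtoC 0).
      split; rewrite <- Hz; f_equal; ring.
    - split.
      + rewrite <- IH1, <- (cexp_periodic (z + (0, 2 * PI * INR n)%R)), S_INR. f_equal.
        apply injective_projections; simpl; ring.
      + rewrite <- IH2, <- (cexp_periodic (z - (0, 2 * PI * INR (S n))%R)), S_INR. f_equal.
        apply injective_projections; simpl; ring. }
  set (k := Int_part ((Im z - T) / (2 * PI))).
  assert (Hk := base_Int_part ((Im z - T) / (2 * PI))). fold k in Hk.
  assert (E : Im z = (T + 2 * PI * ((Im z - T) / (2 * PI)))%R) by (field; lra).
  assert (W : T <= Im z - 2 * PI * IZR k <= T + 2 * PI) by (rewrite E; nra).
  destruct (Z_le_gt_dec 0 k) as [P|P].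
  - exists (z - (0, 2 * PI * INR (Z.to_nat k))%R). split. apply Hn.
    rewrite INR_IZR_INZ, Z2Nat.id by lia. unfold Im in *. simpl. lra.
  - exists (z + (0, 2 * PI * INR (Z.to_nat (- k)))%R). split. apply Hn.
    rewrite INR_IZR_INZ, Z2Nat.id by lia. rewrite opp_IZR. unfold Im in *. simpl. lra.
Qed.

(** In the coordinate [zeta] with [z = c + cexp zeta], circles about [c] are vertical segments of
    length [2 PI], and the horizontal sides of a rectangle of that height cancel by periodicity. So
    Goursat's theorem says that the mean of [f] over a circle does not depend on its radius, and
    this mean tends to [f c] as the radius tends to zero. At [c] only continuity is asked, because
    the lemma serves for difference quotients in [schwarz_derivative]. *)
Theorem mean_value_bound f c (r M : R) : 0 < r ->
  (forall z, 0 < Cmod (z - c) <= r -> exists l, cder f z l) -> ccont f c ->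
  (forall z, Cmod (z - c) = r -> Cmod (f z) <= M) -> Cmod (f c) <= M.
Proof.
  intros Hr Hd Hc HM. apply le_epsilon. intros eps He.
  destruct (Hc eps He) as [d [Hd0 Hf]].
  set (s1 := ln (Rmin r (d / 2))).
  assert (Hmin : 0 < Rmin r (d / 2)) by (apply Rmin_pos; lra).
  assert (Hs1 : exp s1 < d). { unfold s1. rewrite exp_ln by auto. eapply Rle_lt_trans. apply Rmin_r. lra. }
  assert (Hs12 : s1 <= ln r).
  { unfold s1. destruct (Rle_lt_or_eq_dec _ _ (Rmin_l r (d / 2))) as [H|H].
    left. apply ln_increasing; auto. rewrite H. lra. }
  assert (Hpi := PI_RGT_0).
  set (k := fun z => f (c + cexp z)).
  assert (Hsub : forall z, c + cexp z - c = cexp z) by (intros; ring).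
  assert (Hk : forall z, Re z <= ln r -> exists l, cder k z l).
  { intros z Hz. destruct (Hd (c + cexp z)) as [l Hl].
    - rewrite Hsub, Cmod_cexp. split. apply exp_pos. rewrite <- (exp_ln r) by auto.
      destruct Hz as [Hz|Hz]. left; apply exp_increasing, Hz. right; f_equal; exact Hz.
    - eexists. apply (cder_comp f (fun z => c + cexp z)). exact Hl. apply cder_plus.
      apply cder_const. apply cder_cexp. }
  assert (Hkc : forall z, Re z <= ln r -> ccont k z).
  { intros z Hz. destruct (Hk z Hz) as [l Hl]. eapply cder_ccont, Hl. }
  assert (G : rect_int k s1 (ln r) 0 (2 * PI) = 0).
  { apply Goursat; try lra. intros z [Hz _]. apply Hk, Hz. }
  unfold rect_int in G.
  rewrite (line_int_ext k (fun z => k (z + (0, 2 * PI)%R)) (0, 0)) in G; try lra.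
  2:{ intros t _. unfold k. rewrite cexp_periodic. reflexivity. }
  assert (E1 : line_int (fun z => k (z + (0, 2 * PI)%R)) (0, 0) 1 s1 (ln r)
     = line_int k (0, (2 * PI)%R) 1 s1 (ln r)).
  { unfold line_int. apply (RInt_ext (V := C_R_CompleteNormedModule)). intros x _. f_equal. f_equal.
    apply injective_projections; simpl; ring. }
  rewrite E1 in G.
  assert (E : line_int k (ln r, 0) Ci 0 (2 * PI) = line_int k (s1, 0) Ci 0 (2 * PI)).
  { set (X := line_int k (0, (2 * PI)%R) 1 s1 (ln r)) in G.
    set (Y := line_int k (s1, 0) Ci 0 (2 * PI)) in *.
    set (Z := line_int k (ln r, 0) Ci 0 (2 * PI)) in *.
    replace Z with ((X - X + Z - Y) + Y) by ring. rewrite G. ring. }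
  assert (V : forall x, x <= ln r -> cont_on_line k (x, 0) Ci 0 (2 * PI)).
  { intros x Hx t Ht. rewrite vertical_point. apply Hkc. exact Hx. }
  assert (B1 : Cmod (line_int k (ln r, 0) Ci 0 (2 * PI)) <= (2 * PI - 0) * (Cmod Ci * M)).
  { apply line_int_bound. lra. apply V; lra. intros t Ht. rewrite vertical_point.
    apply HM. rewrite Hsub, Cmod_cexp. simpl. apply exp_ln, Hr. }
  assert (CC : forall z, ccont (fun _ => f c) z).
  { intros z. eapply cder_ccont, cder_const. }
  assert (B2 : Cmod (line_int (fun z => k z - f c) (s1, 0) Ci 0 (2 * PI)) <= (2 * PI - 0) * (Cmod Ci * eps)).
  { apply line_int_bound. lra.
    - intros t Ht. apply ccont_minus. apply V. exact Hs12. exact Ht. apply CC.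
    - intros t Ht. rewrite vertical_point. left. apply Hf. rewrite Hsub, Cmod_cexp. exact Hs1. }
  rewrite line_int_minus in B2.
  2: apply V, Hs12. 2:{ intros t Ht. apply CC. }
  rewrite (line_int_primitive (fun z => f c * z) (fun _ => f c)) in B2.
  2:{ intros t _. eapply cder_eq. apply cder_scal, cder_id. ring. }
  2:{ intros t Ht. apply CC. }
  rewrite !vertical_point, <- E in B2. rewrite Cmod_Ci in B1, B2.
  set (Z := line_int k (ln r, 0) Ci 0 (2 * PI)) in *.
  assert (N : Cmod (f c * (s1, (2 * PI)%R) - f c * (s1, 0)) = (2 * PI * Cmod (f c))%R).
  { replace (f c * (s1, (2 * PI)%R) - f c * (s1, 0)) with (f c * (RtoC (2 * PI) * Ci)).
    rewrite !Cmod_mult, Cmod_Ci, Cmod_R, Rabs_pos_eq by lra. ring.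
    rewrite <- vertical_point. rewrite <- (vertical_point s1 0). ring. }
  assert (T := Cmod_triangle_rev (f c * (s1, (2 * PI)%R) - f c * (s1, 0)) Z).
  rewrite (Cmod_minus_sym _ Z), N in T.
  apply Rmult_le_reg_l with (2 * PI)%R; lra.
Qed.

(** * Cauchy estimates, zeros and primitives on discs *)

Definition holo (f : C -> C) (c : C) (r : R) : Prop :=
  forall z, Cmod (z - c) < r -> exists l, cder f z l.

Lemma holo_D f c r z : holo f c r -> Cmod (z - c) < r -> cder f z (C_derive f z).
Proof.
  intros H Hz. destruct (H z Hz) as [l Hl]. rewrite (cder_unique _ _ _ Hl). exact Hl.
Qed.

Lemma holo_sub f c r c' r' : holo f c r -> Cmod (c' - c) + r' <= r -> holo f c' r'.
Proof.
  intros H Hr z Hz. apply H. assert (T := Cmod_triangle3 z c' c). lra.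
Qed.

Lemma Cmod_self (c : C) : Cmod (c - c) = 0.
Proof. replace (c - c) with (RtoC 0) by ring. apply Cmod_0. Qed.

(** The difference quotient [(f z - f c) / (z - c)], completed by [C_derive f c] at [c],
    is continuous at [c] and bounded by [M / rho] on the circle of radius [rho]; let [rho] tend
    to [r]. *)
Lemma schwarz_derivative f c (r M : R) : 0 < r -> holo f c r ->
  (forall z, Cmod (z - c) < r -> Cmod (f z - f c) <= M) -> Cmod (C_derive f c) * r <= M.
Proof.
  intros Hr Hf HM. set (d := C_derive f c).
  assert (Hd : cder f c d) by (apply (holo_D f c r); auto; rewrite Cmod_self; auto).
  set (q := fun z => if Ceq_dec z c then d else (f z - f c) / (z - c)).
  assert (Hqc : q c = d). { unfold q. destruct (Ceq_dec c c); congruence. }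
  assert (Hqz : forall z, z <> c -> q z = (f z - f c) / (z - c)).
  { intros z N. unfold q. destruct (Ceq_dec z c); congruence. }
  assert (Hne : forall z, 0 < Cmod (z - c) -> z <> c).
  { intros z H E. subst z. rewrite Cmod_self in H. lra. }
  assert (K : forall rho, 0 < rho < r -> Cmod d * rho <= M).
  { intros rho Hrho. apply Rmult_le_reg_r with (/ rho)%R. apply Rinv_0_lt_compat; lra.
    rewrite Rmult_assoc, Rinv_r, Rmult_1_r by lra. rewrite <- Hqc.
    apply (mean_value_bound q c rho); try lra.
    - intros z Hz. assert (N := Hne z (proj1 Hz)).
      destruct (Hf z) as [l Hl]; [lra|].
      eexists. apply (cder_ext_near (fun z => (f z - f c) / (z - c)) q z _ (Cmod (z - c)) ltac:(lra)).
      { intros w Hw. symmetry. apply Hqz. intros E. subst w. rewrite Cmod_minus_sym in Hw. lra. }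
      apply cder_div.
      + intros E. apply N. replace z with ((z - c) + c) by ring. rewrite E. ring.
      + apply cder_minus. exact Hl. apply cder_const.
      + apply cder_minus. apply cder_id. apply cder_const.
    - intros eps He.
      destruct (proj1 (cder_eps _ _ _) Hd (mkposreal (eps / 2) ltac:(lra))) as [e He2]. simpl in He2.
      exists e. split. apply cond_pos. intros w Hw. rewrite Hqc.
      destruct (Ceq_dec w c) as [->|N]. { rewrite Hqc, Cmod_self. exact He. }
      rewrite Hqz by auto.
      assert (N2 : w - c <> 0). { intros E. apply N. replace w with ((w - c) + c) by ring. rewrite E. ring. }
      replace ((f w - f c) / (w - c) - d) with ((f w - f c - d * (w - c)) / (w - c)) by (field; auto).
      rewrite Cmod_div by auto. specialize (He2 w Hw).
      assert (Hp := proj1 (Cmod_gt_0 _) N2).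
      apply Rle_lt_trans with (eps / 2)%R; [|lra].
      apply Rmult_le_reg_r with (Cmod (w - c)); auto.
      unfold Rdiv at 1. rewrite Rmult_assoc, Rinv_l, Rmult_1_r by lra. exact He2.
    - intros z Hz. assert (N := Hne z ltac:(lra)). rewrite Hqz by auto.
      rewrite Cmod_div, Hz. apply Rmult_le_compat_r. left; apply Rinv_0_lt_compat; lra.
      apply HM. lra. intros E. rewrite E, Cmod_0 in Hz. lra. }
  destruct (Rle_dec (Cmod d * r) M) as [L|L]; [exact L|exfalso].
  assert (Hdp := Cmod_ge_0 d).
  assert (HM0 : 0 <= M). { assert (X := HM c). rewrite Cmod_self in X. eapply Rle_trans; [|apply X; auto]. apply Cmod_ge_0. }
  assert (Hd0 : 0 < Cmod d). { destruct Hdp; auto. rewrite <- H in L. lra. }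
  assert (X : M / Cmod d < r). { apply Rmult_lt_reg_r with (Cmod d); auto. unfold Rdiv. rewrite Rmult_assoc, Rinv_l by lra. lra. }
  assert (Y : 0 <= M / Cmod d). { apply Rmult_le_pos; auto. left; apply Rinv_0_lt_compat; auto. }
  (* If the conclusion failed, the radius half-way between [M / |d|] and [r] would violate [K]. *)
  specialize (K ((M / Cmod d + r) / 2)%R ltac:(lra)).
  replace (Cmod d * ((M / Cmod d + r) / 2))%R with ((M + Cmod d * r) / 2)%R in K by (field; lra). lra.
Qed.

Lemma cauchy_estimate f c (r M : R) : 0 < r -> holo f c r ->
  (forall z, Cmod (z - c) < r -> Cmod (f z) <= M) -> Cmod (C_derive f c) * r <= 2 * M.
Proof.
  intros Hr Hf HM. apply schwarz_derivative; auto.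
  intros z Hz. eapply Rle_trans. apply Cmod_triangle_minus.
  assert (A := HM z Hz). assert (B := HM c ltac:(rewrite Cmod_self; auto)). lra.
Qed.

Lemma C_complete (u : nat -> C) (e : nat -> R) : Un_cv e 0 ->
  (forall n m, (n <= m)%nat -> Cmod (u n - u m) <= e n) ->
  exists l, forall n, Cmod (u n - l) <= e n.
Proof.
  intros He Hu.
  assert (Hc : forall p : C -> R, (forall a b, Rabs (p a - p b) <= Cmod (a - b)) ->
      exists l, Un_cv (fun n => p (u n)) l).
  { intros p Hp. destruct (Rcomplete.R_complete (fun n => p (u n))) as [l Hl]; [|now exists l].
    intros eps Heps. destruct (He eps Heps) as [N HN]. exists N.
    intros n m Hn Hm. unfold R_dist in *.
    assert (G : forall n m : nat, (n >= N)%nat -> (n <= m)%nat -> Rabs (p (u n) - p (u m)) < eps).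
    { intros a b Ha Hab. eapply Rle_lt_trans. apply Hp. eapply Rle_lt_trans. apply Hu, Hab.
      specialize (HN a Ha). rewrite Rminus_0_r in HN. eapply Rle_lt_trans; [apply Rle_abs|exact HN]. }
    destruct (Nat.le_ge_cases n m). apply G; auto.
    rewrite Rabs_minus_sym. apply G; auto. }
  destruct (Hc Re) as [a Ha].
  { intros x y. apply (re_le_Cmod (x - y)). }
  destruct (Hc Im) as [b Hb].
  { intros x y. eapply Rle_trans; [|apply (Rmax_Cmod (x - y))]. apply Rmax_r. }
  exists (a, b). intros n. apply le_epsilon. intros eps Heps.
  destruct (Ha (eps / 2)%R ltac:(lra)) as [N1 H1].
  destruct (Hb (eps / 2)%R ltac:(lra)) as [N2 H2].
  set (m := max n (max N1 N2)).
  specialize (H1 m ltac:(lia)). specialize (H2 m ltac:(lia)). unfold R_dist in H1, H2.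
  assert (H3 := Hu n m ltac:(lia)).
  eapply Rle_trans. apply (Cmod_triangle3 _ (u m)).
  assert (H4 := Cmod_le_Re_Im (u m - (a, b))).
  change (Re (u m - (a, b))) with (Re (u m) - a)%R in H4.
  change (Im (u m - (a, b))) with (Im (u m) - b)%R in H4. lra.
Qed.

(** Near [c], [schwarz_derivative] bounds [f'] and, applied to increments of [f], shows that [f'] is
    Lipschitz. Hence the difference quotients [(f (w + h) - f w) / h] are within [O(|h|)] of [f'],
    uniformly in [w]. Two of them, for [h] and [k], differ by [O(|h| + |k|)]; by the Cauchy estimate
    so do their derivatives at [c], which are the difference quotients of [f'] at [c]. These
    therefore converge. *)
Lemma holo_derive_at f c (r : R) : 0 < r -> holo f c r -> exists l, cder (C_derive f) c l.
Proof.
  intros Hr Hf.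
  assert (Hcc : ccont f c).
  { destruct (Hf c) as [l Hl]. rewrite Cmod_self; auto. eapply cder_ccont, Hl. }
  destruct (Hcc 1 Rlt_0_1) as [d0 [Hd0 Hb]].
  set (d := Rmin d0 r).
  assert (Hd : 0 < d) by (apply Rmin_pos; auto).
  assert (Hdr : d <= r) by apply Rmin_r.
  assert (Hb' : forall z, Cmod (z - c) < d -> Cmod (f z - f c) <= 1).
  { intros z Hz. left. apply Hb. eapply Rlt_le_trans; [exact Hz|apply Rmin_l]. }
  assert (HD : forall z, Cmod (z - c) < d -> cder f z (C_derive f z)).
  { intros z Hz. apply (holo_D f c r); auto. lra. }
  clearbody d.
  set (L1 := (4 / d)%R). assert (HL1 : 0 < L1) by (apply Rdiv_lt_0_compat; lra).
  assert (S1 : forall z, Cmod (z - c) < d / 2 -> Cmod (C_derive f z) <= L1).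
  { intros z Hz. assert (X := schwarz_derivative f z (d / 2) 2 ltac:(lra)).
    apply Rmult_le_reg_r with (d / 2)%R; [lra|]. unfold L1.
    replace (4 / d * (d / 2))%R with 2%R by (field; lra). apply X.
    - intros w Hw. exists (C_derive f w). apply HD. assert (T := Cmod_triangle3 w z c). lra.
    - intros w Hw. assert (T := Cmod_triangle3 w z c).
      assert (T2 := Cmod_triangle3 (f w) (f c) (f z)). rewrite (Cmod_minus_sym (f c)) in T2.
      assert (A := Hb' w ltac:(lra)). assert (B := Hb' z ltac:(lra)). lra. }
  assert (Hseg : forall z h t, 0 <= t <= 1 -> Cmod (z + RtoC t * h - c) <= Cmod (z - c) + Cmod h).
  { intros z h t Ht. replace (z + RtoC t * h - c) with ((z - c) + RtoC t * h) by ring.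
    eapply Rle_trans. apply Cmod_triangle. rewrite Cmod_mult, Cmod_R, Rabs_pos_eq by lra.
    assert (X := Cmod_ge_0 h). nra. }
  set (L2 := (8 * L1 / d)%R). assert (HL2 : 0 < L2) by (apply Rdiv_lt_0_compat; lra).
  assert (S2 : forall z h, Cmod (z - c) < d / 8 -> Cmod h < d / 8 ->
     Cmod (C_derive f (z + h) - C_derive f z) <= L2 * Cmod h).
  { intros z h Hz Hh.
    assert (HDz : forall w, Cmod (w - z) < d / 4 -> cder (fun w => f (w + h) - f w) w (C_derive f (w + h) - C_derive f w)).
    { intros w Hw. assert (T := Cmod_triangle3 w z c).
      apply cder_minus. apply cder_shift. apply HD.
      replace (w + h - c) with ((w - c) + h) by ring. assert (T2 := Cmod_triangle (w - c) h). lra.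
      apply HD; lra. }
    assert (X := cauchy_estimate (fun w => f (w + h) - f w) z (d / 4) (L1 * Cmod h) ltac:(lra)).
    rewrite (cder_unique _ _ _ (HDz z ltac:(rewrite Cmod_self; lra))) in X.
    apply Rmult_le_reg_r with (d / 4)%R; [lra|]. unfold L2.
    replace (8 * L1 / d * Cmod h * (d / 4))%R with (2 * (L1 * Cmod h))%R by (field; lra).
    apply X.
    - intros w Hw. eexists. apply HDz, Hw.
    - intros w Hw. assert (T := Cmod_triangle3 w z c).
      apply (segment_bound f (C_derive f)). intros t Ht. specialize (Hseg w h t Ht).
      split. apply HD; lra. apply S1; lra. }
  assert (S3 : forall w h, Cmod (w - c) < d / 8 -> Cmod h < d / 8 ->
     Cmod (f (w + h) - f w - C_derive f w * h) <= L2 * Cmod h * Cmod h).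
  { intros w h Hw Hh.
    assert (X := segment_bound (fun u => f u - C_derive f w * u) (fun u => C_derive f u - C_derive f w) w h (L2 * Cmod h)).
    cbv beta in X.
    replace (f (w + h) - f w - C_derive f w * h) with (f (w + h) - C_derive f w * (w + h) - (f w - C_derive f w * w)) by ring.
    apply X. intros t Ht. split.
    - eapply cder_eq. apply cder_minus. apply HD. specialize (Hseg w h t Ht). lra.
      apply cder_scal, cder_id. ring.
    - assert (E : Cmod (RtoC t * h) <= Cmod h).
      { rewrite Cmod_mult, Cmod_R, Rabs_pos_eq by lra. assert (Y := Cmod_ge_0 h). nra. }
      eapply Rle_trans. apply S2; lra. apply Rmult_le_compat_l; lra. }
  set (phi := fun h => (C_derive f (c + h) - C_derive f c) / h).
  set (L3 := (16 * L2 / d)%R). assert (HL3 : 0 < L3) by (apply Rdiv_lt_0_compat; lra).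
  assert (S4 : forall h k, 0 < Cmod h < d / 8 -> 0 < Cmod k < d / 8 ->
     Cmod (phi h - phi k) <= L3 * (Cmod h + Cmod k)).
  { intros h k Hh Hk.
    assert (h0 : h <> 0) by (apply Cmod_gt_0; lra). assert (k0 : k <> 0) by (apply Cmod_gt_0; lra).
    set (Q := fun w => / h * (f (w + h) - f w) - / k * (f (w + k) - f w)).
    assert (HQ : forall w, Cmod (w - c) < d / 8 ->
      cder Q w (/ h * (C_derive f (w + h) - C_derive f w) - / k * (C_derive f (w + k) - C_derive f w))).
    { intros w Hw. assert (T1 := Cmod_triangle (w - c) h). assert (T2 := Cmod_triangle (w - c) k).
      replace (w - c + h) with (w + h - c) in T1 by ring. replace (w - c + k) with (w + k - c) in T2 by ring.
      unfold Q. apply (cder_minus (fun w => / h * (f (w + h) - f w)) (fun w => / k * (f (w + k) - f w)));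
        [apply (cder_scal (/ h) (fun w => f (w + h) - f w)) | apply (cder_scal (/ k) (fun w => f (w + k) - f w))].
      - apply (cder_minus (fun w => f (w + h)) f). apply (cder_shift f h). apply HD; lra. apply HD; lra.
      - apply (cder_minus (fun w => f (w + k)) f). apply (cder_shift f k). apply HD; lra. apply HD; lra. }
    assert (X := cauchy_estimate Q c (d / 8) (L2 * (Cmod h + Cmod k)) ltac:(lra)).
    rewrite (cder_unique _ _ _ (HQ c ltac:(rewrite Cmod_self; lra))) in X.
    replace (phi h - phi k) with (/ h * (C_derive f (c + h) - C_derive f c) - / k * (C_derive f (c + k) - C_derive f c)) by (unfold phi, Cdiv; ring).
    apply Rmult_le_reg_r with (d / 8)%R; [lra|]. unfold L3.
    replace (16 * L2 / d * (Cmod h + Cmod k) * (d / 8))%R with (2 * (L2 * (Cmod h + Cmod k)))%R by (field; lra).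
    apply X.
    - intros w Hw. eexists. apply HQ, Hw.
    - intros w Hw. unfold Q.
      replace (/ h * (f (w + h) - f w) - / k * (f (w + k) - f w)) with
        ((f (w + h) - f w - C_derive f w * h) / h - (f (w + k) - f w - C_derive f w * k) / k) by (field; auto).
      eapply Rle_trans. apply Cmod_triangle_minus. rewrite !Cmod_div by auto.
      assert (A := S3 w h Hw (proj2 Hh)). assert (B := S3 w k Hw (proj2 Hk)).
      assert (A' : Cmod (f (w + h) - f w - C_derive f w * h) / Cmod h <= L2 * Cmod h).
      { apply Rmult_le_reg_r with (Cmod h); [lra|]. unfold Rdiv. rewrite Rmult_assoc, Rinv_l by lra. lra. }
      assert (B' : Cmod (f (w + k) - f w - C_derive f w * k) / Cmod k <= L2 * Cmod k).
      { apply Rmult_le_reg_r with (Cmod k); [lra|]. unfold Rdiv. rewrite Rmult_assoc, Rinv_l by lra. lra. }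
      lra. }
  clearbody L3.
  (* Any sequence of increments tending to zero exhibits the limit. *)
  set (hs := fun n => RtoC (d / 16 / INR (S n))).
  assert (HS : forall n, 0 < INR (S n)) by (intros; apply lt_0_INR; lia).
  assert (Hhs : forall n, Cmod (hs n) = (d / 16 / INR (S n))%R).
  { intros n. unfold hs. rewrite Cmod_R, Rabs_pos_eq; auto. left.
    apply Rdiv_lt_0_compat; auto. lra. }
  assert (Hhs0 : forall n, 0 < Cmod (hs n) < d / 8).
  { intros n. rewrite Hhs. split. apply Rdiv_lt_0_compat; auto; lra.
    apply Rle_lt_trans with (d / 16)%R; [|lra].
    apply Rmult_le_reg_r with (INR (S n)); auto. unfold Rdiv at 1. rewrite Rmult_assoc, Rinv_l by (specialize (HS n); lra).
    apply Rmult_le_compat_l. lra. rewrite S_INR. assert (Y := pos_INR n). lra. }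
  destruct (C_complete (fun n => phi (hs n)) (fun n => 2 * L3 * Cmod (hs n))%R) as [l Hl].
  { intros eps He. destruct (archimed_cor1 (eps / (2 * L3 * (d / 16)))) as [N [HN HN0]].
    { apply Rdiv_lt_0_compat; auto. repeat apply Rmult_lt_0_compat; lra. }
    exists N. intros n Hn. unfold R_dist. rewrite Rminus_0_r, Rabs_pos_eq.
    2:{ destruct (Hhs0 n). apply Rmult_le_pos; lra. }
    rewrite Hhs.
    assert (I : / INR (S n) <= / INR N). { apply Rinv_le_contravar. apply lt_0_INR; lia. apply le_INR. lia. }
    replace (2 * L3 * (d / 16 / INR (S n)))%R with (2 * L3 * (d / 16) * / INR (S n))%R by (unfold Rdiv; ring).
    apply Rle_lt_trans with (2 * L3 * (d / 16) * / INR N)%R.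
    apply Rmult_le_compat_l; auto. apply Rmult_le_pos; lra.
    apply (Rmult_lt_compat_l (2 * L3 * (d / 16))) in HN.
    2: repeat apply Rmult_lt_0_compat; lra.
    replace (2 * L3 * (d / 16) * (eps / (2 * L3 * (d / 16))))%R with eps in HN by (field; lra). exact HN. }
  { intros n m Hnm. eapply Rle_trans. apply S4; apply Hhs0.
    assert (Cmod (hs m) <= Cmod (hs n)).
    { rewrite !Hhs. apply Rmult_le_compat_l. lra. apply Rinv_le_contravar; auto. apply le_INR. lia. }
    assert (L3 * Cmod (hs m) <= L3 * Cmod (hs n)) by (apply Rmult_le_compat_l; lra). lra. }
  (* Letting [k] tend to zero in [S4] along that sequence. *)
  assert (S5 : forall h, 0 < Cmod h < d / 8 -> Cmod (phi h - l) <= L3 * Cmod h).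
  { intros h Hh. apply le_epsilon. intros eps He.
    destruct (archimed_cor1 (eps / (3 * L3 * (d / 16)))) as [N [HN HN0]].
    { apply Rdiv_lt_0_compat; auto. repeat apply Rmult_lt_0_compat; lra. }
    assert (I : / INR (S N) <= / INR N). { apply Rinv_le_contravar. apply lt_0_INR; lia. apply le_INR. lia. }
    assert (B : 3 * L3 * Cmod (hs N) <= eps).
    { rewrite Hhs.
      replace (3 * L3 * (d / 16 / INR (S N)))%R with (3 * L3 * (d / 16) * / INR (S N))%R by (unfold Rdiv; ring).
      apply Rle_trans with (3 * L3 * (d / 16) * / INR N)%R.
      apply Rmult_le_compat_l; auto. apply Rmult_le_pos; lra.
      apply (Rmult_lt_compat_l (3 * L3 * (d / 16))) in HN.
      2: repeat apply Rmult_lt_0_compat; lra.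
      replace (3 * L3 * (d / 16) * (eps / (3 * L3 * (d / 16))))%R with eps in HN by (field; lra). lra. }
    assert (T := Cmod_triangle3 (phi h) (phi (hs N)) l).
    assert (A1 := S4 h (hs N) Hh (Hhs0 N)). assert (A2 := Hl N). lra. }
  exists l. apply cder_eps. intros eps. assert (He := cond_pos eps).
  assert (Hdel : 0 < Rmin (d / 8) (eps / L3)) by (apply Rmin_pos; [lra|apply Rdiv_lt_0_compat; lra]).
  exists (mkposreal _ Hdel). intros w Hw. simpl in Hw.
  destruct (Ceq_dec w c) as [->|N].
  { replace (C_derive f c - C_derive f c - l * (c - c)) with (RtoC 0) by ring.
    rewrite Cmod_0, Cmod_self. lra. }
  assert (N2 : w - c <> 0). { intros E. apply N. replace w with ((w - c) + c) by ring. rewrite E. ring. }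
  assert (Hp := proj1 (Cmod_gt_0 _) N2).
  assert (W1 := Rlt_le_trans _ _ _ Hw (Rmin_l _ _)). assert (W2 := Rlt_le_trans _ _ _ Hw (Rmin_r _ _)).
  assert (F := S5 (w - c) ltac:(lra)).
  replace (C_derive f w - C_derive f c - l * (w - c)) with ((phi (w - c) - l) * (w - c)).
  2:{ unfold phi. replace (c + (w - c)) with w by ring. field. auto. }
  rewrite Cmod_mult. apply Rmult_le_compat_r; [lra|].
  eapply Rle_trans; [exact F|]. apply (Rmult_lt_compat_l L3) in W2; [|lra].
  replace (L3 * (eps / L3))%R with (pos eps) in W2 by (field; lra). lra.
Qed.

Lemma holo_derive f c r : holo f c r -> holo (C_derive f) c r.
Proof.
  intros H z Hz. apply (holo_derive_at f z (r - Cmod (z - c))). lra.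
  apply (holo_sub f c r); auto. lra.
Qed.

(** Without a zero, [1 / f] would be holomorphic, and larger at [p] than on the circle about [p]. *)
Lemma zero_in_disc f p (d m : R) : 0 < d ->
  (forall z, Cmod (z - p) <= d -> exists l, cder f z l) ->
  Cmod (f p) < m -> (forall z, Cmod (z - p) = d -> m <= Cmod (f z)) ->
  exists z, Cmod (z - p) <= d /\ f z = 0.
Proof.
  intros Hd Hf Hp Hm. apply NNPP. intros N.
  assert (Nz : forall z, Cmod (z - p) <= d -> f z <> 0).
  { intros z Hz E. apply N. now exists z. }
  assert (N0 : f p <> 0) by (apply Nz; rewrite Cmod_self; lra).
  assert (P0 := proj1 (Cmod_gt_0 _) N0).
  assert (Hi : forall z, Cmod (z - p) <= d -> exists l, cder (fun w => / f w) z l).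
  { intros z Hz. destruct (Hf z Hz) as [l Hl]. eexists. apply cder_inv; eauto. }
  assert (X : Cmod (/ f p) <= / m).
  { apply (mean_value_bound (fun w => / f w) p d); auto.
    - intros z Hz. apply Hi; lra.
    - destruct (Hi p) as [l Hl]. rewrite Cmod_self; lra. eapply cder_ccont, Hl.
    - intros z Hz. rewrite Cmod_inv. 2: apply Nz; lra.
      apply Rinv_le_contravar. lra. apply Hm, Hz. }
  rewrite Cmod_inv in X by auto.
  apply Rinv_le_contravar in X. rewrite !Rinv_inv in X. lra. apply Rinv_0_lt_compat; auto.
Qed.

Lemma Cmod_mono (a b a' b' : R) : Rabs a <= Rabs a' -> Rabs b <= Rabs b' -> Cmod (a, b) <= Cmod (a', b').
Proof.
  intros Ha Hb. unfold Cmod. apply sqrt_le_1_alt. cbn [fst snd].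
  apply Rsqr_le_abs_1 in Ha. apply Rsqr_le_abs_1 in Hb. unfold Rsqr in *. lra.
Qed.

(** The primitive integrates [f] from [c] horizontally and then vertically. By Goursat's theorem its
    increment from [z] to a nearby [w] is the integral over the short horizontal-then-vertical path
    from [z] to [w], along which [f] is almost [f z]. *)
Lemma holo_primitive f c (r : R) : holo f c r ->
  exists P, forall z, Cmod (z - c) < r -> cder P z (f z).
Proof.
  intros Hf. destruct c as [x0 y0].
  exists (fun z => line_int f (0, y0) 1 x0 (Re z) + line_int f (Re z, 0) Ci y0 (Im z)).
  intros [x y] Hz.
  assert (Hcf : forall w, Cmod (w - (x0, y0)) < r -> ccont f w).
  { intros w Hw. destruct (Hf w Hw) as [l Hl]. eapply cder_ccont, Hl. }
  set (s := (r - Cmod ((x, y) - (x0, y0)))%R). assert (Hs : 0 < s) by (unfold s; lra).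
  assert (Hnear : forall a b, Cmod ((a, b) - (x, y)) < s -> Cmod ((a, b) - (x0, y0)) < r).
  { intros a b H. assert (T := Cmod_triangle3 (a, b) (x, y) (x0, y0)). unfold s in H. lra. }
  assert (Hdown : forall a t, Cmod ((a, y) - (x0, y0)) < r -> Rmin y0 y <= t <= Rmax y0 y -> Cmod ((a, t) - (x0, y0)) < r).
  { intros a t H Ht. eapply Rle_lt_trans; [|exact H]. apply Cmod_mono. apply Rle_refl.
    destruct (Rle_dec y0 y) as [L|L].
    - rewrite Rmin_left, Rmax_right in Ht by lra. rewrite !Rabs_pos_eq; simpl; lra.
    - rewrite Rmin_right, Rmax_left in Ht by lra. rewrite !Rabs_left1; simpl; lra. }
  assert (Hbase : forall a t, Cmod ((a, y) - (x0, y0)) < r -> Rmin x0 a <= t <= Rmax x0 a -> Cmod ((t, y0) - (x0, y0)) < r).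
  { intros a t H Ht. eapply Rle_lt_trans; [|exact H]. apply Cmod_mono.
    2:{ simpl. rewrite Rplus_opp_r, Rabs_R0. apply Rabs_pos. }
    destruct (Rle_dec x0 a) as [L|L].
    - rewrite Rmin_left, Rmax_right in Ht by lra. rewrite !Rabs_pos_eq; simpl; lra.
    - rewrite Rmin_right, Rmax_left in Ht by lra. rewrite !Rabs_left1; simpl; lra. }
  apply cder_eps. intros eps. assert (He := cond_pos eps).
  destruct (Hcf (x, y) Hz (eps / 2)%R ltac:(lra)) as [d [Hd Hfd]].
  assert (Hdel : 0 < Rmin s d) by (apply Rmin_pos; auto).
  exists (mkposreal _ Hdel). intros [x' y'] Hw. simpl in Hw.
  assert (W1 := Rlt_le_trans _ _ _ Hw (Rmin_l _ _)). assert (W2 := Rlt_le_trans _ _ _ Hw (Rmin_r _ _)).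
  cbn [Re Im fst snd].
  assert (Hx : forall t, Rmin x x' <= t <= Rmax x x' -> Cmod ((t, y) - (x, y)) <= Cmod ((x', y') - (x, y))).
  { intros t Ht. apply Cmod_mono. 2:{ simpl. rewrite Rplus_opp_r, Rabs_R0. apply Rabs_pos. }
    destruct (Rle_dec x x') as [L|L].
    - rewrite Rmin_left, Rmax_right in Ht by lra. rewrite !Rabs_pos_eq; simpl; lra.
    - rewrite Rmin_right, Rmax_left in Ht by lra. rewrite !Rabs_left1; simpl; lra. }
  assert (Hy : forall t, Rmin y y' <= t <= Rmax y y' -> Cmod ((x', t) - (x, y)) <= Cmod ((x', y') - (x, y))).
  { intros t Ht. apply Cmod_mono. apply Rle_refl.
    destruct (Rle_dec y y') as [L|L].
    - rewrite Rmin_left, Rmax_right in Ht by lra. rewrite !Rabs_pos_eq; simpl; lra.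
    - rewrite Rmin_right, Rmax_left in Ht by lra. rewrite !Rabs_left1; simpl; lra. }
  assert (Hx'y : Cmod ((x', y) - (x0, y0)) < r).
  { apply Hnear. eapply Rle_lt_trans; [apply Hx|exact W1]. split. apply Rmin_r. apply Rmax_r. }
  assert (C1 : cont_on_line f (0, y0) 1 x0 x).
  { intros t Ht. rewrite horizontal_point. apply Hcf. apply (Hbase x); auto. }
  assert (C2 : cont_on_line f (0, y0) 1 x0 x').
  { intros t Ht. rewrite horizontal_point. apply Hcf. apply (Hbase x'); auto. }
  assert (C3 : cont_on_line f (0, y) 1 x x').
  { intros t Ht. rewrite horizontal_point. apply Hcf, Hnear. eapply Rle_lt_trans; [apply Hx, Ht|exact W1]. }
  assert (C4 : cont_on_line f (x', 0) Ci y y').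
  { intros t Ht. rewrite vertical_point. apply Hcf, Hnear. eapply Rle_lt_trans; [apply Hy, Ht|exact W1]. }
  assert (C5 : cont_on_line f (x', 0) Ci y0 y).
  { intros t Ht. rewrite vertical_point. apply Hcf, Hdown; auto. }
  assert (G : rect_int f x x' y0 y = 0).
  { apply Goursat_signed. intros [a b] [Z1 Z2]. apply Hf. simpl in Z1, Z2. apply Hdown; auto.
    apply Hnear. eapply Rle_lt_trans; [apply Hx, Z1|exact W1]. }
  unfold rect_int in G.
  assert (E1 := line_int_Chasles f (0, y0) 1 x x0 x' (cont_on_line_swap _ _ _ _ _ C1) C2).
  rewrite (line_int_swap f (0, y0) 1 x0 x C1) in E1.
  rewrite E1 in G.
  rewrite (line_int_Chasles f (x', 0) Ci y0 y y' C5 C4).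
  set (A := line_int f (0, y0) 1 x0 x') in *. set (B := line_int f (0, y0) 1 x0 x) in *.
  set (U := line_int f (0, y) 1 x x') in *. set (V := line_int f (x', 0) Ci y0 y) in *.
  set (W := line_int f (x', 0) Ci y y') in *. set (Z := line_int f (x, 0) Ci y0 y) in *.
  assert (CC : forall z, ccont (fun _ => f (x, y)) z).
  { intros z. eapply cder_ccont, cder_const. }
  assert (K : forall z h a b, line_int (fun _ => f (x, y)) z h a b = f (x, y) * (z + b * h) - f (x, y) * (z + a * h)).
  { intros z h a b. rewrite (line_int_primitive (fun z => f (x, y) * z)). reflexivity.
    intros t _. eapply cder_eq. apply cder_scal, cder_id. ring. intros t Ht. apply CC. }
  assert (EU : U - f (x, y) * ((x', y) - (x, y)) = line_int (fun w => f w - f (x, y)) (0, y) 1 x x').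
  { rewrite line_int_minus, K, !horizontal_point; auto. fold U. ring. intros t Ht; apply CC. }
  assert (EW : W - f (x, y) * ((x', y') - (x', y)) = line_int (fun w => f w - f (x, y)) (x', 0) Ci y y').
  { rewrite line_int_minus, K, !vertical_point; auto. fold W. ring. intros t Ht; apply CC. }
  (* The last bracket is the boundary integral over the rectangle between the two vertical paths. *)
  replace (A + (V + W) - (B + Z) - f (x, y) * ((x', y') - (x, y))) with
    ((U - f (x, y) * ((x', y) - (x, y))) + (W - f (x, y) * ((x', y') - (x', y))) + (- B + A - U + V - Z)) by ring.
  rewrite G, EU, EW, Cplus_0_r.
  assert (BU : Cmod (line_int (fun w => f w - f (x, y)) (0, y) 1 x x') <= Rabs (x' - x) * (Cmod 1 * (eps / 2))).
  { apply line_int_bound_abs.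
    - intros t Ht. apply ccont_minus; auto.
    - intros t Ht. rewrite horizontal_point. left. apply Hfd. eapply Rle_lt_trans; [apply Hx, Ht|exact W2]. }
  assert (BW : Cmod (line_int (fun w => f w - f (x, y)) (x', 0) Ci y y') <= Rabs (y' - y) * (Cmod Ci * (eps / 2))).
  { apply line_int_bound_abs.
    - intros t Ht. apply ccont_minus; auto.
    - intros t Ht. rewrite vertical_point. left. apply Hfd. eapply Rle_lt_trans; [apply Hy, Ht|exact W2]. }
  rewrite Cmod_1 in BU. rewrite Cmod_Ci in BW.
  assert (R1 := Rmax_Cmod ((x', y') - (x, y))).
  assert (R2 := Rmax_l (Rabs (fst ((x', y') - (x, y)))) (Rabs (snd ((x', y') - (x, y))))).
  assert (R3 := Rmax_r (Rabs (fst ((x', y') - (x, y)))) (Rabs (snd ((x', y') - (x, y))))).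
  change (fst ((x', y') - (x, y))) with (x' - x)%R in *. change (snd ((x', y') - (x, y))) with (y' - y)%R in *.
  eapply Rle_trans. apply Cmod_triangle. nra.
Qed.

(** * Logarithms, and functions with positive real part *)

Lemma derive_0_constant f c (r : R) : (forall z, Cmod (z - c) < r -> cder f z 0) ->
  forall z, Cmod (z - c) < r -> f z = f c.
Proof.
  intros H z Hz.
  assert (X := segment_bound f (fun _ => 0) c (z - c) 0).
  replace (c + (z - c)) with z in X by ring. rewrite Rmult_0_l in X.
  assert (E : f z - f c = 0).
  { apply Cmod_eq_0, Rle_antisym; [|apply Cmod_ge_0]. apply X.
    intros t Ht. rewrite Cmod_0. split; [|lra]. apply H.
    replace (c + t * (z - c) - c) with (RtoC t * (z - c)) by ring.
    rewrite Cmod_mult, Cmod_R, Rabs_pos_eq by lra. assert (Y := Cmod_ge_0 (z - c)). nra. }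
  replace (f z) with ((f z - f c) + f c) by ring. rewrite E. ring.
Qed.

(** Take a primitive [h] of [q' / q] with [cexp (h c) = q c]; then [q * cexp (- h)] has derivative
    zero. *)
Lemma holo_log (q : C -> C) c (r : R) : 0 < r -> holo q c r ->
  (forall z, Cmod (z - c) < r -> q z <> 0) ->
  exists h, holo h c r /\ (forall z, Cmod (z - c) < r -> cexp (h z) = q z)
    /\ (forall z, Cmod (z - c) < r -> C_derive h z = C_derive q z / q z).
Proof.
  intros Hr Hq Hq0.
  destruct (holo_primitive (fun z => C_derive q z / q z) c r) as [P HP].
  { intros z Hz. destruct (holo_derive q c r Hq z Hz) as [l Hl].
    eexists. apply (cder_div (C_derive q) q). auto. exact Hl. apply (holo_D q c r); auto. }
  assert (Hc0 : Cmod (c - c) < r) by (rewrite Cmod_self; auto).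
  destruct (cexp_surj (q c) (Hq0 c Hc0)) as [l0 Hl0].
  set (h := fun z => P z + (l0 - P c)).
  assert (Hh : forall z, Cmod (z - c) < r -> cder h z (C_derive q z / q z)).
  { intros z Hz. eapply cder_eq. apply (cder_plus P (fun _ => l0 - P c)). apply HP, Hz. apply cder_const. ring. }
  exists h. split; [|split].
  - intros z Hz. eexists. apply Hh, Hz.
  - intros z Hz.
    assert (E : q z * cexp (- h z) = q c * cexp (- h c)).
    { apply (derive_0_constant (fun z => q z * cexp (- h z)) c r); auto.
      intros w Hw. eapply cder_eq. apply (cder_mult q (fun z => cexp (- h z))). apply (holo_D q c r); auto.
      apply (cder_comp cexp (fun z => - h z)). apply cder_cexp.
      apply (cder_ext (fun z => (- (1)) * h z)). intros; ring. apply cder_scal, Hh, Hw.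
      field. auto. }
    replace (h c) with l0 in E by (unfold h; ring).
    rewrite !cexp_opp, Hl0 in E.
    assert (N1 := cexp_neq_0 (h z)). assert (N2 := Hq0 c Hc0).
    replace (q z) with (q z * / cexp (h z) * cexp (h z)) by (field; auto).
    rewrite E. field. auto.
  - intros z Hz. apply cder_unique, Hh, Hz.
Qed.

Lemma Cmod_sqr (z : C) : (Cmod z * Cmod z)%R = (Re z * Re z + Im z * Im z)%R.
Proof. assert (H := Cmod2_alt z). simpl in H. lra. Qed.

Lemma Cmod_lt_sqr (a b : C) : Cmod a * Cmod a < Cmod b * Cmod b -> Cmod a < Cmod b.
Proof. assert (H := Cmod_ge_0 a). assert (H2 := Cmod_ge_0 b). nra. Qed.

Lemma cayley_lt (a b : C) : 0 < Re a -> 0 < Re b -> Cmod (a - b) < Cmod (a + Cconj b).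
Proof.
  intros Ha Hb. apply Cmod_lt_sqr. rewrite !Cmod_sqr.
  destruct a as [a1 a2], b as [b1 b2]. simpl in *. nra.
Qed.

(** The Cayley transform [(h - h c) / (h + Cconj (h c))] maps into the unit disc, vanishes at [c],
    and has there the derivative [C_derive h c / (2 Re (h c))]: the Schwarz lemma applies. The
    constant 2 is sharp, which matters in [harnack]. *)
Lemma pos_re_derivative h c (r : R) : 0 < r -> holo h c r ->
  (forall z, Cmod (z - c) < r -> 0 < Re (h z)) -> Cmod (C_derive h c) * r <= 2 * Re (h c).
Proof.
  intros Hr Hh Hpos.
  assert (Hc0 : Cmod (c - c) < r) by (rewrite Cmod_self; auto).
  set (b := h c). assert (Hb : 0 < Re b) by (apply Hpos; auto).
  assert (Hden : forall z, Cmod (z - c) < r -> 0 < Cmod (h z + Cconj b)).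
  { intros z Hz. assert (X := cayley_lt (h z) b (Hpos z Hz) Hb).
    assert (Y := Cmod_ge_0 (h z - b)). lra. }
  assert (Hden0 : forall z, Cmod (z - c) < r -> h z + Cconj b <> 0).
  { intros z Hz. apply Cmod_gt_0, Hden, Hz. }
  set (om := fun z => (h z - b) / (h z + Cconj b)).
  assert (Hom : forall z, Cmod (z - c) < r -> cder om z
    ((C_derive h z * (h z + Cconj b) - (h z - b) * C_derive h z) / ((h z + Cconj b) * (h z + Cconj b)))).
  { intros z Hz. apply (cder_div (fun z => h z - b) (fun z => h z + Cconj b)). auto.
    eapply cder_eq. apply cder_minus. apply (holo_D h c r); auto. apply cder_const. ring.
    eapply cder_eq. apply cder_plus. apply (holo_D h c r); auto. apply cder_const. ring. }
  assert (E2 : b + Cconj b = RtoC (2 * Re b)).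
  { destruct b as [b1 b2]. apply injective_projections; simpl; ring. }
  assert (E0 : om c = 0). { unfold om. fold b. replace (b - b) with (RtoC 0) by ring. unfold Cdiv. ring. }
  assert (N2 : RtoC (2 * Re b) <> 0). { intros E. apply RtoC_inj in E. lra. }
  assert (X := schwarz_derivative om c r 1 Hr).
  rewrite (cder_unique _ _ _ (Hom c Hc0)) in X. fold b in X.
  replace ((C_derive h c * (b + Cconj b) - (b - b) * C_derive h c) / ((b + Cconj b) * (b + Cconj b)))
     with (C_derive h c / RtoC (2 * Re b)) in X.
  2:{ rewrite E2. field. auto. }
  rewrite Cmod_div, Cmod_R, Rabs_pos_eq in X by (auto; lra).
  assert (Y : Cmod (C_derive h c) / (2 * Re b) * r <= 1).
  { apply X. intros z Hz. eexists; apply Hom, Hz.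
    intros z Hz. rewrite E0. unfold Cminus. replace (om z + - 0) with (om z) by ring.
    unfold om. rewrite Cmod_div by auto. specialize (Hden z Hz).
    apply Rmult_le_reg_r with (Cmod (h z + Cconj b)); auto.
    unfold Rdiv. rewrite Rmult_assoc, Rinv_l by lra.
    assert (Z := cayley_lt (h z) b (Hpos z Hz) Hb). lra. }
  apply (Rmult_le_compat_l (2 * Re b)) in Y; [|lra].
  replace (2 * Re b * (Cmod (C_derive h c) / (2 * Re b) * r))%R with (Cmod (C_derive h c) * r)%R in Y by (field; lra).
  lra.
Qed.

Lemma Cconj_mult_mod (a : C) : Cconj a * a = RtoC (Cmod a * Cmod a).
Proof. rewrite Cmod_sqr. destruct a. apply injective_projections; simpl; ring. Qed.

(** Precompose with the automorphism of the disc that carries its centre to [z]. *)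
Lemma pos_re_derivative_off_centre h c (r : R) z : 0 < r -> holo h c r ->
  (forall w, Cmod (w - c) < r -> 0 < Re (h w)) -> Cmod (z - c) < r ->
  Cmod (C_derive h z) * (r * r - Cmod (z - c) * Cmod (z - c)) <= 2 * r * Re (h z).
Proof.
  intros Hr Hh Hpos Hz.
  set (a := (z - c) / RtoC r).
  assert (Nr : RtoC r <> 0). { intros E. apply RtoC_inj in E. lra. }
  assert (Ea : Cmod a = (Cmod (z - c) / r)%R).
  { unfold a. rewrite Cmod_div, Cmod_R, Rabs_pos_eq; auto; lra. }
  assert (Ha : Cmod a < 1).
  { rewrite Ea. apply Rmult_lt_reg_r with r; auto. unfold Rdiv. rewrite Rmult_assoc, Rinv_l; lra. }
  assert (Ha0 := Cmod_ge_0 a).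
  assert (Hden : forall w, Cmod w < 1 -> 0 < Cmod (1 + Cconj a * w)).
  { intros w Hw. assert (T := Cmod_triangle_rev 1 (- (Cconj a * w))).
    replace (1 - - (Cconj a * w)) with (1 + Cconj a * w) in T by ring.
    rewrite Cmod_opp, Cmod_1, Cmod_mult, Cmod_conj in T.
    assert (W := Cmod_ge_0 w). nra. }
  assert (Hden0 : forall w, Cmod w < 1 -> 1 + Cconj a * w <> 0).
  { intros w Hw. apply Cmod_gt_0, Hden, Hw. }
  (* [phi] maps the unit disc onto the given one and [0] to [z]. *)
  set (phi := fun w => c + RtoC r * ((w + a) / (1 + Cconj a * w))).
  assert (Hphi : forall w, Cmod w < 1 -> Cmod (phi w - c) < r).
  { intros w Hw. unfold phi.
    replace (c + RtoC r * ((w + a) / (1 + Cconj a * w)) - c) with (RtoC r * ((w + a) / (1 + Cconj a * w))) by ring.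
    rewrite Cmod_mult, Cmod_R, Rabs_pos_eq, Cmod_div by (auto; lra).
    assert (X : Cmod (w + a) < Cmod (1 + Cconj a * w)).
    { apply Cmod_lt_sqr.
      assert (Y : (Cmod w * Cmod w < 1)%R) by (assert (W := Cmod_ge_0 w); nra).
      assert (Y2 : (Cmod a * Cmod a < 1)%R) by nra.
      rewrite Cmod_sqr in Y, Y2. rewrite !Cmod_sqr.
      destruct a as [a1 a2], w as [w1 w2]. simpl in *. nra. }
    specialize (Hden w Hw).
    assert (X2 : Cmod (w + a) / Cmod (1 + Cconj a * w) < 1).
    { apply Rmult_lt_reg_r with (Cmod (1 + Cconj a * w)); auto. unfold Rdiv. rewrite Rmult_assoc, Rinv_l; lra. }
    nra. }
  assert (Hdphi : forall w, Cmod w < 1 -> cder phi w (RtoC r * ((1 * (1 + Cconj a * w) - (w + a) * Cconj a) / ((1 + Cconj a * w) * (1 + Cconj a * w))))).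
  { intros w Hw. unfold phi. eapply cder_eq. apply cder_plus. apply cder_const. apply cder_scal.
    apply (cder_div (fun w => w + a) (fun w => 1 + Cconj a * w)). auto.
    eapply cder_eq. apply cder_plus. apply cder_id. apply cder_const. instantiate (1 := 1). ring.
    eapply cder_eq. apply cder_plus. apply cder_const. apply cder_scal, cder_id. instantiate (1 := Cconj a). ring.
    ring. }
  assert (H00 : Cmod 0 < 1) by (rewrite Cmod_0; lra).
  assert (P0 : phi 0 = z). { unfold phi. replace ((0 + a) / (1 + Cconj a * 0)) with a.
    unfold a. field. auto. replace (1 + Cconj a * 0) with (RtoC 1) by ring. field. }
  assert (S0 : forall w, w - 0 = w) by (intros; ring).
  assert (Hcomp : forall w, Cmod (w - 0) < 1 -> cder (fun w => h (phi w)) w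
      (C_derive h (phi w) * (RtoC r * ((1 * (1 + Cconj a * w) - (w + a) * Cconj a) / ((1 + Cconj a * w) * (1 + Cconj a * w)))))).
  { intros w Hw. rewrite S0 in Hw. apply (cder_comp h phi). apply (holo_D h c r); auto. apply Hdphi, Hw. }
  assert (X := pos_re_derivative (fun w => h (phi w)) 0 1 Rlt_0_1).
  rewrite (cder_unique _ _ _ (Hcomp 0 ltac:(rewrite S0; auto))), P0 in X.
  replace (RtoC r * ((1 * (1 + Cconj a * 0) - (0 + a) * Cconj a) / ((1 + Cconj a * 0) * (1 + Cconj a * 0))))
     with (RtoC r * (1 - Cconj a * a)) in X.
  2:{ replace (1 + Cconj a * 0) with (RtoC 1) by ring. field. }
  rewrite Cconj_mult_mod, <- RtoC_minus, !Cmod_mult, !Cmod_R, !Rabs_pos_eq in X by nra.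
  assert (Y : Cmod (C_derive h z) * (r * (1 - Cmod a * Cmod a)) * 1 <= 2 * Re (h z)).
  { apply X. intros w Hw. eexists. apply Hcomp, Hw. intros w Hw. rewrite S0 in Hw. apply Hpos, Hphi, Hw. }
  rewrite Ea in Y. apply (Rmult_le_compat_l r) in Y; [|lra].
  replace (r * (Cmod (C_derive h z) * (r * (1 - Cmod (z - c) / r * (Cmod (z - c) / r))) * 1))%R
    with (Cmod (C_derive h z) * (r * r - Cmod (z - c) * Cmod (z - c)))%R in Y by (field; lra).
  lra.
Qed.

Lemma MVT_increasing (f df : R -> R) (a b : R) : a <= b ->
  (forall t, a <= t <= b -> is_derive f t (df t) /\ 0 <= df t) -> f a <= f b.
Proof.
  intros Hab H. destruct (MVT_gen f a b df) as [t [Ht E]].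
  - intros x Hx. rewrite Rmin_left, Rmax_right in Hx by lra. apply H; lra.
  - intros x Hx. rewrite Rmin_left, Rmax_right in Hx by lra.
    apply continuity_pt_filterlim, (ex_derive_continuous (K := R_AbsRing) (V := R_NormedModule)).
    eexists. apply H; lra.
  - rewrite Rmin_left, Rmax_right in Ht by lra. destruct (H t Ht). nra.
Qed.

(** Let [u] be the real part of [h] along the radius from [c] to [z], as a function of the distance
    [s] from [c]. The sharp estimate [|u'| <= 2 r u / (r^2 - s^2)] says exactly that
    [u (r + s) / (r - s)] increases and [u (r - s) / (r + s)] decreases. *)
Lemma harnack h c (r : R) z : 0 < r -> holo h c r ->
  (forall w, Cmod (w - c) < r -> 0 < Re (h w)) -> Cmod (z - c) < r ->
  Re (h c) * (r - Cmod (z - c)) <= Re (h z) * (r + Cmod (z - c)) /\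
  Re (h z) * (r - Cmod (z - c)) <= Re (h c) * (r + Cmod (z - c)).
Proof.
  intros Hr Hh Hpos Hz. set (s := Cmod (z - c)) in *.
  assert (Hs := Cmod_ge_0 (z - c)). fold s in Hs.
  set (v := z - c).
  set (u := fun t : R => Re (1 * h (c + t * v))).
  set (du := fun t : R => Re (1 * (C_derive h (c + t * v) * v))).
  assert (Hin : forall t : R, 0 <= t <= 1 -> Cmod (c + t * v - c) = (t * s)%R).
  { intros t Ht. replace (c + t * v - c) with (RtoC t * v) by ring.
    rewrite Cmod_mult, Cmod_R, Rabs_pos_eq by lra. reflexivity. }
  assert (Hts : forall t : R, 0 <= t <= 1 -> 0 <= t * s < r) by (intros; nra).
  assert (Hu : forall t : R, 0 <= t <= 1 -> is_derive u t (du t)).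
  { intros t Ht. apply cder_Re_line. apply (holo_D h c r); auto. rewrite Hin by auto. apply Hts, Ht. }
  assert (Hdu : forall t, 0 <= t <= 1 -> Rabs (du t) * ((r - t * s) * (r + t * s)) <= 2 * r * s * u t).
  { intros t Ht. assert (X := pos_re_derivative_off_centre h c r (c + t * v) Hr Hh Hpos).
    rewrite Hin in X by auto. specialize (X (proj2 (Hts t Ht))).
    assert (A : Rabs (du t) <= Cmod (C_derive h (c + t * v)) * s).
    { unfold du. eapply Rle_trans. apply re_le_Cmod. rewrite !Cmod_mult, Cmod_1. fold v in s. fold s. lra. }
    assert (B := Hts t Ht).
    assert (D : 0 <= (r - t * s) * (r + t * s)) by nra.
    apply (Rmult_le_compat_r _ _ _ D) in A. eapply Rle_trans; [exact A|].
    unfold u. rewrite Cmult_1_l. apply (Rmult_le_compat_r s) in X; lra. }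
  assert (Hu0 : u 0%R = Re (h c)). { unfold u. f_equal. replace (c + 0%R * v) with c by ring. ring. }
  assert (Hu1 : u 1%R = Re (h z)). { unfold u, v. f_equal. replace (c + 1%R * (z - c)) with z by ring. ring. }
  assert (Hm : forall t : R, is_derive (fun t : R => r - t * s)%R t (- s)%R).
  { intros t. auto_derive; auto; ring. }
  assert (Hp : forall t : R, is_derive (fun t : R => r + t * s)%R t s).
  { intros t. auto_derive; auto; ring. }
  split.
  - assert (X := MVT_increasing (fun t => u t * ((r + t * s) / (r - t * s)))%R
      (fun t => du t * ((r + t * s) / (r - t * s)) + u t * ((s * (r - t * s) - (r + t * s) * (- s)) / (r - t * s) ^ 2))%R 0 1 ltac:(lra)).
    cbv beta in X. rewrite Hu0, Hu1, Rmult_0_l, Rmult_1_l, Rplus_0_r, Rminus_0_r in X.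
    replace (r / r)%R with 1%R in X by (field; lra).
    assert (Y : Re (h c) * 1 <= Re (h z) * ((r + s) / (r - s))).
    { apply X. intros t Ht. assert (B := Hts t Ht). split.
      - apply (is_derive_mult u (fun t => (r + t * s) / (r - t * s))%R); auto.
        apply (is_derive_div (fun t => r + t * s)%R (fun t => r - t * s)%R t s (- s)%R); auto. lra. intros; apply Rmult_comm.
      - specialize (Hdu t Ht). assert (Q := Rle_abs (- du t)). rewrite Rabs_Ropp in Q.
        replace (du t * ((r + t * s) / (r - t * s)) + u t * ((s * (r - t * s) - (r + t * s) * (- s)) / (r - t * s) ^ 2))%R
         with ((du t * ((r - t * s) * (r + t * s)) + 2 * r * s * u t) * / ((r - t * s) ^ 2))%R by (field; lra).
        apply Rmult_le_pos. 2: left; apply Rinv_0_lt_compat, pow_lt; lra.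
        assert (D : 0 <= (r - t * s) * (r + t * s)) by nra.
        apply (Rmult_le_compat_r _ _ _ D) in Q. lra. }
    apply (Rmult_le_compat_r (r - s)) in Y; [|lra].
    replace (Re (h z) * ((r + s) / (r - s)) * (r - s))%R with (Re (h z) * (r + s))%R in Y by (field; lra). lra.
  - assert (X := MVT_increasing (fun t => - (u t * ((r - t * s) / (r + t * s))))%R
      (fun t => - (du t * ((r - t * s) / (r + t * s)) + u t * ((- s * (r + t * s) - (r - t * s) * s) / (r + t * s) ^ 2)))%R 0 1 ltac:(lra)).
    cbv beta in X. rewrite Hu0, Hu1, Rmult_0_l, Rmult_1_l, Rplus_0_r, Rminus_0_r in X.
    replace (r / r)%R with 1%R in X by (field; lra).
    assert (Y : - (Re (h c) * 1) <= - (Re (h z) * ((r - s) / (r + s)))).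
    { apply X. intros t Ht. assert (B := Hts t Ht). split.
      - apply (is_derive_opp (K := R_AbsRing) (V := R_NormedModule)).
        apply (is_derive_mult u (fun t => (r - t * s) / (r + t * s))%R); auto.
        apply (is_derive_div (fun t => r - t * s)%R (fun t => r + t * s)%R t (- s)%R s); auto. lra. intros; apply Rmult_comm.
      - specialize (Hdu t Ht). assert (Q := Rle_abs (du t)).
        replace (- (du t * ((r - t * s) / (r + t * s)) + u t * ((- s * (r + t * s) - (r - t * s) * s) / (r + t * s) ^ 2)))%R
         with ((2 * r * s * u t - du t * ((r - t * s) * (r + t * s))) * / ((r + t * s) ^ 2))%R by (field; lra).
        apply Rmult_le_pos. 2: left; apply Rinv_0_lt_compat, pow_lt; lra.
        assert (D : 0 <= (r - t * s) * (r + t * s)) by nra.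
        apply (Rmult_le_compat_r _ _ _ D) in Q. lra. }
    apply Ropp_le_cancel in Y. apply (Rmult_le_compat_r (r + s)) in Y; [|lra].
    replace (Re (h z) * ((r - s) / (r + s)) * (r + s))%R with (Re (h z) * (r - s))%R in Y by (field; lra). lra.
Qed.

(** * Bounds from the spherical derivative *)

(** What remains of the hypotheses after replacing [f] by [f / b - 1]. The class is stable under
    [G |-> m * G (a + z / m)] with [m > 0]. *)
Definition exceptional (G : C -> C) : Prop :=
  (forall z, exists l, cder G z l) /\ (forall z, G z = 0 -> C_derive G z = 0) /\
  (forall z, C_derive G z <> 1).

(** The second clause says that rescaling about the origin has been stopped at the right moment, the
    first that no point within distance [rad] would have asked for more than twice as much. The
    first clause also bounds the spherical derivative [|G'| / (1 + |G|^2)] by 4. *)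
Definition normalised_on (G : C -> C) (rad : R) : Prop :=
  (forall z, Cmod z < rad -> Cmod (C_derive G z) <= 1 + 4 * (Cmod (G z) * Cmod (G z))) /\
  Cmod (C_derive G 0) = (1 + Cmod (G 0) * Cmod (G 0))%R.

Lemma entire_holo f c (r : R) : (forall z, exists l, cder f z l) -> holo f c r.
Proof. intros H z _. apply H. Qed.

Lemma entire_D f z : (forall z, exists l, cder f z l) -> cder f z (C_derive f z).
Proof. intros H. destruct (H z) as [l Hl]. rewrite (cder_unique _ _ _ Hl). exact Hl. Qed.

Lemma real_scalar_product_bound (a b : C) : Rabs (Re a * Re b + Im a * Im b) <= Cmod a * Cmod b.
Proof.
  rewrite <- (Cmod_conj a), <- Cmod_mult.
  replace (Re a * Re b + Im a * Im b)%R with (Re (Cconj a * b)). apply re_le_Cmod.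
  destruct a, b; simpl; ring.
Qed.

(** The square of the chordal distance from [G z] to infinity on the Riemann sphere. *)
Definition chordal_to_infinity (G : C -> C) (z : C) : R := (/ (1 + Cmod (G z) * Cmod (G z)))%R.

(** This is how a bounded spherical derivative is used. The function is smooth even at the zeros
    of [G], and with [g = |G|] its slope is at most [2 g |G'| / (1 + g^2)^2], hence at most
    [2 g (1 + 4 g^2) / (1 + g^2)^2 <= 4]. *)
Lemma chordal_lipschitz G (rad : R) z w : (forall z, exists l, cder G z l) ->
  (forall z, Cmod z < rad -> Cmod (C_derive G z) <= 1 + 4 * (Cmod (G z) * Cmod (G z))) ->
  Cmod z < rad -> Cmod w < rad -> Rabs (chordal_to_infinity G w - chordal_to_infinity G z) <= 4 * Cmod (w - z).
Proof.
  intros HG HB Hz Hw.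
  set (h := w - z).
  set (a := fun t : R => Re (1 * G (z + t * h))).
  set (b := fun t : R => Re (- Ci * G (z + t * h))).
  set (d := fun t : R => C_derive G (z + t * h) * h).
  assert (Ha : forall t : R, is_derive a t (Re (d t))).
  { intros t. replace (Re (d t)) with (Re (1 * (C_derive G (z + t * h) * h))).
    apply cder_Re_line, entire_D, HG. unfold d. f_equal. ring. }
  assert (Hb : forall t : R, is_derive b t (Im (d t))).
  { intros t. replace (Im (d t)) with (Re (- Ci * (C_derive G (z + t * h) * h))).
    apply cder_Re_line, entire_D, HG. fold (d t). destruct (d t). simpl. ring. }
  assert (HRe : forall t, a t = Re (G (z + t * h))). { intros t. unfold a. f_equal. ring. }
  assert (HIm : forall t, b t = Im (G (z + t * h))). { intros t. unfold b. destruct (G (z + t * h)). simpl. ring. }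
  assert (HN : forall t, (1 + a t * a t + b t * b t)%R = (1 + Cmod (G (z + t * h)%C) * Cmod (G (z + t * h)%C))%R).
  { intros t. rewrite Cmod_sqr, HRe, HIm. ring. }
  assert (Hpos : forall t, 0 < 1 + a t * a t + b t * b t).
  { intros t. assert (0 <= a t * a t) by nra. assert (0 <= b t * b t) by nra. lra. }
  set (k := fun t : R => (/ (1 + a t * a t + b t * b t))%R).
  assert (Hk : forall t, is_derive k t (- (2 * (a t * Re (d t) + b t * Im (d t))) / (1 + a t * a t + b t * b t) ^ 2)%R).
  { intros t. unfold k.
    assert (X : is_derive (fun t => 1 + a t * a t + b t * b t)%R t (2 * (a t * Re (d t) + b t * Im (d t)))%R).
    { assert (Da : ex_derive a t) by (exists (Re (d t)); apply Ha).
      assert (Db : ex_derive b t) by (exists (Im (d t)); apply Hb).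
      auto_derive. repeat apply conj; first [exact Da | exact Db | exact I].
      replace (Derive (fun x : R => a x) t) with (Re (d t)) by (symmetry; apply is_derive_unique, Ha).
      replace (Derive (fun x : R => b x) t) with (Im (d t)) by (symmetry; apply is_derive_unique, Hb). ring. }
    apply (is_derive_inv (fun t => 1 + a t * a t + b t * b t)%R). exact X. specialize (Hpos t). lra. }
  assert (Hin : forall t, 0 <= t <= 1 -> Cmod (z + t * h) < rad).
  { intros t Ht. replace (z + t * h) with (RtoC (1 - t) * z + RtoC t * w) by (rewrite RtoC_minus; unfold h; ring).
    eapply Rle_lt_trans. apply Cmod_triangle. rewrite !Cmod_mult, !Cmod_R, !Rabs_pos_eq by lra.
    destruct (Req_dec t 0) as [->|N]. lra. nra. }
  assert (E0 : k 0%R = chordal_to_infinity G z). { unfold k, chordal_to_infinity. rewrite HN. replace (z + 0%R * h) with z by ring. reflexivity. }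
  assert (E1 : k 1%R = chordal_to_infinity G w). { unfold k, chordal_to_infinity. rewrite HN. replace (z + 1%R * h) with w by (unfold h; ring). reflexivity. }
  destruct (MVT_gen k 0 1 (fun t => (- (2 * (a t * Re (d t) + b t * Im (d t))) / (1 + a t * a t + b t * b t) ^ 2)%R)) as [t [Ht E]].
  - intros x Hx. apply Hk.
  - intros x Hx. apply continuity_pt_filterlim, (ex_derive_continuous (K := R_AbsRing) (V := R_NormedModule)).
    eexists. apply Hk.
  - rewrite Rmin_left, Rmax_right in Ht by lra.
    rewrite <- E0, <- E1, E, Rminus_0_r, Rmult_1_r. fold h.
    assert (P := Hpos t). rewrite Rabs_div by (apply pow_nonzero; lra).
    rewrite Rabs_Ropp, Rabs_mult, (Rabs_pos_eq 2), (Rabs_pos_eq (_ ^ 2)) by (try apply pow2_ge_0; lra).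
    apply Rmult_le_reg_r with ((1 + a t * a t + b t * b t) ^ 2)%R. apply pow_lt; auto.
    unfold Rdiv. rewrite Rmult_assoc, Rinv_l, Rmult_1_r by (apply pow_nonzero; lra).
    rewrite HRe, HIm.
    assert (CS := real_scalar_product_bound (G (z + t * h)) (d t)).
    rewrite <- HRe, <- HIm, HN, HRe, HIm.
    unfold d in CS at 3. rewrite Cmod_mult in CS.
    specialize (HB _ (Hin t Ht)).
    set (g := Cmod (G (z + t * h))) in *. assert (Hg : 0 <= g) by apply Cmod_ge_0.
    assert (Hh := Cmod_ge_0 h).
    assert (Q1 : Cmod (C_derive G (z + t * h)) * Cmod h <= (1 + 4 * (g * g)) * Cmod h) by (apply Rmult_le_compat_r; auto).
    apply (Rmult_le_compat_l g) in Q1; auto.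
    apply Rle_trans with (2 * (g * ((1 + 4 * (g * g)) * Cmod h)))%R. lra.
    replace (2 * (g * ((1 + 4 * (g * g)) * Cmod h)))%R with ((2 * g * (1 + 4 * (g * g))) * Cmod h)%R by ring.
    replace (4 * Cmod h * (1 + g * g) ^ 2)%R with ((4 * (1 + g * g) ^ 2) * Cmod h)%R by ring.
    apply Rmult_le_compat_r; auto.
    assert (X := Rle_0_sqr (1 - g)). unfold Rsqr in X.
    assert (Y := Rle_0_sqr g). unfold Rsqr in Y.
    apply Rle_trans with ((1 + g * g) * (1 + 4 * (g * g)))%R.
    apply Rmult_le_compat_r; lra.
    clear - Y. set (q := (g * g)%R) in *. nra.
Qed.

Lemma exp_ge_1_plus (x : R) : 1 + x <= exp x.
Proof.
  destruct (Req_dec x 0) as [->|N]. rewrite exp_0; lra. left; apply exp_ineq1; auto.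
Qed.

(** If [|G 0|] is large then [|G| > 1] on a disc of fixed radius, where [G] has a logarithm with
    positive real part. So [|G'(0)| / |G 0|] is at most a constant times [ln |G 0|]; but
    [|G'(0)|] exceeds [|G 0|^2]. *)
Lemma centre_bound G (rad : R) : 1 <= rad -> exceptional G -> normalised_on G rad -> Cmod (G 0) <= 6400.
Proof.
  intros HR [HG _] [HB H0]. apply Rnot_lt_le. intros HL.
  set (B := Cmod (G 0)) in *.
  assert (H1 : forall z, Cmod (z - 0) < / 20 -> 1 < Cmod (G z)).
  { intros z Hz. assert (Ez : z - 0 = z) by ring.
    assert (X := chordal_lipschitz G rad 0 z HG HB). rewrite Cmod_0 in X.
    rewrite Ez in *. specialize (X ltac:(lra) ltac:(lra)).
    apply Rabs_le_between in X.
    assert (Y : chordal_to_infinity G 0 <= / 10). { unfold chordal_to_infinity. fold B. apply Rinv_le_contravar. lra. nra. }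
    assert (K : chordal_to_infinity G z < / 2) by lra.
    apply Rnot_le_lt. intros L. assert (Hg := Cmod_ge_0 (G z)).
    assert (/ 2 <= chordal_to_infinity G z). { unfold chordal_to_infinity. apply Rinv_le_contravar. nra. nra. }
    lra. }
  destruct (holo_log G 0 (/ 20)) as [h [Hh [He Hd]]]. lra. apply entire_holo, HG.
  { intros z Hz. apply Cmod_gt_0. specialize (H1 z Hz). lra. }
  assert (Hc : Cmod (0 - 0) < / 20) by (rewrite Cmod_self; lra).
  assert (X := pos_re_derivative h 0 (/ 20) ltac:(lra) Hh).
  rewrite Hd, Cmod_div, H0 in X; auto. fold B in X.
  2:{ apply Cmod_gt_0. fold B. lra. }
  assert (Y : (1 + B * B) / B * / 20 <= 2 * Re (h 0)).
  { apply X. intros z Hz. specialize (H1 z Hz). rewrite <- He, Cmod_cexp in H1 by auto.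
    apply Rnot_le_lt. intros L. assert (exp (Re (h z)) <= exp 0).
    destruct L as [L|L]. left; apply exp_increasing, L. right; f_equal; exact L.
    rewrite exp_0 in H. lra. }
  assert (EB : B = exp (Re (h 0))). { unfold B. rewrite <- He, Cmod_cexp; auto. }
  (* With [B = s * s] one has [ln B <= 2 (s - 1)], so the logarithmic bound becomes [B <= 80 s]. *)
  set (s := exp (Re (h 0) / 2)).
  assert (Es : B = (s * s)%R). { rewrite EB. unfold s. rewrite <- exp_plus. f_equal. lra. }
  assert (Hs := exp_pos (Re (h 0) / 2)). fold s in Hs.
  assert (Hs2 := exp_ge_1_plus (Re (h 0) / 2)). fold s in Hs2.
  assert (Z : B <= (1 + B * B) / B).
  { apply Rmult_le_reg_r with B. lra. unfold Rdiv. rewrite Rmult_assoc, Rinv_l; lra. }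
  assert (B <= 80 * s) by lra. nra.
Qed.

Lemma ln_le_minus_1 (x : R) : 0 < x -> ln x <= x - 1.
Proof. intros H. assert (X := exp_ge_1_plus (ln x)). rewrite exp_ln in X by auto. lra. Qed.

(** The argument of Clunie and Hayman. Suppose [|G z0| > A], and let [r] be the radius of
    the largest disc about [z0] on which [|G| > A]; it does not reach beyond the origin. There
    [u = ln (|G| / A)] is positive, and by Harnack's inequality it is at least [u(z0) eta / (2 r)]
    at distance [eta] from the boundary. But near a boundary point where [|G| = A] it is at most a
    constant times [eta], since the chordal distance is Lipschitz. So [u(z0) <= K r <= K |z0|]. *)
Lemma exponential_growth (A : R) : 1 <= A -> exists K, 0 < K /\ forall G rad,
  (forall z, exists l, cder G z l) ->
  (forall z, Cmod z < rad -> Cmod (C_derive G z) <= 1 + 4 * (Cmod (G z) * Cmod (G z))) ->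
  Cmod (G 0) <= A -> forall z, Cmod z < rad / 2 -> Cmod (G z) <= A * exp (K * Cmod z).
Proof.
  intros HA. set (K := (16 * (1 + A * A) * (1 + A * A) / (A * A))%R).
  assert (HK : 0 < K). { unfold K. apply Rdiv_lt_0_compat; nra. }
  exists K. split; [exact HK|]. intros G rad HG HB H0 z0 Hz0.
  apply Rnot_lt_le. intros HL.
  assert (Hz00 := Cmod_ge_0 z0).
  assert (HexpK : 1 <= exp (K * Cmod z0)).
  { assert (X := exp_ge_1_plus (K * Cmod z0)). assert (0 <= K * Cmod z0) by (apply Rmult_le_pos; lra). lra. }
  assert (HzA : A < Cmod (G z0)) by nra.
  set (Q := fun rho : R => forall w, Cmod (w - z0) < rho -> A < Cmod (G w)).
  assert (Hbnd : forall rho, Q rho -> rho <= Cmod z0).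
  { intros rho Hrho. apply Rnot_lt_le. intros L.
    assert (X := Hrho 0). rewrite Cmod_minus_sym in X. replace (z0 - 0) with z0 in X by ring.
    specialize (X L). lra. }
  destruct (completeness Q) as [r [Hr1 Hr2]].
  { exists (Cmod z0). exact Hbnd. }
  { exists 0%R. intros w Hw. assert (X := Cmod_ge_0 (w - z0)). lra. }
  assert (Hcont : ccont G z0). { destruct (HG z0) as [l Hl]. eapply cder_ccont, Hl. }
  assert (Hr0 : 0 < r).
  { destruct (Hcont (Cmod (G z0) - A)%R ltac:(lra)) as [d [Hd Hf]].
    apply Rlt_le_trans with d; auto. apply Hr1. intros w Hw. specialize (Hf w Hw).
    assert (T := Cmod_triangle_rev (G z0) (G w)). rewrite Cmod_minus_sym in T. lra. }
  assert (Hrz : r <= Cmod z0) by (apply Hr2; exact Hbnd).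
  assert (HQr : Q r).
  { intros w Hw. apply NNPP. intros N.
    assert (X : r <= Cmod (w - z0)).
    { apply Hr2. intros rho Hrho. apply Rnot_lt_le. intros L. apply N, Hrho, L. }
    lra. }
  destruct (holo_log G z0 r) as [h [Hh [He _]]]; auto. apply entire_holo, HG.
  { intros z Hz. apply Cmod_gt_0. specialize (HQr z Hz). lra. }
  set (v := fun z => h z - RtoC (ln A)).
  assert (Hv : holo v z0 r).
  { intros z Hz. destruct (Hh z Hz) as [l Hl]. eexists. apply cder_minus. exact Hl. apply cder_const. }
  assert (Hev : forall z, Cmod (z - z0) < r -> Cmod (G z) = (A * exp (Re (v z)))%R).
  { intros z Hz. rewrite <- He, Cmod_cexp by auto. unfold v.
    change (Re (h z - RtoC (ln A))) with (Re (h z) - ln A)%R. unfold Rminus.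
    rewrite exp_plus, exp_Ropp, exp_ln by lra. field. lra. }
  assert (Hvpos : forall z, Cmod (z - z0) < r -> 0 < Re (v z)).
  { intros z Hz. specialize (HQr z Hz). rewrite Hev in HQr by auto.
    apply exp_lt_inv. rewrite exp_0. apply Rmult_lt_reg_l with A; lra. }
  assert (Hc0 : Cmod (z0 - z0) < r) by (rewrite Cmod_self; auto).
  set (u0 := Re (v z0)). assert (Hu0 : 0 < u0) by (apply Hvpos; auto).
  assert (Hu0K : K * Cmod z0 < u0).
  { rewrite (Hev z0 Hc0) in HL. fold u0 in HL. apply exp_lt_inv. apply Rmult_lt_reg_l with A; lra. }
  (* With [eta <= r / u0] the lower bound [x] for [2 u] at distance [eta] from the boundary stays
     below 1, so that [1 + A^2 (1 + x)] stays below [2 (1 + A^2)]; the last term keeps the point [w]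
     in the disc of radius [rad]. *)
  set (eta := Rmin (r / 2) (Rmin (r / u0) (rad - 2 * Cmod z0))).
  assert (Heta : 0 < eta). { unfold eta. repeat apply Rmin_pos. lra. apply Rdiv_lt_0_compat; auto. lra. }
  assert (Heta1 : eta <= r / 2) by apply Rmin_l.
  assert (Heta2 : eta <= r / u0). { unfold eta. eapply Rle_trans. apply Rmin_r. apply Rmin_l. }
  assert (Heta3 : eta <= rad - 2 * Cmod z0). { unfold eta. eapply Rle_trans. apply Rmin_r. apply Rmin_r. }
  assert (Hw : exists w, Cmod (w - z0) < r + eta /\ Cmod (G w) <= A).
  { apply NNPP. intros N. assert (X : Q (r + eta)%R).
    { intros w Hw. apply Rnot_le_lt. intros L. apply N. now exists w. }
    apply Hr1 in X. lra. }
  clearbody eta.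
  destruct Hw as [w [Hw1 HwA]].
  assert (Hwr : r <= Cmod (w - z0)).
  { apply Rnot_lt_le. intros L. specialize (HQr w L). lra. }
  set (dw := Cmod (w - z0)) in *.
  (* The point at distance [r - eta] from [z0] on the segment to [w]. *)
  set (z := z0 + RtoC ((r - eta) / dw) * (w - z0)).
  assert (Ez : Cmod (z - z0) = (r - eta)%R).
  { unfold z. replace (z0 + RtoC ((r - eta) / dw) * (w - z0) - z0) with (RtoC ((r - eta) / dw) * (w - z0)) by ring.
    rewrite Cmod_mult, Cmod_R. fold dw. rewrite Rabs_pos_eq. field. lra.
    left. apply Rdiv_lt_0_compat; lra. }
  assert (Ezw : Cmod (z - w) <= 2 * eta).
  { unfold z. replace (z0 + RtoC ((r - eta) / dw) * (w - z0) - w) with (RtoC ((r - eta) / dw - 1) * (w - z0)) by (rewrite RtoC_minus; ring).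
    rewrite Cmod_mult, Cmod_R. fold dw. rewrite Rabs_left1.
    replace (- ((r - eta) / dw - 1) * dw)%R with (dw - (r - eta))%R by (field; lra). lra.
    apply Rmult_le_reg_r with dw. lra. replace (((r - eta) / dw - 1) * dw)%R with ((r - eta) - dw)%R by (field; lra). lra. }
  assert (Hzr : Cmod (z - z0) < r) by lra.
  assert (HzR : Cmod z < rad). { replace z with ((z - z0) + z0) by ring. eapply Rle_lt_trans. apply Cmod_triangle. lra. }
  assert (HwR : Cmod w < rad). { replace w with ((w - z0) + z0) by ring. eapply Rle_lt_trans. apply Cmod_triangle. fold dw. lra. }
  assert (Har := proj1 (harnack v z0 r z Hr0 Hv Hvpos Hzr)). rewrite Ez in Har. fold u0 in Har.
  assert (Lip := chordal_lipschitz G rad z w HG HB HzR HwR). rewrite Cmod_minus_sym in Lip.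
  assert (Lip2 : chordal_to_infinity G w - chordal_to_infinity G z <= 8 * eta). { apply Rabs_le_between in Lip. lra. }
  set (x := (u0 * eta / r)%R).
  assert (Hx0 : 0 < x). { unfold x. apply Rdiv_lt_0_compat; nra. }
  assert (Hx1 : x <= 1).
  { unfold x. apply Rmult_le_reg_r with r; auto. unfold Rdiv. rewrite Rmult_assoc, Rinv_l by lra.
    apply (Rmult_le_compat_r u0) in Heta2; [|lra]. unfold Rdiv in Heta2. rewrite Rmult_assoc, Rinv_l in Heta2 by lra. lra. }
  assert (Hux : x <= 2 * Re (v z)).
  { unfold x. apply Rmult_le_reg_r with r; auto. unfold Rdiv. rewrite Rmult_assoc, Rinv_l by lra.
    assert (V := Hvpos z Hzr). nra. }
  assert (K1 : / (1 + A * A) <= chordal_to_infinity G w).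
  { unfold chordal_to_infinity. assert (X := Cmod_ge_0 (G w)). apply Rinv_le_contravar; nra. }
  assert (K2 : chordal_to_infinity G z <= / (1 + A * A * (1 + x))).
  { unfold chordal_to_infinity. rewrite (Hev z Hzr). apply Rinv_le_contravar. nra.
    replace (A * exp (Re (v z)) * (A * exp (Re (v z))))%R with (A * A * (exp (Re (v z)) * exp (Re (v z))))%R by ring.
    rewrite <- exp_plus. assert (X := exp_ge_1_plus (Re (v z) + Re (v z))).
    apply Rplus_le_compat_l, Rmult_le_compat_l. nra. lra. }
  assert (D : (/ (1 + A * A) - / (1 + A * A * (1 + x)))%R = (A * A * x / ((1 + A * A) * (1 + A * A * (1 + x))))%R).
  { field. split; nra. }
  assert (D2 : A * A * x / (2 * (1 + A * A) * (1 + A * A)) <= A * A * x / ((1 + A * A) * (1 + A * A * (1 + x)))).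
  { apply Rmult_le_compat_l. nra. apply Rinv_le_contravar. nra.
    assert (1 + A * A * (1 + x) <= 2 * (1 + A * A)) by nra. nra. }
  assert (F : A * A * x / (2 * (1 + A * A) * (1 + A * A)) <= 8 * eta) by lra.
  assert (F2 : x <= K * eta).
  { unfold K. apply Rmult_le_reg_r with (A * A / (2 * (1 + A * A) * (1 + A * A)))%R.
    apply Rdiv_lt_0_compat; nra.
    replace (16 * (1 + A * A) * (1 + A * A) / (A * A) * eta * (A * A / (2 * (1 + A * A) * (1 + A * A))))%R
      with (8 * eta)%R by (field; split; nra).
    replace (x * (A * A / (2 * (1 + A * A) * (1 + A * A))))%R with (A * A * x / (2 * (1 + A * A) * (1 + A * A)))%R by (field; nra).
    exact F. }
  assert (F3 : u0 <= K * r).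
  { unfold x in F2. apply Rmult_le_reg_r with (eta / r)%R. apply Rdiv_lt_0_compat; auto.
    replace (K * r * (eta / r))%R with (K * eta)%R by (field; lra).
    replace (u0 * (eta / r))%R with (u0 * eta / r)%R by (field; lra). exact F2. }
  assert (K * r <= K * Cmod z0) by (apply Rmult_le_compat_l; lra). lra.
Qed.

(** * The derivative of a normalised function on a large disc *)

Lemma exp_monotone (x y : R) : x <= y -> exp x <= exp y.
Proof. intros [H|H]. left; apply exp_increasing, H. right; f_equal; exact H. Qed.

Lemma exp_le_inv (x y : R) : exp x <= exp y -> x <= y.
Proof. intros H. apply Rnot_lt_le. intros L. apply exp_increasing in L. lra. Qed.

Lemma derivative_growth : exists Cst, 1 <= Cst /\ forall G rad, 1 <= rad ->
  exceptional G -> normalised_on G rad ->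
  forall z, Cmod z < rad / 2 -> Cmod (C_derive G z - 1) <= exp (Cst * (1 + Cmod z)).
Proof.
  destruct (exponential_growth 6400) as [K [HK HG]]. lra.
  set (A := 6400%R) in *.
  exists (2 + 4 * (A * A) + 2 * K)%R. split. unfold A; lra.
  intros G rad Hrad HE HN z Hz.
  assert (Hc := centre_bound G rad Hrad HE HN). fold A in Hc.
  destruct HE as [Hd _]. destruct HN as [HB _].
  assert (Hz0 := Cmod_ge_0 z).
  specialize (HG G rad Hd HB Hc z Hz). specialize (HB z ltac:(lra)).
  assert (Hg := Cmod_ge_0 (G z)). assert (He := exp_pos (K * Cmod z)).
  set (g := Cmod (G z)) in *. set (e := exp (K * Cmod z)) in *.
  assert (He1 : 1 <= e). { unfold e. assert (X := exp_ge_1_plus (K * Cmod z)). assert (0 <= K * Cmod z) by (apply Rmult_le_pos; lra). lra. }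
  assert (Hgg : g * g <= (A * A) * (e * e)).
  { replace (A * A * (e * e))%R with ((A * e) * (A * e))%R by ring. apply Rmult_le_compat; auto. }
  assert (Hee : 1 <= e * e) by nra.
  assert (T := Cmod_triangle_minus (C_derive G z) 1). rewrite Cmod_1 in T.
  apply Rle_trans with ((2 + 4 * (A * A)) * (e * e))%R.
  { assert (0 <= A * A) by (unfold A; lra). nra. }
  assert (E2 : (e * e)%R = exp (2 * K * Cmod z)). { unfold e. rewrite <- exp_plus. f_equal. ring. }
  rewrite E2. set (B := (2 + 4 * (A * A))%R).
  assert (HBp : 2 <= B) by (unfold B, A; lra).
  apply Rle_trans with (exp B * exp (2 * K * Cmod z))%R.
  { apply Rmult_le_compat_r. left; apply exp_pos. assert (X := exp_ge_1_plus B). lra. }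
  rewrite <- exp_plus. apply exp_monotone. nra.
Qed.

(** Otherwise [G] is close to [z + G 0] on the disc of radius [1/2]; as [|G'(0)|] is close to 1, the
    normalisation makes [G 0] small, and [G] has a zero in that disc. There [G' = 0], which is far
    from 1. *)
Lemma derivative_not_near_1 G (rad : R) : 1 <= rad -> exceptional G -> normalised_on G rad ->
  exists z, Cmod z <= / 2 /\ / 100 < Cmod (C_derive G z - 1).
Proof.
  intros Hrad [Hd [H0 _]] [_ HN]. apply NNPP. intros N.
  assert (Hs : forall z, Cmod z <= / 2 -> Cmod (C_derive G z - 1) <= / 100).
  { intros z Hz. apply Rnot_lt_le. intros L. apply N. now exists z. }
  assert (X0 := Hs 0 ltac:(rewrite Cmod_0; lra)).
  assert (T := Cmod_triangle_rev (C_derive G 0) 1). rewrite Cmod_1, HN in T.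
  assert (HG0 : Cmod (G 0) <= / 10).
  { assert (X := Cmod_ge_0 (G 0)). apply Rnot_lt_le. intros L. nra. }
  assert (Happ : forall z, Cmod z <= / 2 -> Cmod (G z - z - G 0) <= / 100 * Cmod z).
  { intros z Hz. assert (X := segment_bound (fun w => G w - w) (fun w => C_derive G w - 1) 0 z (/ 100)).
    cbv beta in X. replace (0 + z) with z in X by ring. replace (G 0 - 0) with (G 0) in X by ring.
    apply X. intros t Ht. split. apply cder_minus. apply entire_D, Hd. apply cder_id.
    apply Hs. replace (0 + t * z) with (RtoC t * z) by ring.
    rewrite Cmod_mult, Cmod_R, Rabs_pos_eq by lra. assert (Y := Cmod_ge_0 z). nra. }
  destruct (zero_in_disc G 0 (/ 2) (/ 4)) as [z [Hz Ez]]. lra. intros; apply Hd. lra.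
  { intros z Hz. replace (z - 0) with z in Hz by ring.
    specialize (Happ z ltac:(lra)).
    assert (T1 := Cmod_triangle_rev z (- (G z - z - G 0))).
    replace (z - - (G z - z - G 0)) with (G z - G 0) in T1 by ring. rewrite Cmod_opp in T1.
    assert (T2 := Cmod_triangle_minus (G z) (G 0)). lra. }
  replace (z - 0) with z in Hz by ring.
  specialize (Hs z Hz). rewrite (H0 z Ez) in Hs.
  replace (0 - 1) with (- (1)) in Hs by ring. rewrite Cmod_opp, Cmod_1 in Hs. lra.
Qed.

(** As [G' - 1] has no zero, it is [cexp g] on a large disc, where [Re g] grows at most linearly by
    [derivative_growth] and is not too negative at the centre by [derivative_not_near_1]. For
    [v = M - g] with [M] a bound of [Re g], of order [rho], the estimates for positive real parts
    give a bound for [g'] that does not depend on [rho]. The Cauchy estimate then makes [g''] of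
    order [1 / rho], so [g] is nearly affine. *)
Lemma linearisation : exists Cst, 1 <= Cst /\ forall G rho, 1 <= rho ->
  exceptional G -> normalised_on G (16 * rho) ->
  exists E c gam, exp (- Cst) <= Cmod E <= exp Cst /\ Cmod c <= Cst /\
    forall z, Cmod z < rho -> C_derive G z = 1 + E * cexp (gam z) /\
      Cmod (gam z - c * z) <= Cst * (Cmod z * Cmod z) / rho.
Proof.
  destruct derivative_growth as [K [HK HG]].
  set (M1 := (3 * K + 1)%R). set (C2 := (4 * M1 + 400)%R).
  set (C3 := (6 * (5 * K + 1 + C2))%R).
  assert (HC2 : 0 < C2) by (unfold C2, M1; lra).
  exists (C2 + C3)%R. split. unfold C3; lra.
  intros G rho Hrho HE HN. assert (Hrad : 1 <= 16 * rho) by lra.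
  specialize (HG G _ Hrad HE HN).
  destruct HE as [Hd [H0 H1]].
  assert (S0 : forall w, w - 0 = w) by (intros; ring).
  destruct (holo_log (fun z => C_derive G z - 1) 0 (8 * rho)) as [g [Hg [Heg _]]]. lra.
  { intros z Hz. destruct (holo_derive G 0 (8 * rho) (entire_holo _ _ _ Hd) z Hz) as [l Hl].
    eexists. apply cder_minus. exact Hl. apply cder_const. }
  { intros z Hz E. apply (H1 z). replace (C_derive G z) with ((C_derive G z - 1) + 1) by ring. rewrite E; ring. }
  assert (Hre : forall z, Cmod z < 8 * rho -> Re (g z) <= K * (1 + Cmod z)).
  { intros z Hz. apply exp_le_inv. rewrite <- Cmod_cexp, Heg by (rewrite S0; auto). apply HG. lra. }
  assert (Hg0 : - C2 <= Re (g 0)).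
  { apply Rnot_lt_le. intros L.
    destruct (derivative_not_near_1 G (16 * rho) Hrad (conj Hd (conj H0 H1)) HN) as [z [Hz Hz1]].
    assert (Hz0 := Cmod_ge_0 z).
    set (v := fun w => RtoC M1 - g w).
    assert (Hv : holo v 0 1).
    { intros w Hw. destruct (Hg w) as [l Hl]. lra. eexists. apply cder_minus. apply cder_const. exact Hl. }
    assert (Rv : forall w, Re (v w) = (M1 - Re (g w))%R) by reflexivity.
    destruct (harnack v 0 1 z Rlt_0_1 Hv) as [HA _].
    { intros w Hw. rewrite S0 in Hw. rewrite Rv. specialize (Hre w ltac:(lra)). unfold M1. nra. }
    { rewrite S0. lra. }
    rewrite S0, !Rv in HA.
    assert (P : 0 < M1 - Re (g 0)) by (unfold C2, M1 in *; lra).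
    assert (Q : (M1 - Re (g 0)) * / 2 <= (M1 - Re (g z)) * (1 + Cmod z)).
    { eapply Rle_trans; [|exact HA]. apply Rmult_le_compat_l; lra. }
    (* Harnack transports a very negative value of [Re g] from the centre to [z]. *)
    assert (Hgz : Re (g z) <= - (100)).
    { apply Rnot_lt_le. intros L2. assert ((M1 - Re (g z)) * (1 + Cmod z) <= (M1 + 100) * 2).
      apply Rmult_le_compat; try lra. specialize (Hre z ltac:(lra)). unfold M1. nra.
      unfold C2 in L. unfold M1 in *. lra. }
    rewrite <- Heg, Cmod_cexp in Hz1 by (rewrite S0; lra).
    assert (X := exp_monotone _ _ Hgz). rewrite exp_Ropp in X.
    assert (Y := exp_ge_1_plus 100). assert (/ exp 100 <= / 101) by (apply Rinv_le_contravar; lra). lra. }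
  set (M := (K * (1 + 4 * rho) + 1)%R).
  set (v := fun w => RtoC M - g w).
  assert (Hv : holo v 0 (4 * rho)).
  { intros w Hw. destruct (Hg w) as [l Hl]. lra. eexists. apply cder_minus. apply cder_const. exact Hl. }
  assert (Rv : forall w, Re (v w) = (M - Re (g w))%R) by reflexivity.
  assert (Hvpos : forall w, Cmod (w - 0) < 4 * rho -> 0 < Re (v w)).
  { intros w Hw. rewrite S0 in Hw. rewrite Rv. specialize (Hre w ltac:(lra)). unfold M. nra. }
  assert (Hv0 : Re (v 0) <= rho * (5 * K + 1 + C2)). { rewrite Rv. unfold M. nra. }
  assert (Hc0 : Cmod (0 - 0) < 4 * rho) by (rewrite S0, Cmod_0; lra).
  assert (Hv0p := Hvpos 0 Hc0).
  assert (Hd1 : forall z, Cmod z < 2 * rho -> Cmod (C_derive g z) <= C3 / 2).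
  { intros z Hz. assert (Hz0 := Cmod_ge_0 z).
    destruct (harnack v 0 (4 * rho) z ltac:(lra) Hv Hvpos) as [_ HA]. { rewrite S0; lra. }
    rewrite S0 in HA.
    assert (Hvz := Hvpos z ltac:(rewrite S0; lra)).
    assert (A1 : Re (v z) <= 3 * Re (v 0)).
    { assert (Re (v z) * (2 * rho) <= Re (v 0) * (6 * rho)).
      { eapply Rle_trans; [|eapply Rle_trans; [exact HA|]]. apply Rmult_le_compat_l; lra. apply Rmult_le_compat_l; lra. }
      nra. }
    assert (X := pos_re_derivative v z (2 * rho) ltac:(lra)).
    assert (Dv : C_derive v z = - C_derive g z).
    { apply cder_unique. eapply cder_eq. apply cder_minus. apply cder_const. apply (holo_D g 0 (8 * rho)); auto. rewrite S0; lra. ring. }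
    rewrite Dv, Cmod_opp in X.
    assert (Y : Cmod (C_derive g z) * (2 * rho) <= 2 * Re (v z)).
    { apply X. apply (holo_sub v 0 (4 * rho)); auto. rewrite S0; lra.
      intros w Hw. apply Hvpos. assert (T := Cmod_triangle3 w z 0). rewrite (S0 z) in T. lra. }
    apply Rmult_le_reg_r with (2 * rho)%R. lra.
    eapply Rle_trans; [exact Y|]. unfold C3. nra. }
  assert (HC3 : 0 < C3) by (unfold C3; lra).
  assert (Hd2 : forall z, Cmod z < rho -> Cmod (C_derive (C_derive g) z) <= C3 / rho).
  { intros z Hz. apply Rmult_le_reg_r with rho. lra.
    replace (C3 / rho * rho)%R with (2 * (C3 / 2))%R by (field; lra).
    apply cauchy_estimate. lra.
    - apply holo_derive. apply (holo_sub g 0 (8 * rho)); auto. rewrite S0. lra.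
    - intros w Hw. apply Hd1. assert (T := Cmod_triangle3 w z 0). rewrite !S0 in T. lra. }
  assert (HDg : forall z, Cmod z < rho -> cder g z (C_derive g z)).
  { intros z Hz. apply (holo_D g 0 (8 * rho)); auto. rewrite S0; lra. }
  assert (HDDg : forall z, Cmod z < rho -> cder (C_derive g) z (C_derive (C_derive g) z)).
  { intros z Hz. apply (holo_D (C_derive g) 0 (8 * rho)). apply holo_derive, Hg. rewrite S0; lra. }
  assert (Hseg : forall (t : R) z, 0 <= t <= 1 -> Cmod (0 + t * z) <= Cmod z).
  { intros t z Ht. replace (0 + t * z) with (RtoC t * z) by ring. rewrite Cmod_mult, Cmod_R, Rabs_pos_eq by lra.
    assert (Y := Cmod_ge_0 z). nra. }
  assert (Hl1 : forall z, Cmod z < rho -> Cmod (C_derive g z - C_derive g 0) <= C3 / rho * Cmod z).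
  { intros z Hz. assert (X := segment_bound (C_derive g) (C_derive (C_derive g)) 0 z (C3 / rho)).
    replace (0 + z) with z in X by ring. apply X. intros t Ht. specialize (Hseg t z Ht).
    split. apply HDDg; lra. apply Hd2; lra. }
  exists (cexp (g 0)), (C_derive g 0), (fun z => g z - g 0).
  split; [|split].
  - rewrite Cmod_cexp. split; apply exp_monotone. lra.
    specialize (Hre 0 ltac:(rewrite Cmod_0; lra)). rewrite Cmod_0 in Hre. unfold C2, M1. lra.
  - assert (X := Hd1 0 ltac:(rewrite Cmod_0; lra)). lra.
  - intros z Hz. assert (Hz0 := Cmod_ge_0 z). split.
    + rewrite <- cexp_plus. replace (g 0 + (g z - g 0)) with (g z) by ring.
      rewrite Heg by (rewrite S0; lra). ring.
    + assert (X := segment_bound (fun w => g w - C_derive g 0 * w) (fun w => C_derive g w - C_derive g 0) 0 z (C3 / rho * Cmod z)).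
      cbv beta in X. replace (0 + z) with z in X by ring.
      replace (g z - C_derive g 0 * z - (g 0 - C_derive g 0 * 0)) with (g z - g 0 - C_derive g 0 * z) in X by ring.
      apply Rle_trans with (C3 / rho * Cmod z * Cmod z)%R.
      * apply X. intros t Ht. specialize (Hseg t z Ht). split.
        eapply cder_eq. apply cder_minus. apply HDg; lra. apply cder_scal, cder_id. ring.
        eapply Rle_trans. apply Hl1; lra. apply Rmult_le_compat_l; auto.
        left. apply Rdiv_lt_0_compat; lra.
      * unfold Rdiv. assert (I : 0 < / rho) by (apply Rinv_0_lt_compat; lra).
        replace (C3 * / rho * Cmod z * Cmod z)%R with (C3 * (Cmod z * Cmod z) * / rho)%R by ring.
        apply Rmult_le_compat_r; [lra|]. apply Rmult_le_compat_r; nra.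
Qed.

(** * Normalised functions live on small discs only *)

Lemma Cmod_segment (t : R) z : 0 <= t <= 1 -> Cmod (0 + t * z) <= Cmod z.
Proof.
  intros Ht. replace (0 + t * z) with (RtoC t * z) by ring. rewrite Cmod_mult, Cmod_R, Rabs_pos_eq by lra.
  assert (Y := Cmod_ge_0 z). nra.
Qed.

Lemma Re_le_Cmod (z : C) : Re z <= Cmod z.
Proof. eapply Rle_trans. apply Rle_abs. apply re_le_Cmod. Qed.

Lemma cexp_near_1 w : Cmod w <= 1 -> Cmod (cexp w - 1) <= 3 * Cmod w.
Proof.
  intros Hw. assert (X := segment_bound cexp cexp 0 w 3).
  replace (0 + w) with w in X by ring. rewrite cexp_0 in X. apply X.
  intros t Ht. split. apply cder_cexp. rewrite Cmod_cexp.
  eapply Rle_trans; [|apply exp_le_3]. apply exp_monotone.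
  assert (A := Re_le_Cmod (0 + t * w)). assert (B := Cmod_segment t w Ht). lra.
Qed.

Lemma cexp_away_from_1 w : Cmod w = (/ 6)%R -> / 12 <= Cmod (cexp w - 1).
Proof.
  intros Hw. assert (X := segment_bound (fun u => cexp u - u) (fun u => cexp u - 1) 0 w (/ 2)).
  cbv beta in X. replace (0 + w) with w in X by ring. rewrite cexp_0 in X.
  replace (cexp w - w - (1 - 0)) with ((cexp w - 1) - w) in X by ring.
  assert (Y : Cmod (cexp w - 1 - w) <= / 2 * Cmod w).
  { apply X. intros t Ht. split. apply cder_minus. apply cder_cexp. apply cder_id.
    assert (B := Cmod_segment t w Ht). eapply Rle_trans. apply cexp_near_1. lra. lra. }
  assert (T := Cmod_triangle_rev w (- (cexp w - 1 - w))).
  replace (w - - (cexp w - 1 - w)) with (cexp w - 1) in T by ring. rewrite Cmod_opp in T. lra.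
Qed.

(** By [linearisation], on any fixed disc [G] is as close as we like to
    [k + z + E (exp (c z) - 1) / c], with bounds on [k], [E], [1 / E] and [c]. If [c] is tiny this is
    almost [k + (1 + E) z], and [|1 + E| = |G'(0)| >= 1], so [G] has a simple zero at bounded
    distance. Otherwise the model function has zeros arbitrarily far out, where [E exp (c z)] is
    about [- c z] and so has large modulus, whereas [G' = 0] would require it to be close to [-1].
    All constants depend only on the bounds, so a contradiction is reached at a fixed radius. *)
Theorem no_normalised_exceptional : exists R0, 0 < R0 /\
  forall G, exceptional G -> normalised_on G R0 -> False.
Proof.
  destruct linearisation as [K [HK Hlin]].
  set (A := 6400%R).
  set (E2 := exp K). assert (HE2 : 2 <= E2). { unfold E2. assert (X := exp_ge_1_plus K). lra. }
  set (S1 := (4 * A + 4)%R). assert (HS1 : 1 <= S1) by (unfold S1, A; lra).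
  (* For [|c| < c0] the exponent [c z] moves [E exp (c z)] by at most [1 / 20] on [|z| <= S1]. *)
  set (c0 := (/ (60 * E2 * S1))%R).
  assert (Hc0 : 0 < c0). { unfold c0. apply Rinv_0_lt_compat. apply Rmult_lt_0_compat; lra. }
  set (K0 := (K * A + E2)%R). assert (HK0 : 0 < K0) by (unfold K0, A; lra).
  set (X := (24 * (K0 + K + 8) + 100)%R). assert (HX : 100 <= X) by (unfold X; lra).
  (* [Y = s^2] is to exceed a multiple of [s] plus a constant, where [2 s] is a bound for [ln Y]. *)
  set (s := (48 + X)%R). set (Y := (s * s)%R).
  assert (Hs : 148 <= s) by (unfold s; lra).
  assert (HY : 24 * (K0 + 2 * s + K + 8) + 100 <= Y). { replace (24 * (K0 + 2 * s + K + 8) + 100)%R with (X + 48 * s)%R by (unfold X; ring).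
    replace Y with (X * s + 48 * s)%R by (unfold Y, s; ring). nra. }
  set (S2 := ((2 * s + K + Y + 8 + 1) / c0)%R).
  assert (HS2 : 0 < S2). { unfold S2. apply Rdiv_lt_0_compat; auto. nra. }
  (* [L / rho] bounds the error of the model function, multiplied by [c], on [|z| <= S2]. *)
  set (L := (K * E2 * exp (K * S2) * 3 * K * S2 * S2 * S2)%R).
  assert (HL : 0 < L). { unfold L. assert (P := exp_pos (K * S2)). clearbody S2. repeat apply Rmult_lt_0_compat; lra. }
  set (rho := (1 + S1 + S2 + 60 * E2 * K * S1 * S1 + K * S2 * S2 + L)%R).
  assert (P1 : 0 < 60 * E2 * K * S1 * S1) by (repeat apply Rmult_lt_0_compat; lra).
  assert (P2 : 0 < K * S2 * S2) by (clearbody S2; repeat apply Rmult_lt_0_compat; lra).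
  assert (Hrho : 1 <= rho) by (unfold rho; lra).
  exists (16 * rho)%R. split. lra.
  intros G HE HN.
  assert (HkA := centre_bound G (16 * rho) ltac:(lra) HE HN). fold A in HkA.
  destruct (Hlin G rho Hrho HE HN) as [E [c [gam [[HE1 HE3] [Hc Hg]]]]]. fold E2 in HE3.
  destruct HE as [Hd [H0 H1]]. destruct HN as [_ HN].
  set (k := G 0) in *.
  assert (Hcg := Cmod_ge_0 c).
  assert (S0 : forall w, w - 0 = w) by (intros; ring).
  destruct (Rlt_dec (Cmod c) c0) as [Hsmall|Hbig].
  - assert (Hslope : 1 <= Cmod (1 + E)).
    { destruct (Hg 0) as [G0 G1]. rewrite Cmod_0; lra.
      rewrite Cmod_0, Rmult_0_l, Rmult_0_r in G1. unfold Rdiv in G1. rewrite Rmult_0_l in G1.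
      replace (gam 0 - c * 0) with (gam 0) in G1 by ring.
      assert (Z : gam 0 = 0) by (apply Cmod_eq_0, Rle_antisym; [exact G1|apply Cmod_ge_0]).
      rewrite Z, cexp_0, Cmult_1_r in G0. rewrite <- G0, HN. assert (W := Cmod_ge_0 k). nra. }
    assert (Happ : forall z, Cmod z <= S1 -> Cmod (C_derive G z - (1 + E)) <= / 10).
    { intros z Hz. destruct (Hg z) as [G0 G1]. unfold rho; lra.
      assert (Hz0 := Cmod_ge_0 z).
      assert (B1 : Cmod c * Cmod z <= / (60 * E2)).
      { apply Rle_trans with (c0 * S1)%R. apply Rmult_le_compat; lra. unfold c0. right. field. lra. }
      assert (B2 : K * (Cmod z * Cmod z) / rho <= / (60 * E2)).
      { apply Rmult_le_reg_r with (60 * E2 * rho)%R. apply Rmult_lt_0_compat; lra.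
        replace (K * (Cmod z * Cmod z) / rho * (60 * E2 * rho))%R with (60 * E2 * K * (Cmod z * Cmod z))%R by (field; lra).
        replace (/ (60 * E2) * (60 * E2 * rho))%R with rho by (field; lra).
        apply Rle_trans with (60 * E2 * K * (S1 * S1))%R; [|unfold rho; lra].
        apply Rmult_le_compat_l. repeat apply Rmult_le_pos; lra. apply Rmult_le_compat; auto. }
      assert (B3 : Cmod (gam z) <= / (30 * E2)).
      { replace (gam z) with ((gam z - c * z) + c * z) by ring. eapply Rle_trans. apply Cmod_triangle.
        rewrite Cmod_mult. replace (/ (30 * E2))%R with (/ (60 * E2) + / (60 * E2))%R by (field; lra). lra. }
      assert (B4 : / (30 * E2) <= 1). { rewrite <- Rinv_1. apply Rinv_le_contravar; lra. }
      rewrite G0. replace (1 + E * cexp (gam z) - (1 + E)) with (E * (cexp (gam z) - 1)) by ring.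
      rewrite Cmod_mult. assert (B5 := cexp_near_1 (gam z) ltac:(lra)).
      apply Rle_trans with (E2 * (3 * / (30 * E2)))%R.
      apply Rmult_le_compat; try apply Cmod_ge_0; lra. right. field. lra. }
    assert (HG : forall z, Cmod z <= S1 -> Cmod (G z - (1 + E) * z - k) <= / 10 * Cmod z).
    { intros z Hz. assert (W := segment_bound (fun w => G w - (1 + E) * w) (fun w => C_derive G w - (1 + E)) 0 z (/ 10)).
      cbv beta in W. replace (0 + z) with z in W by ring. fold k in W.
      replace (k - (1 + E) * 0) with k in W by ring.
      apply W. intros t Ht. split. eapply cder_eq. apply cder_minus. apply entire_D, Hd. apply cder_scal, cder_id. ring.
      apply Happ. assert (B := Cmod_segment t z Ht). lra. }
    destruct (zero_in_disc G 0 S1 (2 * A + 1)) as [z [Hz Ez]]. lra. intros; apply Hd. fold k; unfold A in *; lra.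
    { intros z Hz. rewrite S0 in Hz. specialize (HG z ltac:(lra)).
      assert (T1 := Cmod_triangle_rev ((1 + E) * z) (- (G z - (1 + E) * z - k))).
      replace ((1 + E) * z - - (G z - (1 + E) * z - k)) with (G z - k) in T1 by ring. rewrite Cmod_opp, Cmod_mult in T1.
      assert (T2 := Cmod_triangle_minus (G z) k).
      assert (S1 <= Cmod (1 + E) * Cmod z) by nra. unfold S1, A in *. lra. }
    rewrite S0 in Hz. specialize (Happ z Hz). rewrite (H0 z Ez) in Happ.
    replace (0 - (1 + E)) with (- (1 + E)) in Happ by ring. rewrite Cmod_opp in Happ. lra.
  - assert (Hc1 : c0 <= Cmod c) by lra.
    assert (Nc : c <> 0) by (apply Cmod_gt_0; lra).
    assert (HYp : 0 < Y) by (unfold Y; nra).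
    assert (HEp : 0 < Cmod E) by (assert (W := exp_pos (- K)); lra).
    assert (NE : E <> 0) by (apply Cmod_gt_0; auto).
    (* At [c z = t] the terms [c z] and [E exp (c z)] of the model, about [i Y] and equal to [- i Y],
       cancel up to [ln Y] and a constant. *)
    destruct (cexp_surj_window (- Ci * RtoC Y / E) Y) as [t [Ht1 Ht2]].
    { apply Cmod_gt_0. rewrite Cmod_div, Cmod_mult, Cmod_opp, Cmod_Ci, Cmod_R, Rabs_pos_eq by (auto; lra).
      apply Rdiv_lt_0_compat; lra. }
    assert (HEt : E * cexp t = - Ci * RtoC Y). { rewrite Ht1. field. auto. }
    assert (Hpi := PI_4).
    assert (Hre : Rabs (Re t) <= 2 * s + K).
    { assert (W : exp (Re t) = (Y / Cmod E)%R).
      { rewrite <- Cmod_cexp, Ht1, Cmod_div, Cmod_mult, Cmod_opp, Cmod_Ci, Cmod_R, Rabs_pos_eq by (auto; lra). field; lra. }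
      assert (W2 : Re t = (ln Y - ln (Cmod E))%R).
      { rewrite <- (ln_exp (Re t)), W. apply ln_div; auto. }
      assert (L1 : ln (Cmod E) <= K). { rewrite <- (ln_exp K). apply ln_le; auto. }
      assert (L2 : - K <= ln (Cmod E)). { rewrite <- (ln_exp (- K)). apply ln_le; auto. apply exp_pos. }
      assert (L3 : ln Y = (ln s + ln s)%R). { unfold Y. apply ln_mult; lra. }
      assert (L4 := ln_le_minus_1 s ltac:(lra)).
      assert (L5 : 0 <= ln s). { rewrite <- ln_1. apply ln_le; lra. }
      apply Rabs_le. lra. }
    assert (Him : Rabs (Im t) <= Y + 8) by (apply Rabs_le; lra).
    set (p := t / c).
    assert (Hin : forall z, Cmod (z - p) <= / 6 * / Cmod c -> Cmod (c * z - t) <= / 6 /\ Cmod z <= S2).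
    { intros z Hz.
      assert (B1 : Cmod (c * z - t) <= / 6).
      { replace (c * z - t) with (c * (z - p)) by (unfold p; field; auto). rewrite Cmod_mult.
        apply (Rmult_le_compat_l (Cmod c)) in Hz; auto.
        replace (Cmod c * (/ 6 * / Cmod c))%R with (/ 6)%R in Hz by (field; lra). exact Hz. }
      split; auto.
      assert (B2 : Cmod (c * z) <= 2 * s + K + Y + 8 + 1).
      { replace (c * z) with ((c * z - t) + t) by ring. eapply Rle_trans. apply Cmod_triangle.
        assert (B3 := Cmod_le_Re_Im t). lra. }
      rewrite Cmod_mult in B2. unfold S2. apply Rmult_le_reg_r with c0; auto.
      replace ((2 * s + K + Y + 8 + 1) / c0 * c0)%R with (2 * s + K + Y + 8 + 1)%R by (field; lra).
      assert (Z0 := Cmod_ge_0 z). nra. }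
    assert (Hgz : forall z, Cmod z <= S2 -> Cmod (gam z - c * z) <= K * S2 * S2 / rho /\ Cmod (gam z - c * z) <= 1).
    { intros z Hz. destruct (Hg z) as [_ G1]. unfold rho; lra.
      assert (Z0 := Cmod_ge_0 z).
      assert (B : Cmod (gam z - c * z) <= K * S2 * S2 / rho).
      { eapply Rle_trans; [exact G1|]. unfold Rdiv. apply Rmult_le_compat_r. left; apply Rinv_0_lt_compat; lra.
        rewrite Rmult_assoc. apply Rmult_le_compat_l. lra. apply Rmult_le_compat; auto. }
      split; auto. eapply Rle_trans; [exact B|]. apply Rmult_le_reg_r with rho. lra.
      unfold Rdiv. rewrite Rmult_assoc, Rinv_l by lra. unfold rho. lra. }
    assert (Herr : forall z, Cmod z <= S2 -> Cmod (c * G z - (c * k - E + c * z + E * cexp (c * z))) <= 1).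
    { intros z Hz.
      assert (W := segment_bound (fun w => c * G w - (c * k - E + c * w + E * cexp (c * w)))
        (fun w => c * C_derive G w - (c + E * (cexp (c * w) * c))) 0 z (L / (S2 * rho))).
      cbv beta in W. replace (0 + z) with z in W by ring.
      replace (c * G 0 - (c * k - E + c * 0 + E * cexp (c * 0))) with (RtoC 0) in W.
      2:{ replace (c * 0) with (RtoC 0) by ring. rewrite cexp_0. unfold k. ring. }
      replace (c * G z - (c * k - E + c * z + E * cexp (c * z)) - 0) with (c * G z - (c * k - E + c * z + E * cexp (c * z))) in W by ring.
      apply Rle_trans with (L / (S2 * rho) * Cmod z)%R.
      2:{ apply Rle_trans with (L / (S2 * rho) * S2)%R. apply Rmult_le_compat_l; auto.
          left; apply Rdiv_lt_0_compat; nra.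
          replace (L / (S2 * rho) * S2)%R with (L / rho)%R by (field; lra).
          apply Rmult_le_reg_r with rho. lra. unfold Rdiv. rewrite Rmult_assoc, Rinv_l by lra. unfold rho; lra. }
      apply W. intros u Hu. assert (Hw := Cmod_segment u z Hu). set (w := 0 + u * z) in *. split.
      - apply cder_minus. apply cder_scal, entire_D, Hd.
        eapply cder_eq. apply cder_plus. apply cder_plus. apply cder_const. apply cder_scal, cder_id.
        apply cder_scal. apply (cder_comp cexp (fun w => c * w)). apply cder_cexp. apply cder_scal, cder_id. ring.
      - destruct (Hg w) as [G0 _]. unfold rho; lra. destruct (Hgz w ltac:(lra)) as [Q1 Q2].
        rewrite G0.
        replace (c * (1 + E * cexp (gam w)) - (c + E * (cexp (c * w) * c))) with (c * E * (cexp (c * w) * (cexp (gam w - c * w) - 1))).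
        2:{ replace (cexp (gam w)) with (cexp (c * w) * cexp (gam w - c * w)). ring. rewrite <- cexp_plus. f_equal. ring. }
        rewrite !Cmod_mult. assert (Q3 := cexp_near_1 _ Q2).
        assert (Q4 : Cmod (cexp (c * w)) <= exp (K * S2)).
        { rewrite Cmod_cexp. apply exp_monotone. eapply Rle_trans. apply Re_le_Cmod. rewrite Cmod_mult.
          apply Rmult_le_compat; try apply Cmod_ge_0; lra. }
        replace (L / (S2 * rho))%R with (K * E2 * (exp (K * S2) * (3 * (K * S2 * S2 / rho))))%R.
        2:{ unfold L. field. lra. }
        assert (Q5 := Cmod_ge_0 (cexp (gam w - c * w) - 1)). assert (Q6 := Cmod_ge_0 (cexp (c * w))).
        apply Rmult_le_compat; try apply Rmult_le_pos; try apply Cmod_ge_0.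
        + apply Rmult_le_compat; lra.
        + apply Rmult_le_compat; lra. }
    (* The model in terms of [c z - t]: the first group is small compared with [Y], and the second
       is at least [Y / 12] on the circle [|c z - t| = 1 / 6]. *)
    assert (Hmain : forall z, c * k - E + c * z + E * cexp (c * z) =
       (c * k - E + (t - Ci * RtoC Y) + (c * z - t)) - Ci * RtoC Y * (cexp (c * z - t) - 1)).
    { intros z. replace (cexp (c * z)) with (cexp t * cexp (c * z - t)) by (rewrite <- cexp_plus; f_equal; ring).
      rewrite Cmult_assoc, HEt. ring. }
    assert (Hconst : Cmod (c * k - E + (t - Ci * RtoC Y)) <= K0 + 2 * s + K + 8).
    { eapply Rle_trans. apply Cmod_triangle.
      assert (T1 := Cmod_triangle_minus (c * k) E). rewrite Cmod_mult in T1.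
      assert (T2 : Cmod c * Cmod k <= K * A) by (apply Rmult_le_compat; auto using Cmod_ge_0).
      assert (T3 := Cmod_le_Re_Im (t - Ci * RtoC Y)).
      replace (Re (t - Ci * RtoC Y)) with (Re t) in T3 by (destruct t; simpl; ring).
      replace (Im (t - Ci * RtoC Y)) with (Im t - Y)%R in T3 by (destruct t; simpl; ring).
      assert (T4 : Rabs (Im t - Y) <= 8) by (apply Rabs_le; lra).
      unfold K0. lra. }
    set (Q := (K0 + 2 * s + K + 8)%R) in *.
    assert (Hrad : 0 < / 6 * / Cmod c). { apply Rmult_lt_0_compat. lra. apply Rinv_0_lt_compat. lra. }
    destruct (zero_in_disc (fun z => c * G z) p (/ 6 * / Cmod c) (Q + 2) Hrad) as [z [Hz Ez]].
    + intros z _. eexists. apply cder_scal, entire_D, Hd.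
    + destruct (Hin p) as [_ Hp2]. rewrite Cmod_self; lra.
      specialize (Herr p Hp2). rewrite Hmain in Herr.
      replace (c * p - t) with (RtoC 0) in Herr by (unfold p; field; auto).
      rewrite cexp_0 in Herr.
      replace (c * k - E + (t - Ci * Y) + 0 - Ci * Y * (1 - 1)) with (c * k - E + (t - Ci * Y)) in Herr by ring.
      assert (T := Cmod_triangle_rev (c * G p) (c * k - E + (t - Ci * Y))). lra.
    + intros z Hz. destruct (Hin z) as [Hz1 Hz2]. lra.
      assert (Hz3 : Cmod (c * z - t) = (/ 6)%R).
      { replace (c * z - t) with (c * (z - p)) by (unfold p; field; auto). rewrite Cmod_mult, Hz. field. lra. }
      specialize (Herr z Hz2). rewrite Hmain in Herr.
      assert (W := cexp_away_from_1 _ Hz3).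
      set (U := c * k - E + (t - Ci * Y) + (c * z - t)) in *.
      set (V := Ci * Y * (cexp (c * z - t) - 1)) in *.
      assert (HU : Cmod U <= Q + / 6).
      { unfold U. eapply Rle_trans. apply Cmod_triangle. lra. }
      assert (HV : Y * / 12 <= Cmod V).
      { unfold V. rewrite !Cmod_mult, Cmod_Ci, Cmod_R, Rabs_pos_eq, Rmult_1_l by lra. apply Rmult_le_compat_l; lra. }
      assert (T := Cmod_triangle_rev V U). rewrite Cmod_minus_sym in T.
      assert (T2 := Cmod_triangle_rev (U - V) (c * G z)). rewrite (Cmod_minus_sym (U - V)) in T2.
      lra.
    + cbv beta in Ez. destruct (Hin z Hz) as [Hz1 Hz2].
      assert (EG : G z = 0). { replace (G z) with (/ c * (c * G z)) by (field; auto). rewrite Ez. ring. }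
      destruct (Hg z) as [G0 _]. unfold rho; lra. rewrite (H0 z EG) in G0.
      destruct (Hgz z Hz2) as [_ Q2].
      (* At a zero of [G'] the modulus of [E exp (c z)] is at most 3, but it is about [Y] near [t]. *)
      assert (W : E * cexp (c * z) = - cexp (- (gam z - c * z))).
      { replace (cexp (c * z)) with (cexp (gam z) * cexp (- (gam z - c * z))) by (rewrite <- cexp_plus; f_equal; ring).
        replace (E * (cexp (gam z) * cexp (- (gam z - c * z)))) with ((1 + E * cexp (gam z) - 1) * cexp (- (gam z - c * z))) by ring.
        rewrite <- G0. ring. }
      replace (cexp (c * z)) with (cexp t * cexp (c * z - t)) in W by (rewrite <- cexp_plus; f_equal; ring).
      rewrite Cmult_assoc, HEt in W. apply (f_equal Cmod) in W.
      rewrite !Cmod_mult, !Cmod_opp, Cmod_Ci, Cmod_R, Rabs_pos_eq, !Cmod_cexp, Rmult_1_l in W by lra.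
      assert (V1 : exp (Re (- (gam z - c * z))) <= 3).
      { eapply Rle_trans; [|apply exp_le_3]. apply exp_monotone. eapply Rle_trans. apply Re_le_Cmod. rewrite Cmod_opp. exact Q2. }
      assert (V2 : / 2 <= exp (Re (c * z - t))).
      { assert (V3 := exp_ge_1_plus (Re (c * z - t))). assert (V4 := re_le_Cmod (c * z - t)). apply Rabs_le_between in V4. lra. }
      assert (Y * / 2 <= 3). { rewrite <- W in V1. nra. }
      assert (0 < Q) by (unfold Q; lra). lra.
Qed.

(** * Rescaling an exceptional function *)

(** If no such point existed, one could move again and again, each time at least doubling [M] and so
    with geometrically decreasing steps; [M] would be unbounded near the limit. *)
Lemma doubling_point (M : C -> R) (k : R) (z0 : C) : 0 < k ->
  (forall z, exists d B : R, 0 < d /\ forall w, Cmod (w - z) < d -> M w <= B) ->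
  0 < M z0 -> exists z, 0 < M z /\ forall w, Cmod (w - z) < k / M z -> M w <= 2 * M z.
Proof.
  intros Hk Hloc H0. apply NNPP. intros N.
  assert (Hstep : forall z, 0 < M z -> exists w, Cmod (w - z) < k / M z /\ 2 * M z < M w).
  { intros z Hz. apply NNPP. intros N2. apply N. exists z. split; auto.
    intros w Hw. apply Rnot_lt_le. intros L. apply N2. now exists w. }
  set (next := fun z => epsilon (inhabits z0) (fun w => Cmod (w - z) < k / M z /\ 2 * M z < M w)).
  assert (Hnext : forall z, 0 < M z -> Cmod (next z - z) < k / M z /\ 2 * M z < M (next z)).
  { intros z Hz. apply (epsilon_spec (inhabits z0) _ (Hstep z Hz)). }
  set (s := fix s n := match n with O => z0 | S m => next (s m) end).
  set (m := M z0) in *.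
  assert (Hs : forall n, m * 2 ^ n <= M (s n)).
  { induction n. simpl. unfold m. lra.
    assert (P : 0 < M (s n)). { assert (X := pow_lt 2 n ltac:(lra)). nra. }
    destruct (Hnext (s n) P) as [_ X]. change (s (S n)) with (next (s n)). cbn [pow]. lra. }
  assert (Hpow : forall n, 0 < 2 ^ n) by (intros; apply pow_lt; lra).
  assert (Hs0 : forall n, 0 < M (s n)). { intros n. specialize (Hs n). specialize (Hpow n). nra. }
  set (e := fun n => (2 * (k / m) * (/ 2) ^ n)%R).
  assert (Hstep2 : forall n, Cmod (s n - s (S n)) <= e n - e (S n)).
  { intros n. rewrite Cmod_minus_sym. destruct (Hnext (s n) (Hs0 n)) as [X _].
    change (next (s n)) with (s (S n)) in X. left. eapply Rlt_le_trans; [exact X|].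
    unfold e. cbn [pow]. rewrite pow_inv. specialize (Hs n). specialize (Hpow n).
    replace (2 * (k / m) * / 2 ^ n - 2 * (k / m) * (/ 2 * / 2 ^ n))%R with (k / (m * 2 ^ n))%R by (field; lra).
    apply Rmult_le_compat_l. lra. apply Rinv_le_contravar; auto. apply Rmult_lt_0_compat; auto. }
  assert (He0 : forall n, 0 < e n).
  { intros n. unfold e. apply Rmult_lt_0_compat. apply Rmult_lt_0_compat. lra. apply Rdiv_lt_0_compat; auto.
    apply pow_lt. lra. }
  assert (Hcauchy : forall n j, Cmod (s n - s (n + j)%nat) <= e n - e (n + j)%nat).
  { intros n j. induction j.
    - rewrite Nat.add_0_r, Cmod_self. lra.
    - rewrite Nat.add_succ_r. assert (T := Cmod_triangle3 (s n) (s (n + j)%nat) (s (S (n + j)))).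
      specialize (Hstep2 (n + j)%nat). lra. }
  assert (Hcv : Un_cv e 0).
  { intros eps Heps. destruct (pow_lt_1_zero (/ 2) ltac:(rewrite Rabs_pos_eq; lra) (eps / (2 * (k / m)))) as [n0 Hn0].
    - apply Rdiv_lt_0_compat; auto. apply Rmult_lt_0_compat. lra. apply Rdiv_lt_0_compat; auto.
    - exists n0. intros n Hn. specialize (Hn0 n Hn). unfold R_dist. rewrite Rminus_0_r.
      unfold e. rewrite Rabs_mult, (Rabs_pos_eq (2 * (k / m))).
      2:{ apply Rmult_le_pos. lra. left; apply Rdiv_lt_0_compat; auto. }
      assert (P : 0 < 2 * (k / m)). { apply Rmult_lt_0_compat. lra. apply Rdiv_lt_0_compat; auto. }
      apply (Rmult_lt_compat_l _ _ _ P) in Hn0.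
      replace (2 * (k / m) * (eps / (2 * (k / m))))%R with eps in Hn0 by (field; split; lra). exact Hn0. }
  destruct (C_complete s e Hcv) as [l Hl].
  { intros n j Hnj. replace j with (n + (j - n))%nat by lia. specialize (Hcauchy n (j - n)%nat).
    specialize (He0 (n + (j - n))%nat). lra. }
  destruct (Hloc l) as [d [B [Hd HB]]].
  destruct (Hcv d Hd) as [n1 Hn1].
  destruct (Pow_x_infinity 2 ltac:(rewrite Rabs_pos_eq; lra) ((Rabs B + 1) / m)) as [n2 Hn2].
  set (n := max n1 n2).
  specialize (Hn1 n ltac:(lia)). specialize (Hn2 n ltac:(lia)).
  unfold R_dist in Hn1. rewrite Rminus_0_r in Hn1.
  assert (X := HB (s n)). specialize (Hl n). assert (Y := Rle_abs (e n)).
  specialize (X ltac:(lra)).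
  rewrite (Rabs_pos_eq (2 ^ n)) in Hn2 by (left; apply Hpow).
  specialize (Hs n). assert (Z := Rle_abs B).
  apply Rge_le, (Rmult_le_compat_l m) in Hn2; [|lra].
  replace (m * ((Rabs B + 1) / m))%R with (Rabs B + 1)%R in Hn2 by (field; lra). lra.
Qed.

Lemma sqrt_sqr_ge (x : R) : x <= sqrt x * sqrt x.
Proof.
  destruct (Rle_dec 0 x) as [H|H]. rewrite sqrt_sqrt; lra.
  assert (X := sqrt_pos x). nra.
Qed.

(** The function [M = sqrt (|F'| - 1) / |F|], read as zero where [|F'| <= 1], is, where positive, the factor
    [m] for which [m * F (z + w / m)] satisfies the second clause of [normalised_on]. It is locally bounded:
    near a zero of [F] one has [|F'| < 1], so that [M = 0]. If [M] is positive somewhere, rescaling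
    at a point given by [doubling_point] contradicts [no_normalised_exceptional]. Otherwise
    [|F'| <= 1] everywhere, so [F] is affine by Liouville's argument, and a nonconstant affine
    function has a simple zero. *)
Theorem exceptional_constant F : exceptional F -> exists c, forall z, F z = c.
Proof.
  intros [Hd [H0 H1]].
  assert (HDc : forall z, ccont (C_derive F) z).
  { intros z. destruct (holo_derive_at F z 1 Rlt_0_1 (entire_holo _ _ _ Hd)) as [l Hl]. eapply cder_ccont, Hl. }
  assert (HFc : forall z, ccont F z).
  { intros z. destruct (Hd z) as [l Hl]. eapply cder_ccont, Hl. }
  set (M := fun z => (sqrt (Cmod (C_derive F z) - 1) / Cmod (F z))%R).
  assert (HMle : forall z, Cmod (C_derive F z) <= 1 + (M z * Cmod (F z)) * (M z * Cmod (F z))).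
  { intros z. destruct (Ceq_dec (F z) 0) as [E|N].
    - rewrite (H0 z E), E, Cmod_0. lra.
    - apply Cmod_gt_0 in N. replace (M z * Cmod (F z))%R with (sqrt (Cmod (C_derive F z) - 1)) by (unfold M; field; lra).
      assert (X := sqrt_sqr_ge (Cmod (C_derive F z) - 1)). lra. }
  assert (HMnonpos : forall z, Cmod (C_derive F z) <= 1 -> M z = 0%R).
  { intros z Hz. unfold M. rewrite sqrt_neg_0 by lra. unfold Rdiv. ring. }
  destruct (classic (exists z, 0 < M z)) as [[z0 Hz0]|Hno].
  - exfalso.
    destruct no_normalised_exceptional as [R0 [HR0 Hnone]].
    assert (Hloc : forall z, exists d B : R, 0 < d /\ forall w, Cmod (w - z) < d -> M w <= B).
    { intros z. destruct (Ceq_dec (F z) 0) as [E|N].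
      - destruct (HDc z 1 Rlt_0_1) as [d [Hdp Hw]]. exists d, 0%R. split; auto.
        intros w Hwd. specialize (Hw w Hwd). rewrite (H0 z E) in Hw.
        replace (C_derive F w - 0) with (C_derive F w) in Hw by ring. rewrite HMnonpos; lra.
      - apply Cmod_gt_0 in N.
        destruct (HDc z 1 Rlt_0_1) as [d1 [Hd1 Hw1]].
        destruct (HFc z (Cmod (F z) / 2)%R ltac:(lra)) as [d2 [Hd2 Hw2]].
        exists (Rmin d1 d2), (sqrt (Cmod (C_derive F z)) / (Cmod (F z) / 2))%R. split. apply Rmin_pos; auto.
        intros w Hw. specialize (Hw1 w (Rlt_le_trans _ _ _ Hw (Rmin_l _ _))).
        specialize (Hw2 w (Rlt_le_trans _ _ _ Hw (Rmin_r _ _))).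
        assert (T1 := Cmod_triangle_rev (C_derive F w) (C_derive F z)).
        assert (T2 := Cmod_triangle_rev (F z) (F w)). rewrite Cmod_minus_sym in T2.
        unfold M. apply Rmult_le_compat. apply sqrt_pos. left; apply Rinv_0_lt_compat; lra.
        apply sqrt_le_1_alt. lra. apply Rinv_le_contravar; lra. }
    destruct (doubling_point M R0 z0 HR0 Hloc Hz0) as [z1 [Hz1 HM]].
    set (m := M z1) in *.
    assert (Nm : RtoC m <> 0). { intros E. apply RtoC_inj in E. lra. }
    set (G := fun w => RtoC m * F (z1 + / RtoC m * w)).
    assert (HG : forall w, cder G w (C_derive F (z1 + / RtoC m * w))).
    { intros w. eapply cder_eq. apply cder_scal. apply (cder_comp F (fun w => z1 + / RtoC m * w)).
      apply entire_D, Hd. apply cder_plus. apply cder_const. apply cder_scal, cder_id. field. auto. }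
    assert (HDG : forall w, C_derive G w = C_derive F (z1 + / RtoC m * w)).
    { intros w. apply cder_unique, HG. }
    assert (HmG : forall w, Cmod (G w) = (m * Cmod (F (z1 + / RtoC m * w)%C))%R).
    { intros w. unfold G. rewrite Cmod_mult, Cmod_R, Rabs_pos_eq by lra. reflexivity. }
    apply (Hnone G).
    + split; [|split].
      * intros w. eexists. apply HG.
      * intros w E. rewrite HDG. apply H0. unfold G in E.
        replace (F (z1 + / m * w)) with (/ RtoC m * (RtoC m * F (z1 + / RtoC m * w))) by (field; auto).
        rewrite E. ring.
      * intros w. rewrite HDG. apply H1.
    + split.
      * intros w Hw. rewrite HDG, HmG. eapply Rle_trans. apply HMle.
        set (z := z1 + / RtoC m * w) in *.
        assert (Hz : M z <= 2 * m).
        { apply HM. unfold z. replace (z1 + / m * w - z1) with (/ RtoC m * w) by ring.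
          rewrite Cmod_mult, Cmod_inv, Cmod_R, Rabs_pos_eq by (auto; lra).
          rewrite Rmult_comm. apply Rmult_lt_compat_r; auto. apply Rinv_0_lt_compat; lra. }
        assert (Hz2 : 0 <= M z). { unfold M. destruct (Ceq_dec (F z) 0) as [E|N].
          fold (M z). rewrite HMnonpos. lra. rewrite (H0 z E), Cmod_0. lra.
          apply Cmod_gt_0 in N. apply Rmult_le_pos. apply sqrt_pos. left; apply Rinv_0_lt_compat; lra. }
        assert (X := Cmod_ge_0 (F z)).
        assert (Y : M z * Cmod (F z) <= 2 * (m * Cmod (F z))) by nra.
        assert (Y0 : 0 <= M z * Cmod (F z)) by (apply Rmult_le_pos; auto).
        apply Rplus_le_compat_l.
        replace (4 * (m * Cmod (F z) * (m * Cmod (F z))))%R with ((2 * (m * Cmod (F z))) * (2 * (m * Cmod (F z))))%R by ring.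
        apply Rmult_le_compat; auto.
      * rewrite HDG, HmG. replace (z1 + / m * 0) with z1 by ring.
        assert (Hgt : 1 < Cmod (C_derive F z1)).
        { apply Rnot_le_lt. intros L. unfold m in Hz1. rewrite (HMnonpos z1 L) in Hz1. lra. }
        assert (N : 0 < Cmod (F z1)).
        { apply Cmod_gt_0. intros E. rewrite (H0 z1 E), Cmod_0 in Hgt. lra. }
        replace (m * Cmod (F z1))%R with (sqrt (Cmod (C_derive F z1) - 1)) by (unfold m, M; field; lra).
        rewrite sqrt_sqrt; lra.
  - assert (Hle : forall z, Cmod (C_derive F z) <= 1).
    { intros z. apply Rnot_lt_le. intros L. apply Hno. exists z. unfold M.
      apply Rdiv_lt_0_compat. apply sqrt_lt_R0. lra.
      apply Cmod_gt_0. intros E. rewrite (H0 z E), Cmod_0 in L. lra. }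
    assert (HD2 : forall z, cder (C_derive F) z 0).
    { intros z. assert (Hh : forall r, holo (C_derive F) z r) by (intros r; apply holo_derive, entire_holo, Hd).
      assert (X := holo_D _ z 1 z (Hh 1) ltac:(rewrite Cmod_self; lra)).
      replace (C_derive (C_derive F) z) with (RtoC 0) in X. exact X.
      symmetry. apply Cmod_eq_0, Rle_antisym; [|apply Cmod_ge_0]. apply Rnot_lt_le. intros L.
      set (a := Cmod (C_derive (C_derive F) z)) in *.
      assert (Y := cauchy_estimate (C_derive F) z (3 / a) 1 ltac:(apply Rdiv_lt_0_compat; lra) (Hh _)).
      fold a in Y. replace (a * (3 / a))%R with 3%R in Y by (field; lra).
      assert (3 <= 2 * 1) by (apply Y; intros; apply Hle). lra. }
    set (a := C_derive F 0).
    assert (Hconst : forall z, C_derive F z = a).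
    { intros z. apply (derive_0_constant _ 0 (Cmod (z - 0) + 1)). intros; apply HD2. lra. }
    assert (Haff : forall z, F z - a * z = F 0 - a * 0).
    { intros z. apply (derive_0_constant (fun z => F z - a * z) 0 (Cmod (z - 0) + 1)).
      intros w _. eapply cder_eq. apply cder_minus. apply entire_D, Hd. apply cder_scal, cder_id.
      rewrite Hconst. ring. lra. }
    assert (Ea : a = 0).
    { destruct (Ceq_dec a 0) as [E|N]; auto.
      assert (Z : F (- F 0 / a) = 0).
      { specialize (Haff (- F 0 / a)).
        replace (F (- F 0 / a)) with (F (- F 0 / a) - a * (- F 0 / a) + a * (- F 0 / a)) by ring.
        rewrite Haff. field. auto. }
      rewrite <- (Hconst (- F 0 / a)). apply H0, Z. }
    exists (F 0). intros z. specialize (Haff z). rewrite Ea in Haff.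
    replace (F z) with (F z - 0 * z) by ring. rewrite Haff. ring.
Qed.

Theorem lemma1p1 (f : C -> C) (b : C)
    (hf : entire f)
    (hnc : ~ exists c : C, forall z : C, f z = c)
    (hb : b <> RtoC 0)
    (hshare : share_allowing_ramification f b) :
  ~ totally_ramified_value f b.
Proof.
  intros hram.
  assert (Hd : forall z, cder f z (C_derive f z)).
  { intros z. apply cder_C_NormedModule. apply C_derive_correct. exact z. apply hf. }
  set (F := fun z => / b * f z - 1).
  assert (HF : forall z, cder F z (/ b * C_derive f z)).
  { intros z. eapply cder_eq. apply cder_minus. apply cder_scal, Hd. apply cder_const. ring. }
  assert (HDF : forall z, C_derive F z = / b * C_derive f z) by (intros; apply cder_unique, HF).
  assert (Hex : exceptional F).
  { split; [|split].
    - intros z. eexists. apply HF.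
    - intros z E. rewrite HDF. rewrite hram. ring.
      replace (f z) with (b * (F z + 1)) by (unfold F; field; auto). rewrite E. ring.
    - intros z E. rewrite HDF in E.
      assert (E1 : C_derive f z = b).
      { replace (C_derive f z) with (b * (/ b * C_derive f z)) by (field; auto). rewrite E. ring. }
      apply hb. rewrite <- E1. apply hram. apply hshare, E1. }
  destruct (exceptional_constant F Hex) as [c Hc].
  apply hnc. exists (b * (c + 1)). intros z. rewrite <- (Hc z). unfold F. field. auto.
Qed.
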